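(* Let $d\in\{1,2,3\}$. For any smooth function $f$ on $\mathbb{T}^d\times\mathbb{R}^d$, the Fréchet derivative of the functional $[[\mathcal{T},\mathcal{U}],\mathcal{U}]$ at $f$ is of the form $$\frac{\delta[[\mathcal{T},\mathcal{U}],\mathcal{U}]}{\delta f}(f)=K(x,f),$$ i.e. it is a function $K=K(x,f)$ of $x$ only (and of $f$), where $K$ satisfies, with $\phi=\phi(f)$ and $m=m(f)$, $$-\Delta_x K=-2m\,\Delta_x\phi-2\sum_{i,j=1}^d\big(\partial_{x_i}\partial_{x_j}\phi\big)^2+2(\Delta_x\phi)^2 .$$ Denoting by $E_{x_j}$, $j=1,\dots,d$, the components of the electric field $E=E(f)$, in the case $d=2$ this reads $$-\Delta_x K=-2m\,\Delta_x\phi-4\,(\partial_{x_1}E_{x_2})(\partial_{x_2}E_{x_1})+4\,(\partial_{x_1}E_{x_1})(\partial_{x_2}E_{x_2}),$$ and in the case $d=1$ one has $\partial_x K=-2mE$.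
   Context: $\mathbb{T}^d=\mathbb{R}^d/(2\pi\mathbb{Z}^d)$. Points of phase space are $(x,v)\in\mathbb{T}^d\times\mathbb{R}^d$; $\partial_x,\partial_v$ denote gradients in $x$ and $v$, and $\Delta_x=\sum_{i=1}^d\partial_{x_i}^2$. ''Smooth'' function $f=f(x,v)$: $f$ is real-valued, $C^\infty$, and $v^m\partial_x^p\partial_v^q f\in L^2(\mathbb{T}^d\times\mathbb{R}^d)$ for all multi-indices $m,p,q\in\mathbb{N}^d$. Mass: $m(f)=\frac{1}{(2\pi)^d}\int_{\mathbb{T}^d\times\mathbb{R}^d}f\,\mathrm{d}x\,\mathrm{d}v$. Electric potential: $\phi(f)(x)=-\Delta_x^{-1}\Big[\int_{\mathbb{R}^d}f(x,v)\,\mathrm{d}v-m(f)\Big]$, where $\Delta_x$ is inverted on functions on $\mathbb{T}^d$ with zero average. Electric field: $E(f)=-\partial_x\phi(f)$. Functionals: $\mathcal{T}(f)=\int_{\mathbb{T}^d\times\mathbb{R}^d}\frac{|v|^2}{2}f(x,v)\,\mathrm{d}x\,\mathrm{d}v$ and $\mathcal{U}(f)=\int_{\mathbb{T}^d}\frac12|E(f)(x)|^2\,\mathrm{d}x$. Fréchet derivative of a functional $\mathcal{G}$ at $f$: the function (or distribution) $\frac{\delta\mathcal{G}}{\delta f}(f)$ of $(x,v)$ with $\mathcal{G}(f+\delta f)-\mathcal{G}(f)=\int_{\mathbb{T}^d\times\mathbb{R}^d}\frac{\delta\mathcal{G}}{\delta f}(f)\,\delta f\,\mathrm{d}x\,\mathrm{d}v+\mathcal{O}(\delta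 f^2)$ for all smooth variations $\delta f$. Microcanonical bracket of functions of $(x,v)$: $\{f,g\}=\partial_x f\cdot\partial_v g-\partial_v f\cdot\partial_x g$. Poisson bracket of functionals: $[\mathcal{H},\mathcal{G}](f)=\int_{\mathbb{T}^d\times\mathbb{R}^d}\frac{\delta\mathcal{H}}{\delta f}(f)\,\Big\{\frac{\delta\mathcal{G}}{\delta f}(f),f\Big\}\,\mathrm{d}x\,\mathrm{d}v$, which is again a functional of $f$, so brackets can be iterated. *)

(* Defs.v *)
From HB Require Import structures.
From mathcomp Require Import all_boot all_order all_algebra.
From mathcomp Require Import all_classical all_reals all_analysis.

Set Implicit Arguments.
Unset Strict Implicit.
Unset Printing Implicit Defensive.
Import Order.TTheory GRing.Theory Num.Theory.
Import numFieldNormedType.Exports.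
Local Open Scope classical_set_scope.
Local Open Scope ring_scope.

(* The n-fold product of a sigma-finite measure, as a measure on n-tuples.    *)
Section tuple_power.
Context {d : measure_display} {T : measurableType d} {R : realType}.
Local Open Scope ereal_scope.

Definition tuple_cons (n : nat) (p : T * n.-tuple T) : n.+1.-tuple T :=
  [tuple of p.1 :: p.2].

Lemma measurable_tuple_cons (n : nat) :
  measurable_fun [set: T * n.-tuple T] (@tuple_cons n).
Proof. exact: measurable_cons. Qed.

Section step.
Variables (mu : {sigma_finite_measure set T -> \bar R}) (n : nat)
  (nu : {sigma_finite_measure set (n.-tuple T) -> \bar R}).

Definition tuple_power_step : set (n.+1.-tuple T) -> \bar R :=
  pushforward (mu \x nu) (@tuple_cons n).

Let step0 : tuple_power_step set0 = 0.
Proof. by rewrite /tuple_power_step /pushforward preimage_set0 measure0. Qed.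

Let step_ge0 A : 0 <= tuple_power_step A.
Proof. by rewrite /tuple_power_step /pushforward; exact: measure_ge0. Qed.

Let step_sigma_additive : semi_sigma_additive tuple_power_step.
Proof.
move=> F mF tF mUF; rewrite /tuple_power_step /pushforward preimage_bigcup.
have mc := @measurable_tuple_cons n.
apply: measure_semi_sigma_additive.
- by move=> k; rewrite -[X in measurable X]setTI; exact: mc.
- apply/trivIsetP => /= i j _ _ ij; rewrite -preimage_setI.
  by move/trivIsetP : tF => /(_ _ _ _ _ ij) ->//; rewrite preimage_set0.
- by rewrite -preimage_bigcup -[X in measurable X]setTI; exact: mc.
Qed.

HB.instance Definition _ := isMeasure.Build _ _ _
  tuple_power_step step0 step_ge0 step_sigma_additive.

Let step_sigma_finite : sigma_finite [set: n.+1.-tuple T] tuple_power_step.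
Proof.
have /sigma_finiteP[A [TA ndA Aoo]] := sigma_finiteT mu.
have /sigma_finiteP[B [TB ndB Boo]] := sigma_finiteT nu.
have TF : [set: T * n.-tuple T] = \bigcup_k (A k `*` B k).
  rewrite -setXTT TA TB predeqE => -[x y]; split.
    move=> [/= [k _ Akx] [l _ Bly]]; exists (maxn k l) => //; split.
    - by move: x Akx; exact/subsetPset/ndA/leq_maxl.
    - by move: y Bly; exact/subsetPset/ndB/leq_maxr.
  by move=> [k _ []/= ? ?]; split; exists k.
have mF k : measurable (A k `*` B k) /\ (mu \x nu) (A k `*` B k) < +oo.
  have [? ?] := Aoo k; have [? ?] := Boo k.
  split; first exact: measurableX.
  by rewrite product_measure1E// lte_mul_pinfty// ge0_fin_numE.
pose g (t : n.+1.-tuple T) : T * n.-tuple T := (thead t, [tuple of behead t]).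
have mg : measurable_fun setT g.
  apply: measurable_fun_pair; last exact: measurable_behead.
  exact: measurable_tnth.
have gK : cancel (@tuple_cons n) g.
  by case=> x t; rewrite /g theadE /=; congr pair; exact/val_inj.
exists (fun k => g @^-1` (A k `*` B k)).
  by rewrite -preimage_bigcup -TF preimage_setT.
move=> k; split.
  by rewrite -[X in measurable X]setTI; apply: mg => //; exact: (mF k).1.
rewrite /tuple_power_step /pushforward -comp_preimage.
have -> : g \o @tuple_cons n = id by apply/funext => p; exact: gK.
by rewrite preimage_id; exact: (mF k).2.
Qed.

HB.instance Definition _ := Measure_isSigmaFinite.Build _ _ _
  tuple_power_step step_sigma_finite.
End step.

Fixpoint tuple_power (mu : {sigma_finite_measure set T -> \bar R}) (n : nat) :
    {sigma_finite_measure set (n.-tuple T) -> \bar R} :=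
  match n with
  | 0 => \d_([tuple] : 0.-tuple T)
  | k.+1 => tuple_power_step mu (tuple_power mu k)
  end.
End tuple_power.

(* Lebesgue measure of the circle R / 2 pi Z, on the period cell [0, 2 pi[.   *)
Section circle.
Context {R : realType}.

Let cell : measurable (`[0%R, 2 * pi[ : set R) := measurable_itv _.

Definition circle_measure := mrestr (@lebesgue_measure R) cell.

HB.instance Definition _ := Measure.on circle_measure.

Let circle_sigma_finite : sigma_finite [set: R] circle_measure.
Proof.
have [F TF mF] : sigma_finite setT (@lebesgue_measure R).
  exact: sigma_finiteT.
exists F => // k; split; first exact: (mF k).1.
apply: le_lt_trans (mF k).2; apply: le_measure; rewrite ?inE.
- by apply: measurableI => //; exact: (mF k).1.
- exact: (mF k).1.
- exact: subIsetl.
Qed.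

HB.instance Definition _ := Measure_isSigmaFinite.Build _ _ _
  circle_measure circle_sigma_finite.
End circle.

Section Calculus.
Context {R : realType}.

Fixpoint Ck (W : normedModType R) (k : nat) (F : W -> R) : Prop :=
  match k with
  | 0 => continuous F
  | k'.+1 => (forall z, differentiable F z) /\
             (forall w, @Ck W k' (fun z => 'D_w F z))
  end.

Definition Cinfty (W : normedModType R) (F : W -> R) : Prop :=
  forall k, Ck k F.
End Calculus.

Section VlasovPoisson.
Context {R : realType} {d : nat}.

(* Positions live on the universal cover R^d of the torus: a function on the  *)
(* torus is a function of x that is 2 pi-periodic in each coordinate.         *)
Local Notation V := 'rV[R]_d.
Local Notation phase := (V * V)%type.

Implicit Types (u : V -> R) (f g : phase -> R).

Definition basis (i : 'I_d) : V := delta_mx 0 i.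

Definition row_of_tuple (t : d.-tuple R) : V := \row_i tnth t i.

Definition phase_of_tuples (p : d.-tuple R * d.-tuple R) : phase :=
  (row_of_tuple p.1, row_of_tuple p.2).

Definition torus_measure := tuple_power (@circle_measure R) d.
Definition velocity_measure := tuple_power (@lebesgue_measure R) d.
Definition phase_measure := (torus_measure \x velocity_measure)%E.

Definition int_torus u : R := \int[torus_measure]_t u (row_of_tuple t).
Definition int_velocity u : R := \int[velocity_measure]_t u (row_of_tuple t).
Definition int_phase f : R := \int[phase_measure]_p f (phase_of_tuples p).
Definition integrable_phase f : Prop :=
  phase_measure.-integrable setT (fun p => (f (phase_of_tuples p))%:E).

Definition periodic u : Prop :=
  forall (i : 'I_d) x, u (x + (2 * pi) *: basis i) = u x.
Definition periodic_phase f : Prop := forall v, periodic (fun x => f (x, v)).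

Definition partial (i : 'I_d) u : V -> R := fun x => 'D_(basis i) u x.
Definition partialx (i : 'I_d) f : phase -> R :=
  fun z => 'D_((basis i, 0) : phase) f z.
Definition partialv (i : 'I_d) f : phase -> R :=
  fun z => 'D_((0, basis i) : phase) f z.

Definition laplacian u : V -> R :=
  fun x => \sum_(i < d) partial i (partial i u) x.

Definition multi_partial (D : 'I_d -> (phase -> R) -> phase -> R)
    (p : 'I_d -> nat) f : phase -> R :=
  foldr (fun i g => iter (p i) (D i) g) f (enum 'I_d).

(* v^m d_x^p d_v^q f *)
Definition weighted_partial (m p q : 'I_d -> nat) f : phase -> R := fun z =>
  (\prod_(i < d) z.2 0 i ^+ m i) *
  multi_partial partialx p (multi_partial partialv q f) z.

Definition smooth f : Prop :=
  [/\ periodic_phase f, Cinfty f &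
      forall m p q : 'I_d -> nat,
        weighted_partial m p q f \o phase_of_tuples
          \in Lfun phase_measure 2%:E].

Definition L2norm f : R :=
  fine ('N[phase_measure]_(2%:E) [EFin \o (f \o phase_of_tuples)])%E.

(* These norms, for N : nat, generate the natural Frechet topology of the     *)
(* space of smooth functions.                                                 *)
Definition smooth_norm (N : nat) f : R :=
  \sum_(m : {ffun 'I_d -> 'I_N.+1}) \sum_(p : {ffun 'I_d -> 'I_N.+1})
  \sum_(q : {ffun 'I_d -> 'I_N.+1})
    L2norm (weighted_partial (fun i => m i) (fun i => p i) (fun i => q i) f).

Definition mass f : R := ((2 * pi) ^+ d)^-1 * int_phase f.

Definition density f : V -> R := fun x => int_velocity (fun v => f (x, v)).

Definition inv_laplacian (h : V -> R) : V -> R :=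
  xget (fun=> 0)
    [set u | [/\ periodic u, Cinfty u, int_torus u = 0 &
                 forall x, laplacian u x = h x]].

Definition potential f : V -> R :=
  fun x => - inv_laplacian (fun y => density f y - mass f) x.

Definition field f (i : 'I_d) : V -> R := fun x => - partial i (potential f) x.

Definition functional : Type := (phase -> R) -> R.
Implicit Types G H : functional.

(* The norm of 'rV[R]_d is the sup norm, hence the explicit sums of squares.  *)
Definition kinetic : functional := fun f =>
  int_phase (fun z => (\sum_(i < d) z.2 0 i ^+ 2) / 2 * f z).

Definition electric : functional := fun f =>
  int_torus (fun x => 2^-1 * \sum_(i < d) field f i x ^+ 2).

(* The derivative is sought among C^oo functions on the phase space, on which *)
(* it is unique. The remainder O(df^2) is relative to the topology of the     *)
(* space of smooth functions: it is bounded by the square of one of its       *)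
(* defining norms, uniformly for df in the unit ball of that norm.            *)
Definition is_frechet_derivative G f g : Prop :=
  [/\ periodic_phase g, Cinfty g,
      forall df, smooth df -> integrable_phase (fun z => g z * df z) &
      exists (N : nat) (C : R), forall df, smooth df ->
        smooth_norm N df <= 1 ->
        `|G (fun z => f z + df z) - G f - int_phase (fun z => g z * df z)|
          <= C * smooth_norm N df ^+ 2].

Definition frechet_derivative G f : phase -> R :=
  xget (fun=> 0) [set g | is_frechet_derivative G f g].

Definition micro_bracket f g : phase -> R := fun z =>
  \sum_(i < d) (partialx i f z * partialv i g z
                - partialv i f z * partialx i g z).

Definition poisson_bracket H G : functional := fun f =>
  int_phase (fun z => frechet_derivative H f z *
                      micro_bracket (frechet_derivative G f) f z).

End VlasovPoisson.

(* Main.v *)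
(* Everything is computed on the density rho, the fluxes J_i and the potential
   phi of f. Integration by parts in v and x gives, with angular brackets for
   integrals over the torus,
     [T, U](f) = - < grad phi, J >,   [[T, U], U](f) = < |grad phi|^2, rho >,
   because d T / d f = |v|^2 / 2 and d U / d f = phi, and the derivative of the
   first is psi - v . grad phi with - Delta psi = div J. The derivative of the
   second is K = |grad phi|^2 + chi with - Delta chi = - 2 div (rho grad phi),
   and substituting rho = m - Delta phi yields the formula for Delta K. In
   dimension one K - 2 m phi is harmonic, hence constant.
     Three analytic facts support this. The Poisson equation is solved by summing
   the iterates of a Gaussian average over time 2 pi, a strict contraction on
   mean zero functions by Doeblin's argument, against the potential of the heat
   flow up to that time; this also bounds u by a multiple of sup |Delta u|.
   Densities of smooth functions are C^oo and controlled by the norms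
   [smooth_norm] through Sobolev's embedding on the torus and Cauchy-Schwarz in
   v. Finally, test functions compactly supported in v show that a functional
   has at most one smooth derivative. *)
From HB Require Import structures.
Require Import Defs.
From mathcomp Require Import all_boot all_order all_algebra.
From mathcomp Require Import all_classical all_reals all_analysis.
From mathcomp Require Import measurable_realfun zify ring lra.

Set Implicit Arguments.
Unset Strict Implicit.
Unset Printing Implicit Defensive.
Import Order.TTheory GRing.Theory Num.Theory.
Import numFieldNormedType.Exports.
Local Open Scope classical_set_scope.
Local Open Scope ring_scope.

(** * Smooth functions *)

Section calculus.
Context {R : realType}.

(** [inv_laplacian] and [frechet_derivative] are choices with default value 0, so nothing inside a
    bracket can be evaluated before existence and uniqueness are known. Hence each functional gets a
    closed formula on smooth functions, a candidate derivative and an explicit remainder. The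
    remainders are explicit because density, fluxes and potential are linear in [f]: the electric
    energy and the brackets are polynomials of degree at most three in these quantities, and a
    pairing with the potential of the variation becomes a pairing with its density by
    self-adjointness of the inverse Laplacian. Averages of translates commute with all derivatives
    and preserve periodicity. The smoothness of a solution of the Poisson equation is therefore
    inherited term by term from the data, and one sup bound takes the place of elliptic regularity
    and of Fourier series. Sobolev's embedding and the gradient bound for the potential lose
    derivatives, which is harmless because the remainder may be measured in a norm of any order. *)

Lemma is_derive_line (W : normedModType R) (F : W -> R) (x h : W) (t : R) :
  differentiable F (x + t *: h) ->
  is_derive t 1 (fun s : R => F (x + s *: h)) ('D_h F (x + t *: h)).
Proof.
move=> dF.
have E : (fun a : R => a^-1 *: (((fun s : R => F (x + s *: h)) \o shift t) (a *: 1)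
    - F (x + t *: h))) =
  (fun a : R => a^-1 *: ((F \o shift (x + t *: h)) (a *: h) - F (x + t *: h))).
  apply/funext => a /=; congr (_ *: (F _ - _)).
  by rewrite scalerDl [_ *: 1]mulr1 addrCA.
apply: DeriveDef; first by rewrite /derivable E; exact: diff_derivable.
by rewrite /derive E.
Qed.

Lemma MVT_line (W : normedModType R) (F : W -> R) (x h : W) :
  (forall z, differentiable F z) ->
  exists2 t : R, 0 <= t <= 1 & F (x + h) - F x = 'D_h F (x + t *: h).
Proof.
move=> dF.
have dl t : is_derive t (1:R) (fun s : R => F (x + s *: h)) ('D_h F (x + t *: h)).
  exact/is_derive_line/dF.
have cl : {within `[(0:R), 1], continuous (fun s : R => F (x + s *: h))}.
  apply: continuous_subspaceT => t.
  apply/differentiable_continuous/derivable1_diffP.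
  by have [] := dl t.
have [c] := MVT_segment ler01 (fun t _ => dl t) cl.
rewrite in_itv /= => c01; rewrite scale1r scale0r addr0 subr0 mulr1 => ->.
by exists c.
Qed.

(** A remainder bounded by a square is the form of differentiability that passes through integrals:
    such a bound for the integrand integrates to the same kind of bound for the integral, with no
    uniformity of an o(h) to discuss. *)
Lemma differentiable_quadratic (W : normedModType R) (F : W -> R)
    (L : {linear W -> R}) (x : W) (C : R) : continuous L ->
  (forall h, `|F (x + h) - F x - L h| <= C * `|h| ^+ 2) ->
  differentiable F x /\ forall w, 'D_w F x = L w.
Proof.
move=> cL HF.
have HL : F \o shift x = cst (F x) + L +o_ 0 id.
  apply/eqaddoP => e e0; near=> h.
  rewrite /= !fctE /= opprD addrA addrC (addrC h) -[X in `|X|]addrC.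
  rewrite (le_trans (HF h))// expr2 mulrA ler_wpM2r//.
  have : `|C| * `|h| <= e.
    near: h; apply/nbhs_normP; exists (e / (`|C| + 1)) => /=; first by rewrite divr_gt0// ltr_wpDl.
    move=> h /=; rewrite sub0r normrN ltr_pdivlMr ?ltr_wpDl// => hh.
    rewrite (le_trans _ (ltW hh))// mulrC ler_wpM2l// lerDl //.
  by apply: le_trans; rewrite ler_wpM2r// ler_norm.
have dF : differentiable F x.
  apply/diff_locallyP; rewrite (diff_unique cL HL); split => //.
split=> // w; rewrite deriveE// (diff_unique cL HL)//.
Unshelve. all: by end_near. Qed.

End calculus.

(** * Closure properties of C^k and C^oo functions, symmetry of second derivatives *)

Section Ck_theory.
Context {R : realType}.
Implicit Types W : normedModType R.

Lemma deriveZdir W (F : W -> R) (z w : W) (a : R) : differentiable F z ->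
  'D_(a *: w) F z = a * 'D_w F z.
Proof. by move=> dF; rewrite !deriveE// linearZ. Qed.

Lemma Ck_continuous W k (F : W -> R) : Ck k F -> continuous F.
Proof. by case: k => // k [dF _] z; exact/differentiable_continuous. Qed.

Lemma CkS W k (F : W -> R) : Ck k.+1 F -> Ck k F.
Proof.
elim: k F => [|k IH] F; first exact: Ck_continuous.
by case=> dF HF; split=> // w; exact: IH.
Qed.

Lemma Cinfty_continuous W (F : W -> R) : Cinfty F -> continuous F.
Proof. by move=> /(_ 0). Qed.

Lemma Cinfty_diff W (F : W -> R) : Cinfty F -> forall z, differentiable F z.
Proof. by move=> /(_ 1)[]. Qed.

Lemma Cinfty_derive W (F : W -> R) w : Cinfty F -> Cinfty (fun z => 'D_w F z : R).
Proof. by move=> CF k; have [_] := CF k.+1; exact. Qed.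

Lemma Ck_cst W k (c : R) : Ck k (fun _ : W => c).
Proof.
elim: k c => [|k IH] c; first by move=> z; exact: cvg_cst.
split=> [z|w]; first exact: differentiable_cst.
have -> : (fun z : W => 'D_w (fun=> c) z : R) = fun=> 0.
  by apply/funext => z; exact: derive_cst.
exact: IH.
Qed.

Lemma CkD W k (F G : W -> R) : Ck k F -> Ck k G -> Ck k (fun z => F z + G z).
Proof.
elim: k F G => [|k IH] F G; first by move=> cF cG z; apply: cvgD; [exact: cF|exact: cG].
move=> [dF HF] [dG HG]; split=> [z|w]; first exact: differentiableD.
have -> : (fun z => 'D_w (fun z => F z + G z) z : R) =
    (fun z => 'D_w F z + 'D_w G z).
  by apply/funext => z; apply: deriveD; exact: diff_derivable.
exact: IH (HF w) (HG w).
Qed.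

Lemma CkM W k (F G : W -> R) : Ck k F -> Ck k G -> Ck k (fun z => F z * G z).
Proof.
elim: k F G => [|k IH] F G; first by move=> cF cG z; apply: cvgM; [exact: cF|exact: cG].
move=> CF CG; have [dF HF] := CF; have [dG HG] := CG.
split=> [z|w]; first exact: differentiableM.
have -> : (fun z => 'D_w (fun z => F z * G z) z : R) =
    (fun z => F z * 'D_w G z + G z * 'D_w F z).
  by apply/funext => z; apply: deriveM; exact: diff_derivable.
apply: CkD; [exact: IH (CkS CF) (HG w)|exact: IH (CkS CG) (HF w)].
Qed.

Lemma Cinfty_cst W (c : R) : Cinfty (fun _ : W => c).
Proof. by move=> k; exact: Ck_cst. Qed.

Lemma CinftyD W (F G : W -> R) : Cinfty F -> Cinfty G -> Cinfty (fun z => F z + G z).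
Proof. by move=> CF CG k; exact: CkD. Qed.

Lemma CinftyM W (F G : W -> R) : Cinfty F -> Cinfty G -> Cinfty (fun z => F z * G z).
Proof. by move=> CF CG k; exact: CkM. Qed.

Lemma CinftyZ W (c : R) (F : W -> R) : Cinfty F -> Cinfty (fun z => c * F z).
Proof. by move=> CF; apply: CinftyM => //; exact: Cinfty_cst. Qed.

Lemma CinftyN W (F : W -> R) : Cinfty F -> Cinfty (fun z => - F z).
Proof.
by move=> CF; under eq_fun do rewrite -mulN1r; exact: CinftyZ.
Qed.

Lemma CinftyB W (F G : W -> R) : Cinfty F -> Cinfty G -> Cinfty (fun z => F z - G z).
Proof. by move=> CF CG; apply: CinftyD => //; exact: CinftyN. Qed.

Lemma Cinfty_sum W (I : Type) (s : seq I) (F : I -> W -> R) :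
  (forall i, Cinfty (F i)) -> Cinfty (fun z => \sum_(i <- s) F i z).
Proof.
move=> CF; elim: s => [|i s IH].
  by under eq_fun do rewrite big_nil; exact: Cinfty_cst.
by under eq_fun do rewrite big_cons; exact: CinftyD.
Qed.

Lemma Cinfty_prod W (I : Type) (s : seq I) (F : I -> W -> R) :
  (forall i, Cinfty (F i)) -> Cinfty (fun z => \prod_(i <- s) F i z).
Proof.
move=> CF; elim: s => [|i s IH].
  by under eq_fun do rewrite big_nil; exact: Cinfty_cst.
by under eq_fun do rewrite big_cons; exact: CinftyM.
Qed.

Lemma CinftyX W (F : W -> R) n : Cinfty F -> Cinfty (fun z => F z ^+ n).
Proof.
move=> CF; elim: n => [|n IH].
  by under eq_fun do rewrite expr0; exact: Cinfty_cst.
by under eq_fun do rewrite exprS; exact: CinftyM.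
Qed.

Lemma differentiable_affine (W1 W2 : normedModType R) (L : W1 -> W2) (b : W2) (F : W2 -> R) z :
  linear L -> continuous L -> differentiable F (L z + b) ->
  differentiable (fun z => F (L z + b)) z /\
  forall w, 'D_w (fun z => F (L z + b)) z = 'D_(L w) F (L z + b).
Proof.
move=> lL cL dF.
pose LM := GRing.isLinear.Build _ _ _ _ _ lL.
pose LL : {linear W1 -> W2} := HB.pack L LM.
have dL : differentiable LL z by exact: linear_differentiable.
split.
  apply: (@differentiable_comp _ _ _ _ (fun z => L z + b) F) => //.
  by apply: differentiableD; [exact: dL|exact: differentiable_cst].
move=> w; rewrite /derive [X in lim (X @ _) = _](_ : _ =
  (fun h => h^-1 *: ((F \o shift (L z + b)) (h *: L w) - F (L z + b))))//.
apply/funext => a /=; congr (_ *: (F _ - _)).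
by rewrite -[L]/(LL : _ -> _) linearD linearZ/= addrA.
Qed.

Lemma Ck_affine (W1 W2 : normedModType R) (L : W1 -> W2) (b : W2) (F : W2 -> R) k :
  linear L -> continuous L -> Ck k F -> Ck k (fun z => F (L z + b)).
Proof.
move=> lL cL; elim: k F => [F cF z|k IH F [dF HF]].
  apply: (@continuous_comp _ _ _ (fun z => L z + b) F); last exact: cF.
  by apply: cvgD; [exact: cL|exact: cvg_cst].
split=> [z|w]; first by have [] := differentiable_affine lL cL (dF (L z + b)).
have -> : (fun z => 'D_w (fun z => F (L z + b)) z : R) =
    (fun z => (fun y => 'D_(L w) F y : R) (L z + b)).
  by apply/funext => z; have [_ ->] := differentiable_affine lL cL (dF (L z + b)).
exact: IH (HF (L w)).
Qed.

Lemma Cinfty_affine (W1 W2 : normedModType R) (L : W1 -> W2) (b : W2) (F : W2 -> R) :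
  linear L -> continuous L -> Cinfty F -> Cinfty (fun z => F (L z + b)).
Proof. by move=> lL cL CF k; exact: Ck_affine. Qed.

Lemma Cinfty_linear W (L : W -> R) : linear L -> continuous L -> Cinfty L.
Proof.
move=> lL cL.
pose LM := GRing.isLinear.Build _ _ _ _ _ lL.
pose LL : {linear W -> R} := HB.pack L LM.
have dL z : differentiable LL z by exact: linear_differentiable.
case=> //= k; split=> [z|w]; first exact: dL.
have -> : (fun z => 'D_w L z : R) = fun=> L w.
  apply/funext => z; rewrite (deriveE w (dL z)); by rewrite diff_lin.
exact: Ck_cst.
Qed.

Lemma differentiable_comp1 W (psi : R -> R) (dpsi : R) (G : W -> R) z :
  is_derive (G z) 1 psi dpsi -> differentiable G z ->
  differentiable (fun z => psi (G z)) z /\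
  forall w, 'D_w (fun z => psi (G z)) z = dpsi * 'D_w G z.
Proof.
move=> dp dG.
have dpsi' : differentiable psi (G z) by apply/derivable1_diffP; case: dp.
have dc : differentiable (psi \o G) z by exact: differentiable_comp.
split=> // w.
rewrite [LHS](deriveE w dc) (diff_comp dG dpsi')/= diff1E//.
by rewrite derive1E derive_val deriveE// [_ *: _]mulrC.
Qed.

(** The outer function comes with the tower [psi] of its successive derivatives, because
    differentiating the composite replaces [psi j] by [psi j.+1]. The tower is constant for [expR]
    and is [bump] for the cutoff functions. *)
Lemma Ck_comp1 W (psi : nat -> R -> R) (G : W -> R) k j :
  (forall j (t : R), is_derive t 1 (psi j) (psi j.+1 t)) ->
  Ck k G -> Ck k (fun z => psi j (G z)).
Proof.
move=> dpsi; elim: k j => [j cG z|k IH j CG].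
  apply: (@continuous_comp _ _ _ G (psi j)); first exact: cG.
  by apply/differentiable_continuous/derivable1_diffP; case: (dpsi j (G z)).
have [dG HG] := CG; split=> [z|w].
  by have [] := differentiable_comp1 (dpsi j (G z)) (dG z).
have -> : (fun z => 'D_w (fun z => psi j (G z)) z : R) =
    (fun z => psi j.+1 (G z) * 'D_w G z).
  by apply/funext => z; have [_ ->] := differentiable_comp1 (dpsi j (G z)) (dG z).
exact: CkM (IH _ (CkS CG)) (HG w).
Qed.

Lemma Cinfty_comp1 W (psi : nat -> R -> R) (G : W -> R) j :
  (forall j (t : R), is_derive t 1 (psi j) (psi j.+1 t)) ->
  Cinfty G -> Cinfty (fun z => psi j (G z)).
Proof. by move=> dpsi CG k; exact: Ck_comp1. Qed.

(** The mean value theorem is used twice: for the increment [F (z + s *: w) - F z] in direction [v],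
    and for ['D_v F] in direction [w]. *)
Lemma second_difference W (F : W -> R) (x v w : W) (s : R) : Ck 2 F ->
  exists2 pq : R * R, (0 <= pq.1 <= 1) && (0 <= pq.2 <= 1) &
  F (x + s *: v + s *: w) - F (x + s *: v) - (F (x + s *: w) - F x) =
  s * (s * 'D_w (fun z => 'D_v F z : R) (x + (pq.1 * s) *: v + (pq.2 * s) *: w)).
Proof.
move=> [dF HF].
have lid : linear (@idfun W) by [].
have cid : continuous (@idfun W) by move=> z; exact: cvg_id.
pose G z := F (z + s *: w) - F z.
have dG z : differentiable G z.
  apply: differentiableB => //.
  by have [] := differentiable_affine lid cid (dF (z + s *: w)).
have [p p01 Ep] := @MVT_line R W G x (s *: v) dG.
have DG z : 'D_v G z = 'D_v F (z + s *: w) - 'D_v F z.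
  have [h1 h2] := differentiable_affine lid cid (dF (z + s *: w)).
  rewrite [LHS](@deriveB _ _ _ (fun z => F (z + s *: w)) F) ?h2//;
    exact: diff_derivable.
have [q q01 Eq] := @MVT_line R W _ (x + (p * s) *: v) (s *: w) (HF v).1.
exists (p, q) => /=; first by rewrite p01.
have -> : F (x + s *: v + s *: w) - F (x + s *: v) - (F (x + s *: w) - F x) =
  G (x + s *: v) - G x by rewrite /G.
rewrite Ep deriveZdir// DG scalerA Eq deriveZdir ?scalerA//.
exact: (HF v).1.
Qed.

(** Schwarz's theorem. The mixed second difference is symmetric in [v] and [w], so the two mixed
    derivatives take a common value at two points arbitrarily close to [x]. *)
Lemma derive_commute W (F : W -> R) (v w x : W) : Ck 2 F ->
  'D_w (fun z => 'D_v F z : R) x = 'D_v (fun z => 'D_w F z : R) x.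
Proof.
move=> CF; apply/eqP; rewrite eq_sym -subr_eq0 -normr_le0.
apply/ler_addgt0Pr => e e0; rewrite add0r.
have cD v1 w1 : continuous (fun z => 'D_w1 (fun z => 'D_v1 F z : R) z : R).
  by have [_ /(_ v1)[_ /(_ w1)]] := CF.
have e2 : 0 < e / 2 by rewrite divr_gt0.
have /cvgrPdist_lt/(_ _ e2)/nbhs_normP[d1 /= d10 H1] := cD v w x.
have /cvgrPdist_lt/(_ _ e2)/nbhs_normP[d2 /= d20 H2] := cD w v x.
pose d := Num.min d1 d2; have d0 : 0 < d by rewrite lt_min d10.
(* With this step every point [x + (p * s) *: v + (q * s) *: w], [p] and [q] in [0, 1], stays within
   [d] of [x]; the extra 1 handles [v = w = 0]. *)
pose s := d / (`|v| + `|w| + 1).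
have N0 : 0 < `|v| + `|w| + 1 by rewrite ltr_wpDl// addr_ge0.
have s0 : 0 < s by rewrite divr_gt0.
have Es : s = d / (`|v| + `|w| + 1) by [].
clearbody s.
have close p q (v1 w1 : W) : 0 <= p <= 1 -> 0 <= q <= 1 ->
    `|v1| + `|w1| = `|v| + `|w| ->
    `|x - (x + (p * s) *: v1 + (q * s) *: w1)| < d.
  move=> /andP[p0 p1] /andP[q0 q1] Evw.
  rewrite -addrA opprD addNKr normrN (le_lt_trans (ler_normD _ _))//.
  rewrite (normrZ _ v1) (normrZ _ w1) 2!normrM (ger0_norm p0) (ger0_norm q0) (gtr0_norm s0).
  apply: (@le_lt_trans _ _ (s * (`|v1| + `|w1|))).
    rewrite mulrDr lerD// ler_wpM2r// ler_piMl// ltW//.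
  by rewrite Evw Es mulrAC ltr_pdivrMr// ltr_pM2l// ltrDl.
have [[p q] /= /andP[p01 q01] E1] := second_difference x v w s CF.
have [[p' q'] /= /andP[p01' q01'] E2] := second_difference x w v s CF.
have E3 : F (x + s *: v + s *: w) - F (x + s *: v) - (F (x + s *: w) - F x) =
  F (x + s *: w + s *: v) - F (x + s *: w) - (F (x + s *: v) - F x).
  by rewrite [x + s *: w + s *: v]addrAC; ring.
move: E3; rewrite E1 E2 => /(mulfI (lt0r_neq0 s0))/(mulfI (lt0r_neq0 s0)) E.
have dd1 : d <= d1 by rewrite ge_min lexx.
have dd2 : d <= d2 by rewrite ge_min lexx orbT.
have {}H1 := H1 _ (lt_le_trans (close p q v w p01 q01 erefl) dd1).
have {}H2 := H2 _ (lt_le_trans (close p' q' w v p01' q01' (addrC _ _)) dd2).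
rewrite /= in H1 H2.
rewrite [leRHS]splitr; apply: (le_trans _ (lerD (ltW H2) (ltW H1))).
rewrite -E [X in _ <= _ + X]distrC.
apply: le_trans (ler_normD _ _).
by rewrite subrKA.
Qed.

End Ck_theory.

(** * Iterated derivatives along words of directions *)

Section iterated_derivatives.
Context {R : realType}.

(** Mixed derivatives are indexed by words of directions: concatenation composes them, inductions
    add one letter, and symmetry becomes invariance under permutation. *)
Definition iter_derive (W : normedModType R) (s : seq W) (F : W -> R) : W -> R :=
  foldr (fun w G z => 'D_w G z) F s.

Lemma Cinfty_iter_derive (W : normedModType R) (s : seq W) (F : W -> R) :
  Cinfty F -> Cinfty (iter_derive s F).
Proof. by move=> CF; elim: s => //= w s IH; exact: Cinfty_derive. Qed.

Lemma iter_derive_cat (W : normedModType R) (s t : seq W) (F : W -> R) :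
  iter_derive (s ++ t) F = iter_derive s (iter_derive t F).
Proof. by rewrite /iter_derive foldr_cat. Qed.

Lemma iter_deriveD (W : normedModType R) (s : seq W) (F G : W -> R) :
  Cinfty F -> Cinfty G ->
  iter_derive s (fun z => F z + G z) = fun z => iter_derive s F z + iter_derive s G z.
Proof.
move=> CF CG; elim: s => //= w s ->; apply/funext => z.
by apply: deriveD; apply: diff_derivable; apply: Cinfty_diff;
  exact: Cinfty_iter_derive.
Qed.

Lemma iter_deriveZ (W : normedModType R) (s : seq W) (F : W -> R) (c : R) :
  Cinfty F -> iter_derive s (fun z => c * F z) = fun z => c * iter_derive s F z.
Proof.
move=> CF; elim: s => //= w s ->; apply/funext => z.
by apply: deriveZ; apply: diff_derivable; apply: Cinfty_diff;
  exact: Cinfty_iter_derive.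
Qed.

Lemma iter_deriveN (W : normedModType R) (s : seq W) (F : W -> R) :
  Cinfty F -> iter_derive s (fun z => - F z) = fun z => - iter_derive s F z.
Proof.
move=> CF; under eq_fun do rewrite -mulN1r.
by rewrite iter_deriveZ//; apply/funext => z; rewrite mulN1r.
Qed.

Lemma iter_derive_sum (W : normedModType R) (s : seq W) (I : Type) (r : seq I)
    (F : I -> W -> R) : (forall i, Cinfty (F i)) ->
  iter_derive s (fun z => \sum_(i <- r) F i z) =
  fun z => \sum_(i <- r) iter_derive s (F i) z.
Proof.
move=> CF; elim: r => [|i r IH].
  under eq_fun do rewrite big_nil; rewrite [RHS](_ : _ = fun=> 0); last first.
    by apply/funext => z; rewrite big_nil.
  elim: s => //= w s ->; apply/funext => z; exact: derive_cst.
under eq_fun do rewrite big_cons.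
rewrite iter_deriveD//; last exact: Cinfty_sum.
by rewrite IH; apply/funext => z; rewrite big_cons.
Qed.

Lemma iter_derive_affine (W1 W2 : normedModType R) (L : W1 -> W2) (b : W2)
    (F : W2 -> R) (s : seq W1) : linear L -> continuous L -> Cinfty F ->
  iter_derive s (fun z => F (L z + b)) =
  fun z => iter_derive (map L s) F (L z + b).
Proof.
move=> lL cL CF; elim: s => //= w s ->; apply/funext => z.
have [//|_ ->//] := @differentiable_affine R W1 W2 L b
  (iter_derive (map L s) F) z lL cL _.
exact/Cinfty_diff/Cinfty_iter_derive.
Qed.

Lemma iter_derive_perm (W : normedModType R) (s t : seq W) (F : W -> R) :
  Cinfty F -> perm_eq s t -> iter_derive s F = iter_derive t F.
Proof.
move=> CF; elim: s t => [|w s IH] t.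
  by rewrite perm_sym => /perm_nilP ->.
move=> st; have wt : w \in t by rewrite -(perm_mem st) mem_head.
case/splitPr: wt st => t1 t2 st.
have /IH /= -> : perm_eq s (t1 ++ t2).
  by rewrite -(perm_cons w) (permPl st) (perm_catCA t1 [:: w] t2).
elim: t1 {st} => //= v t1 <-; apply/funext => z.
rewrite derive_commute//; exact: Cinfty_iter_derive.
Qed.

End iterated_derivatives.

(** * Taylor bounds and partial derivatives on row vectors *)

Section row_calculus.
Context {R : realType} {d : nat}.
Local Notation V := 'rV[R]_d.
Implicit Types (F u : V -> R) (x h : V) (a : seq 'I_d).

Lemma row_basis h : h = \sum_(i < d) h 0 i *: Defs.basis i.
Proof. exact: row_sum_delta. Qed.

Lemma derive_row F x h : differentiable F x ->
  'D_h F x = \sum_(i < d) h 0 i * partial i F x.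
Proof.
move=> dF; rewrite {1}(row_basis h) deriveE// linear_sum.
by apply: eq_bigr => i _; rewrite linearZ /partial deriveE.
Qed.

Lemma Cinfty_coord (i : 'I_d) : Cinfty (fun x : V => x 0 i).
Proof.
by apply: Cinfty_linear; [move=> c v w; rewrite !mxE|exact: coord_continuous].
Qed.

Lemma norm_row_coord h (i : 'I_d) : `|h 0 i| <= `|h|.
Proof.
by rewrite [leRHS]/Num.norm /= mx_normrE; apply/bigmax_geP; right => /=; exists (0, i).
Qed.

Lemma lipschitz_row F x h (M : 'I_d -> R) : (forall z, differentiable F z) ->
  (forall i z, `|partial i F z| <= M i) ->
  `|F (x + h) - F x| <= (\sum_(i < d) M i) * `|h|.
Proof.
move=> dF FM; have [t _ ->] := MVT_line x h dF.
rewrite derive_row// (le_trans (ler_norm_sum _ _ _))// mulr_suml.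
apply: ler_sum => i _; rewrite normrM mulrC ler_pM//; exact: norm_row_coord.
Qed.

Lemma taylor2_row F x h (M : 'I_d -> 'I_d -> R) : Ck 2 F ->
  (forall i j z, `|partial j (partial i F) z| <= M i j) ->
  `|F (x + h) - F x - \sum_(i < d) h 0 i * partial i F x| <=
  (\sum_(i < d) \sum_(j < d) M i j) * `|h| ^+ 2.
Proof.
move=> [dF HF] FM; have [t /andP[t0 t1] ->] := MVT_line x h dF.
rewrite derive_row// -sumrB (le_trans (ler_norm_sum _ _ _))// mulr_suml.
apply: ler_sum => i _; rewrite -mulrBr normrM expr2 mulrCA.
apply: ler_pM => //; first exact: norm_row_coord.
have [dFi _] := HF (Defs.basis i).
apply: (le_trans (lipschitz_row x (t *: h) dFi (FM i))).
rewrite ler_wpM2l//; last by rewrite normrZ ger0_norm// ler_piMl.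
by apply: sumr_ge0 => j _; exact: le_trans (FM i j x).
Qed.

Definition Dw a u : V -> R := iter_derive [seq Defs.basis i | i <- a] u.

Lemma Dw_cons i a u : Dw (i :: a) u = partial i (Dw a u).
Proof. by []. Qed.

Lemma Dw_cat a b u : Dw (a ++ b) u = Dw a (Dw b u).
Proof. by rewrite /Dw map_cat iter_derive_cat. Qed.

Lemma Cinfty_Dw a u : Cinfty u -> Cinfty (Dw a u).
Proof. exact: Cinfty_iter_derive. Qed.

Lemma Dw_perm a b u : Cinfty u -> perm_eq a b -> Dw a u = Dw b u.
Proof. by move=> Cu ab; apply: iter_derive_perm => //; exact: perm_map. Qed.

(** The whole tower of candidate derivatives is given in advance, [U (i :: a)] being the candidate
    for the [i]-th partial of [U a]. Every level satisfies the same hypothesis, so C^k follows for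
    all words at once by induction on [k]; the constant may depend on the point. *)
Lemma Cinfty_family (U : seq 'I_d -> V -> R) :
  (forall a x, exists C, forall h,
    `|U a (x + h) - U a x - \sum_(i < d) h 0 i * U (i :: a) x| <= C * `|h| ^+ 2) ->
  (forall a, Cinfty (U a)) /\ forall a, Dw a (U [::]) = U a.
Proof.
move=> HU.
have HD a x : differentiable (U a) x /\
    forall w : V, 'D_w (U a) x = \sum_(i < d) w 0 i * U (i :: a) x.
  have [C HC] := HU a x.
  pose L (h : V) : R := \sum_(i < d) h 0 i * U (i :: a) x.
  have lL : linear L.
    move=> c v w; rewrite /L scaler_sumr -big_split; apply: eq_bigr => i _.
    by rewrite /= !mxE mulrDl scalerAl.
  pose LM := GRing.isLinear.Build _ _ _ _ _ lL.
  pose LL : {linear V -> R} := HB.pack L LM.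
  have cL : continuous LL.
    apply: Cinfty_continuous; apply: Cinfty_sum => i.
    by apply: CinftyM; [exact: Cinfty_coord|exact: Cinfty_cst].
  exact: (@differentiable_quadratic R V (U a) LL x C cL HC).
split=> a; last first.
  elim: a => // i a IH; rewrite Dw_cons IH; apply/funext => x.
  rewrite /partial (HD a x).2 (bigD1 i)//= big1 ?addr0.
    by rewrite mxE !eqxx mul1r.
  by move=> j ji; rewrite mxE (negbTE ji) andbF mul0r.
move=> k; elim: k a => [|k IH] a.
  by move=> x; apply: differentiable_continuous; have [] := HD a x.
split=> [x|w]; first by have [] := HD a x.
have -> : (fun x => 'D_w (U a) x : R) = fun x => \sum_(i < d) w 0 i * U (i :: a) x.
  by apply/funext => x; rewrite (HD a x).2.
elim: (index_enum _) => [|i r IHr].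
  by under eq_fun do rewrite big_nil; exact: Ck_cst.
by under eq_fun do rewrite big_cons; apply: CkD => //; apply: CkM => //; exact: Ck_cst.
Qed.

End row_calculus.

Section real_integrable.
Context {R : realType} d (T : measurableType d) (mu : {measure set T -> \bar R}).
Implicit Types f g : T -> R.
Local Notation L1 f := (mu.-integrable setT (EFin \o f)).

Lemma integrable_EFinD f g : L1 f -> L1 g -> L1 (fun t => f t + g t).
Proof. by move=> If Ig; exact: (integrableD measurableT If Ig). Qed.

Lemma integrable_EFinB f g : L1 f -> L1 g -> L1 (fun t => f t - g t).
Proof. by move=> If Ig; exact: (integrableB measurableT If Ig). Qed.

Lemma integrable_EFinZ c f : L1 f -> L1 (fun t => c * f t).
Proof. by move=> If; exact: (integrableZl measurableT c If). Qed.

Lemma integrable_EFin_sum (I : Type) (r : seq I) (F : I -> T -> R) :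
  (forall i, L1 (F i)) -> L1 (fun t => \sum_(i <- r) F i t).
Proof.
move=> IF; rewrite [X in _.-integrable _ X](_ : _ =
    fun t => (\sum_(i <- r) (EFin \o F i) t)%E); first exact: integrable_sum.
by apply/funext => t /=; rewrite -sumEFin.
Qed.

Lemma Rintegral_sum (I : Type) (r : seq I) (F : I -> T -> R) :
  (forall i, L1 (F i)) ->
  \int[mu]_t (\sum_(i <- r) F i t) = \sum_(i <- r) \int[mu]_t F i t.
Proof.
move=> IF; elim: r => [|i r IH].
  rewrite big_nil; under eq_Rintegral do rewrite big_nil.
  by rewrite /Rintegral integral0.
rewrite big_cons -IH -RintegralD//; last exact: integrable_EFin_sum.
by apply: eq_Rintegral => t _; rewrite big_cons.
Qed.

Lemma le_EFin_integrable f g : measurable_fun setT f ->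
  (forall t, `|f t| <= g t) -> L1 g -> L1 f.
Proof.
move=> mf fg Ig; apply: (le_integrable _ _ _ Ig) => //.
  exact/measurable_EFinP.
by move=> t _ /=; rewrite lee_fin (le_trans (fg t))//; exact: ler_norm.
Qed.

End real_integrable.

(** * Differentiation under the integral sign, to all orders *)

Section smooth_integral.
Context {R : realType} {n : nat} d (T : measurableType d)
  (mu : {measure set T -> \bar R}).
Local Notation V := 'rV[R]_n.

(** The Taylor remainder of [Dw a (k t)] is dominated, uniformly in [x], by the majorants for words
    two letters longer; integrating it gives the hypothesis of [Cinfty_family]. The same statement
    serves velocity integrals, the integral in the heat parameter and, with the counting measure,
    series. *)
Lemma Cinfty_integral (k : T -> V -> R) (g : seq 'I_n -> T -> R) :
  (forall t, Cinfty (k t)) ->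
  (forall a x, measurable_fun setT (fun t => Dw a (k t) x)) ->
  (forall a, mu.-integrable setT (EFin \o g a)) ->
  (forall a t x, `|Dw a (k t) x| <= g a t) ->
  let U a x := \int[mu]_t Dw a (k t) x in
  Cinfty (U [::]) /\ forall a, Dw a (U [::]) = U a.
Proof.
move=> Ck mk ig kg U.
have ik a x : mu.-integrable setT (EFin \o (fun t => Dw a (k t) x)).
  exact: le_EFin_integrable (mk a x) (fun t => kg a t x) (ig a).
suff /Cinfty_family[CU DU] : forall a x, exists C, forall h,
    `|U a (x + h) - U a x - \sum_(i < n) h 0 i * U (i :: a) x| <= C * `|h| ^+ 2.
  by [].
move=> a x.
pose G t := \sum_(i < n) \sum_(j < n) g (j :: i :: a) t.
have iG : mu.-integrable setT (EFin \o G).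
  by do 2!(apply: integrable_EFin_sum => ?).
exists (\int[mu]_t G t) => h.
pose r t := Dw a (k t) (x + h) - Dw a (k t) x -
  \sum_(i < n) h 0 i * Dw (i :: a) (k t) x.
have iZ i : mu.-integrable setT (EFin \o (fun t => h 0 i * Dw (i :: a) (k t) x)).
  exact: integrable_EFinZ.
have iS : mu.-integrable setT (EFin \o (fun t => \sum_(i < n) h 0 i * Dw (i :: a) (k t) x)).
  exact: integrable_EFin_sum.
have iB : mu.-integrable setT (EFin \o (fun t => Dw a (k t) (x + h) - Dw a (k t) x)).
  exact: integrable_EFinB.
have ir : mu.-integrable setT (EFin \o r) by exact: integrable_EFinB.
have -> : U a (x + h) - U a x - \sum_(i < n) h 0 i * U (i :: a) x = \int[mu]_t r t.
  rewrite /r RintegralB// RintegralB//; congr (_ - _).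
  rewrite Rintegral_sum//; apply: eq_bigr => i _.
  by rewrite RintegralZl.
rewrite (le_trans (le_normr_Rintegral _ ir))//.
rewrite mulrC -RintegralZl//.
apply: le_Rintegral => //.
- exact: integrable_norm.
- exact: integrable_EFinZ.
move=> t _; rewrite mulrC.
apply: (@taylor2_row _ _ (Dw a (k t)) x h (fun i j => g (j :: i :: a) t)).
  exact: Cinfty_Dw.
by move=> i j z; exact: (kg (j :: i :: a)).
Qed.

End smooth_integral.

(** * Measurability and iterated integrals *)

Section measurable_continuous.
Context {R : realType}.

(* A countable dense family of centres makes every open set a countable union
   of balls. *)
Lemma measurable_open_preimage (W : pseudoMetricType R) (I : countType)
    (q : I -> W) d (T : measurableType d) (phi : T -> W) :
  (forall w (e : R), 0 < e -> exists i, ball (q i) e w) ->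
  (forall i (e : R), 0 < e -> measurable (phi @^-1` ball (q i) e)) ->
  forall O, open O -> measurable (phi @^-1` O).
Proof.
move=> dq mq O oO.
pose A (p : I * nat) := if `[< ball (q p.1) p.2.+1%:R^-1 `<=` O >]
  then phi @^-1` ball (q p.1) p.2.+1%:R^-1 else set0.
rewrite (_ : _ @^-1` _ = \bigcup_p A p); last first.
  apply/seteqP; split=> [t Ot|t [p _]]; last first.
    by rewrite /A; case: ifPn => // /asboolP pO /pO.
  have /nbhs_ballP[e /= e0 eO] := open_nbhs_nbhs (conj oO Ot).
  have e20 : 0 < e / 2 by rewrite divr_gt0.
  have [n nb] : exists n : nat, n.+1%:R^-1 < e / 2.
    have [n _ Hn] := near_infty_natSinv_lt (PosNum e20).
    by exists n; apply: Hn => /=; exact: leqnn.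
  have [i qi] := dq (phi t) n.+1%:R^-1 ltac:(by rewrite invr_gt0 ltr0n).
  exists (i, n) => //; rewrite /A/=; case: ifPn => // /asboolP; apply.
  move=> y qy; apply: eO; apply: (@le_ball _ _ _ (n.+1%:R^-1 + n.+1%:R^-1)).
    by rewrite [leRHS]splitr lerD// ltW.
  exact: ball_triangle (ball_sym qi) qy.
apply: countable_bigcupT_measurable => [|p]; first exact: countableP.
rewrite /A; case: ifPn => // _; apply: mq; by rewrite invr_gt0 ltr0n.
Qed.

Lemma measurable_continuous_comp (W : pseudoMetricType R) (I : countType)
    (q : I -> W) d (T : measurableType d) (phi : T -> W) (F : W -> R) :
  (forall w (e : R), 0 < e -> exists i, ball (q i) e w) ->
  (forall i (e : R), 0 < e -> measurable (phi @^-1` ball (q i) e)) ->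
  continuous F -> measurable_fun setT (F \o phi).
Proof.
move=> dq mq /continuousP cF; apply: (measurability _ (RGenOpens.measurableE R)).
move=> _ [_ [a [b ->] <-]]; rewrite setTI.
exact: (measurable_open_preimage dq mq (cF _ (interval_open _ _))).
Qed.

Lemma dense_ratr_row n (w : 'rV[R]_n) (e : R) : 0 < e ->
  exists q : 'rV[rat]_n, ball (map_mx ratr q : 'rV[R]_n) e w.
Proof.
move=> e0.
have /choice[q Hq] : forall i : 'I_n, exists r : rat, `|ratr r - w 0 i| < e.
  move=> i; have /rat_in_itvoo[r /itvP ri] : w 0 i - e < w 0 i + e.
    by rewrite ltrBlDr -addrA ltrDl addr_gt0.
  by exists r; rewrite ltr_distl !ri.
exists (\row_i q i); split=> // i j; rewrite ord1 !mxE; exact: Hq.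
Qed.

Lemma measurable_row_ball n (q : 'rV[R]_n) (e : R) : 0 < e ->
  measurable (@row_of_tuple R n @^-1` ball q e).
Proof.
move=> e0.
rewrite (_ : _ @^-1` _ = \bigcap_(i in [set: 'I_n])
    ((fun t : n.-tuple R => tnth t i) @^-1` ball (q 0 i) e)).
  apply: fin_bigcap_measurable => // i _; rewrite -[X in measurable X]setTI.
  by apply: measurable_tnth => //; apply: open_measurable; exact: ball_open.
apply/seteqP; split=> t; first by move=> [_ H] i _; have := H 0 i; rewrite mxE.
by move=> H; split=> // j i; rewrite ord1 mxE; exact: H.
Qed.

Lemma measurable_row n (F : 'rV[R]_n -> R) :
  continuous F -> measurable_fun setT (fun t => F (row_of_tuple t)).
Proof.
apply: (@measurable_continuous_comp _ _ (fun q => map_mx ratr q : 'rV[R]_n)).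
- by move=> w e e0; exact: dense_ratr_row.
- by move=> q e e0; exact: measurable_row_ball.
Qed.

Lemma measurable_phase n (F : 'rV[R]_n * 'rV[R]_n -> R) :
  continuous F -> measurable_fun setT (fun p => F (phase_of_tuples p)).
Proof.
move=> cF.
apply: (@measurable_continuous_comp ('rV[R]_n * 'rV[R]_n)%type
  ('rV[rat]_n * 'rV[rat]_n)%type (fun q => (map_mx ratr q.1, map_mx ratr q.2))
  _ _ (@phase_of_tuples R n) F) => //.
- move=> w e e0; have [q1 H1] := dense_ratr_row w.1 e0.
  by have [q2 H2] := dense_ratr_row w.2 e0; exists (q1, q2); split.
- move=> q e e0.
  rewrite (_ : _ @^-1` _ = (@row_of_tuple R n @^-1` ball (map_mx ratr q.1 : 'rV[R]_n) e) `*`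
     (@row_of_tuple R n @^-1` ball (map_mx ratr q.2 : 'rV[R]_n) e)) //.
  by apply: measurableX; exact: measurable_row_ball.
Qed.

End measurable_continuous.

(** * Integration against powers of a measure *)

Section tuple_power_integral.
Context {R : realType} d (T : measurableType d)
  (mu : {sigma_finite_measure set T -> \bar R}).
Local Open Scope ereal_scope.

Lemma tonelli_tuple n (F : n.+1.-tuple T -> \bar R) :
  measurable_fun setT F -> (forall t, 0 <= F t) ->
  \int[tuple_power mu n.+1]_t F t =
  \int[mu]_a \int[tuple_power mu n]_t F [tuple of a :: t].
Proof.
move=> mF F0.
rewrite [LHS](ge0_integral_pushforward (@measurable_tuple_cons _ T n))//.
rewrite preimage_setT fubini_tonelli1//; last by move=> x; exact: F0.
by apply: measurableT_comp => //; exact: measurable_tuple_cons.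
Qed.

Lemma measurable_tonelli_tuple n (F : n.+1.-tuple T -> \bar R) :
  measurable_fun setT F -> (forall t, 0 <= F t) ->
  measurable_fun setT (fun a => \int[tuple_power mu n]_t F [tuple of a :: t]).
Proof.
move=> mF F0.
apply: (@measurable_fun_fubini_tonelli_F _ _ _ _ _ _ (F \o @tuple_cons _ T n)) => [|x]; last exact: F0.
by apply: measurableT_comp => //; exact: measurable_tuple_cons.
Qed.

Lemma measurable_cons_tuple n (F : n.+1.-tuple T -> \bar R) a :
  measurable_fun setT F -> measurable_fun setT (fun t : n.-tuple T => F [tuple of a :: t]).
Proof.
move=> mF; apply: (measurableT_comp mF).
by apply: measurable_cons => //; exact: measurable_cst.
Qed.

Lemma integral_tuple0 (F : 0.-tuple T -> \bar R) : (forall t, 0 <= F t) ->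
  measurable_fun setT F -> \int[tuple_power mu 0]_t F t = F [tuple].
Proof. by move=> F0 mF; rewrite integral_dirac// diracT mul1e. Qed.

(* The product function is indexed by [nat] so that the induction on the
   length can shift it. *)
Lemma integral_tuple_prod n (phi : nat -> T -> R) :
  (forall i, measurable_fun setT (phi i)) -> (forall i t, (0 <= phi i t)%R) ->
  \int[tuple_power mu n]_t (\prod_(i < n) phi i (tnth t i))%:E =
  \prod_(i < n) \int[mu]_t (phi i t)%:E.
Proof.
elim: n phi => [|n IH] phi mphi phi0.
  rewrite integral_tuple0; rewrite ?big_ord0//.
    by move=> t; rewrite big_ord0.
  by under eq_fun do rewrite big_ord0; exact: measurable_cst.
have mP : measurable_fun setT (fun t : n.+1.-tuple T => (\prod_(i < n.+1) phi i (tnth t i))%:E).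
  apply/measurable_EFinP; apply: measurable_prod => i _.
  by apply: measurableT_comp => //; exact: measurable_tnth.
rewrite tonelli_tuple//; last by move=> t; rewrite lee_fin prodr_ge0.
rewrite big_ord_recl -(IH (fun i => phi i.+1))// -ge0_integralZr//; last 3 first.
- exact/measurable_EFinP.
- by move=> t _; rewrite lee_fin.
- by apply: integral_ge0 => t _; rewrite lee_fin prodr_ge0.
apply: eq_integral => a _; rewrite -ge0_integralZl//; last 3 first.
- apply/measurable_EFinP; apply: measurable_prod => i _.
  by apply: measurableT_comp => //; exact: measurable_tnth.
- by move=> t _; rewrite lee_fin prodr_ge0.
- by rewrite lee_fin.
apply: eq_integral => t _; rewrite -EFinM big_ord_recl; congr (_ * _)%:E.
by apply: eq_bigr => i _; rewrite tnthS.
Qed.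

(** The indicator of a box is a product of one-dimensional indicators. *)
Lemma tuple_power_box n (A : nat -> set T) : (forall i, measurable (A i)) ->
  tuple_power mu n [set t : n.-tuple T | forall i : 'I_n, A i (tnth t i)] = \prod_(i < n) mu (A i).
Proof.
move=> mA.
have mB : measurable [set t : n.-tuple T | forall i : 'I_n, A i (tnth t i)].
  rewrite (_ : [set _ | _] = \bigcap_(i in [set: 'I_n]) ((fun t : n.-tuple T => tnth t i) @^-1` A i)).
    apply: fin_bigcap_measurable => // i _; rewrite -[X in measurable X]setTI.
    exact: measurable_tnth.
  by apply/seteqP; split => t /= H i; [move=> _; exact: H|exact: H].
rewrite -[LHS]mul1e -integral_cst// integral_mkcond.
transitivity (\int[tuple_power mu n]_t (\prod_(i < n) (\1_(A i) (tnth t i) : R))%:E).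
  apply: eq_integral => t _; rewrite patchE; case: ifPn => [|tB].
    rewrite inE => tB; rewrite big1// => i _.
    by rewrite indicE mem_set//; exact: tB.
  have [i Ai] : exists i : 'I_n, ~ A i (tnth t i).
    by apply/existsNP; apply: contraNnot tB; rewrite inE.
  by rewrite (bigD1 i)//= indicE memNset// mul0r.
rewrite (@integral_tuple_prod n (fun i => \1_(A i))).
- by apply: eq_bigr => i _; rewrite integral_indic// setIT.
- by move=> i; exact: measurable_indic.
- by move=> i t; rewrite indicE.
Qed.

End tuple_power_integral.

(** * Translation invariance on the line and on the circle *)

Section translation.
Context {R : realType}.
Local Notation mu := (@lebesgue_measure R).
Local Open Scope ereal_scope.

Lemma measurable_addr (s : R) : measurable_fun setT (fun t : R => (t + s)%R).
Proof. by apply: measurable_funD. Qed.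

(** Lebesgue measure is determined by the lengths of half-open intervals, which a translation
    preserves. *)
Lemma lebesgue_measure_translation (s : R) (A : set R) : measurable A ->
  pushforward mu (fun t : R => (t + s)%R : measurableTypeR R) A = mu A.
Proof.
move=> mA.
pose mphi := isMeasurableFun.Build _ _ (measurableTypeR R) (measurableTypeR R) _
  (measurable_addr s : measurable_fun setT ((fun t => t + s)%R : measurableTypeR R -> measurableTypeR R)).
pose phi : {mfun measurableTypeR R >-> measurableTypeR R} := HB.pack (fun t : R => (t + s)%R) mphi.
apply/esym; apply: (@lebesgue_measure_unique R (pushforward mu phi)) => //.
move=> _ [[a b]] _ <-.
rewrite [RHS](_ : _ = mu `](a - s)%R, (b - s)%R]%classic).
  rewrite !lebesgue_measure_itv/= !lte_fin ltrD2r; case: ifP => // _.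
  by rewrite -!EFinB opprB addrA subrK.
congr (mu _); apply/seteqP.
by split => t /=; rewrite !in_itv/= ltrBlDr lerBrDr.
Qed.

Lemma ge0_integral_translation (w : R -> \bar R) (s : R) :
  measurable_fun setT w -> (forall t, 0 <= w t) ->
  \int[mu]_t w (t + s)%R = \int[mu]_t w t.
Proof.
move=> mw w0.
have := @ge0_integral_pushforward _ _ (measurableTypeR R) (measurableTypeR R) R
  _ (measurable_addr s) mu setT w measurableT mw (fun y _ => w0 y).
rewrite preimage_setT => <-.
apply: eq_measure_integral => [|? A mA _]; first exact: measurable_addr.
exact: lebesgue_measure_translation.
Qed.

Lemma ge0_integral_translation_itv (w : R -> \bar R) (s a b : R) :
  measurable_fun setT w -> (forall t, 0 <= w t) ->
  \int[mu]_(t in `[a, b[) w (t + s)%R =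
  \int[mu]_(t in `[(a + s)%R, (b + s)%R[) w t.
Proof.
move=> mw w0; rewrite [LHS]integral_mkcond [RHS]integral_mkcond.
rewrite -(ge0_integral_translation s (w := w \_ `[(a + s)%R, (b + s)%R[)).
- apply: eq_integral => t _; rewrite !patchE; congr (if _ then _ else _).
  by apply/idP/idP; rewrite !inE/= !in_itv/= lerD2r ltrD2r.
- have mI : measurable (`[(a + s)%R, (b + s)%R[ : set R) by exact: measurable_itv.
  by have [+ _] := measurable_restrictT w mI; apply; exact: measurable_funTS.
- by move=> t; rewrite patchE; case: ifP.
Qed.

Lemma integral_circle (w : R -> \bar R) : measurable_fun setT w -> (forall t, 0 <= w t) ->
  \int[@circle_measure R]_t w t = \int[mu]_(t in `[0%R, (2 * pi)%R[) w t.
Proof.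
move=> mw w0.
have mC : measurable (`[0%R, (2 * pi)%R[ : set R) by exact: measurable_itv.
rewrite (@ge0_negligible_integral _ _ _ (@circle_measure R) setT (~` `[0%R, (2 * pi)%R[))//.
- rewrite setTD setCK; apply: eq_measure_integral => A mA AC.
  by rewrite /= /circle_measure /mrestr setIidl.
- exact: measurableC.
- by rewrite /= /circle_measure /mrestr setICl measure0.
Qed.

Lemma ge0_integral_setU_itv (w : R -> \bar R) (a b c : R) : (a <= b)%R -> (b <= c)%R ->
  measurable_fun setT w -> (forall t, 0 <= w t) ->
  \int[mu]_(t in `[a, c[) w t =
  \int[mu]_(t in `[a, b[) w t + \int[mu]_(t in `[b, c[) w t.
Proof.
move=> ab bc mw w0.
rewrite -ge0_integral_setU//=; first last.
- apply/disj_set2P; apply/seteqP; split=> // t [] /=.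
  by rewrite !in_itv/= => /andP[_ tb] /andP[]; rewrite leNgt tb.
- exact: measurable_funTS.
by congr (integral mu); rewrite -itv_bndbnd_setU// bnd_simp.
Qed.

Lemma periodic_intmul (U : Type) (w : R -> U) (p : R) (k : int) t :
  (forall t, w (t + p)%R = w t) -> w (t + p *~ k)%R = w t.
Proof.
move=> wp; have wn (n : nat) s : w (s + p *+ n)%R = w s.
  elim: n s => [|n IH] s; first by rewrite mulr0n addr0.
  by rewrite mulrSr addrA wp.
case: k => n; first exact: wn.
by rewrite -[LHS](wn n.+1) NegzE mulrNz -pmulrn subrK.
Qed.

(** Modulo the period the shift is some [r] in [0, 2 pi]. The window from [r] to [2 pi + r] is cut
    at [2 pi], and its upper piece is moved back by one period. *)
Lemma integral_circle_translation (w : R -> \bar R) (s : R) :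
  measurable_fun setT w -> (forall t, 0 <= w t) ->
  (forall t, w (t + 2 * pi)%R = w t) ->
  \int[@circle_measure R]_t w (t + s)%R = \int[@circle_measure R]_t w t.
Proof.
move=> mw w0 wp; have p0 : (0 < 2 * pi :> R)%R by rewrite mulr_gt0// pi_gt0.
have mws : measurable_fun setT (fun t : R => w (t + s)%R).
  by apply: (measurableT_comp mw); exact: measurable_addr.
rewrite !integral_circle// ge0_integral_translation_itv//.
pose k := Num.floor (s / (2 * pi)).
pose r := (s - (2 * pi) *~ k)%R.
have [r0 rp] : (0 <= r)%R /\ (r <= 2 * pi)%R.
  rewrite /r -[X in (_ - X)%R]mulrzr subr_ge0 lerBlDr mulrC -ler_pdivlMr//.
  rewrite ge_floor; split=> //.
  rewrite -[X in (_ <= X + _)%R]mul1r -mulrDl -ler_pdivrMr// addrC ltW//.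
  by rewrite (lt_le_trans (floorD1_gt _))// intrD lexx.
have {1}-> : (0 + s = r + (2 * pi) *~ k)%R by rewrite /r subrK add0r.
have -> : (2 * pi + s = (2 * pi + r) + (2 * pi) *~ k)%R by rewrite /r -addrA subrK.
rewrite -ge0_integral_translation_itv//.
under eq_integral do rewrite periodic_intmul//.
rewrite (@ge0_integral_setU_itv w r (2 * pi)%R)//; last by rewrite lerDl.
rewrite (@ge0_integral_setU_itv w 0%R r (2 * pi)%R)// addeC; congr (_ + _).
have {1}-> : (2 * pi = 0 + 2 * pi :> R)%R by rewrite add0r.
rewrite (addrC (2 * pi)%R r) -ge0_integral_translation_itv//.
by apply: eq_integral => t _; rewrite wp.
Qed.

End translation.

Section tuple_translation.
Context {R : realType}.

Definition shift_tuple n (s : nat -> R) (t : n.-tuple R) : n.-tuple R :=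
  [tuple tnth t i + s i | i < n].

Lemma row_shift_tuple n (s : nat -> R) (t : n.-tuple R) :
  row_of_tuple (shift_tuple s t) = row_of_tuple t + \row_(i < n) s i.
Proof. by apply/rowP => i; rewrite !mxE tnth_mktuple. Qed.

Lemma shift_tuple_cons n (s : nat -> R) a (t : n.-tuple R) :
  shift_tuple s [tuple of a :: t] =
  [tuple of (a + s 0) :: shift_tuple (fun i => s i.+1) t].
Proof.
apply: eq_from_tnth => i; rewrite tnth_mktuple.
case: (unliftP ord0 i) => [j|] ->; last by rewrite !tnth0.
by rewrite !tnthS tnth_mktuple.
Qed.

Lemma measurable_shift_tuple n (s : nat -> R) :
  measurable_fun setT (@shift_tuple n s).
Proof.
apply/measurable_fun_tnthP => i.
rewrite (_ : _ \o _ = fun t => tnth t i + s i).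
  by apply: measurable_funD => //; exact: measurable_tnth.
by apply/funext => t /=; rewrite tnth_mktuple.
Qed.

Variable mu : {sigma_finite_measure set (measurableTypeR R) -> \bar R}.
Variable p : R.
Local Open Scope ereal_scope.
Hypothesis mu_translation : forall (w : R -> \bar R) (s : R),
  measurable_fun setT w -> (forall t, 0 <= w t) -> (forall t, w (t + p)%R = w t) ->
  \int[mu]_t w (t + s)%R = \int[mu]_t w t.

(** Tonelli treats one coordinate at a time. Periodicity in a single coordinate is recovered from
    invariance under shifts by 0 or [p]: a shift vector starting with 0 acts on the tail only, and
    the vector [(p, 0, ..., 0)] acts on the head only. *)
Lemma ge0_integral_shift_tuple n (F : n.-tuple R -> \bar R) (s : nat -> R) :
  measurable_fun setT F -> (forall t, 0 <= F t) ->
  (forall (q : nat -> R) t, (forall i, q i = 0%R \/ q i = p) -> F (shift_tuple q t) = F t) ->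
  \int[tuple_power mu n]_t F (shift_tuple s t) = \int[tuple_power mu n]_t F t.
Proof.
elim: n F s => [|n IH] F s mF F0 Fp.
  by apply: eq_integral => t _; congr F; apply: eq_from_tnth => -[].
have mFs : measurable_fun setT (F \o shift_tuple s).
  exact: (measurableT_comp mF (@measurable_shift_tuple _ s)).
rewrite (tonelli_tuple mu mFs)//; last by move=> t; exact: F0.
rewrite (tonelli_tuple mu mF F0).
under eq_integral do under eq_integral do rewrite /= shift_tuple_cons.
transitivity (\int[mu]_a \int[tuple_power mu n]_t F [tuple of (a + s 0%N)%R :: t]).
  apply: eq_integral => a _; apply: (IH (fun t => F [tuple of (a + s 0%N)%R :: t])).
  - exact: measurable_cons_tuple.
  - by move=> t; exact: F0.
  - move=> q t q0p; pose q' i := if i is i'.+1 then q i' else 0%R.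
    rewrite -[RHS](Fp q'); last by case=> [|i]; [left|exact: q0p].
    by rewrite shift_tuple_cons/= addr0.
apply: (mu_translation (w := fun a => \int[tuple_power mu n]_t F [tuple of a :: t])).
- exact: (measurable_tonelli_tuple mu mF).
- by move=> a; exact: integral_ge0.
- move=> a; apply: eq_integral => t _.
  pose q i := if i is i'.+1 then 0%R else p.
  rewrite -[RHS](Fp q); last by case=> [|i]; [right|left].
  have st : shift_tuple (fun i => q i.+1) t = t.
    by apply: eq_from_tnth => i; rewrite tnth_mktuple addr0.
  by rewrite shift_tuple_cons st.
Qed.

End tuple_translation.

Section tuple_comparison.
Context {R : realType}.
Variables (mu nu : {sigma_finite_measure set (measurableTypeR R) -> \bar R}) (G : R -> R) (c : R).
Local Open Scope ereal_scope.
Hypotheses (c0 : (0 <= c)%R) (G0 : forall t, (0 <= G t)%R) (mG : measurable_fun setT G).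
Hypothesis muG : forall w : R -> \bar R, measurable_fun setT w -> (forall t, 0 <= w t) ->
  c%:E * \int[mu]_t w t <= \int[nu]_t (w t * (G t)%:E).

(** The inequality of measures [c mu <= G nu] on the line passes to products, one Tonelli step per
    coordinate. It serves to bound the Gaussian from below by a multiple of the uniform measure on a
    period cell. *)
Lemma le_integral_tuple n (F : n.-tuple R -> \bar R) :
  measurable_fun setT F -> (forall t, 0 <= F t) ->
  (c ^+ n)%:E * \int[tuple_power mu n]_t F t <=
  \int[tuple_power nu n]_t (F t * (\prod_(i < n) G (tnth t i))%:E).
Proof.
elim: n F => [|n IH] F mF F0.
  rewrite expr0 mul1e !integral_tuple0//; first by rewrite big_ord0 mule1.
  - by move=> t; rewrite big_ord0 mule1.
  - by under eq_fun do rewrite big_ord0 mule1.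
have mP k : measurable_fun setT (fun t : k.-tuple R => (\prod_(i < k) G (tnth t i))%:E).
  apply/measurable_EFinP; apply: measurable_prod => i _.
  by apply: measurableT_comp => //; exact: measurable_tnth.
have P0 k (t : k.-tuple R) : 0 <= (\prod_(i < k) G (tnth t i))%:E.
  by rewrite lee_fin prodr_ge0.
rewrite tonelli_tuple// tonelli_tuple//; first last.
- by move=> t; rewrite mule_ge0.
- exact: emeasurable_funM (mP _).
rewrite exprSr EFinM -muleA.
have mI : measurable_fun setT (fun a => \int[tuple_power mu n]_t F [tuple of a :: t]).
  exact: measurable_tonelli_tuple.
have I0 a : 0 <= \int[tuple_power mu n]_t F [tuple of a :: t] by exact: integral_ge0.
apply: (@le_trans _ _ ((c ^+ n)%:E * \int[nu]_a
    (\int[tuple_power mu n]_t F [tuple of a :: t] * (G a)%:E))).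
  by apply: lee_wpmul2l; [rewrite lee_fin exprn_ge0|exact: muG].
have mFP : measurable_fun setT (fun t : n.+1.-tuple R =>
    F t * (\prod_(i < n.+1) G (tnth t i))%:E) by exact: emeasurable_funM (mP _).
have mIG : measurable_fun setT (fun a =>
    \int[tuple_power mu n]_t F [tuple of a :: t] * (G a)%:E).
  by apply: emeasurable_funM => //; exact/measurable_EFinP.
rewrite -ge0_integralZl//; first last.
- by rewrite lee_fin exprn_ge0.
- by move=> a _; rewrite mule_ge0// lee_fin.
apply: ge0_le_integral => //.
- by move=> a _; rewrite mule_ge0 ?mule_ge0 ?lee_fin// exprn_ge0.
- exact: measurable_funeM.
- apply: (measurable_tonelli_tuple nu mFP) => t; by rewrite mule_ge0.
move=> a _; rewrite muleA.
have mFa : measurable_fun setT (fun t : n.-tuple R => F [tuple of a :: t]).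
  exact: measurable_cons_tuple.
apply: (@le_trans _ _ (\int[tuple_power nu n]_t
    (F [tuple of a :: t] * (\prod_(i < n) G (tnth t i))%:E) * (G a)%:E)).
  apply: lee_wpmul2r; first by rewrite lee_fin.
  by apply: IH => // t; exact: F0.
rewrite -ge0_integralZr//; first last.
- by rewrite lee_fin.
- by move=> t _; rewrite mule_ge0.
- exact: emeasurable_funM (mP _).
apply: ge0_le_integral => //.
- by move=> t _; apply: mule_ge0; [exact: mule_ge0|rewrite lee_fin].
- by apply: emeasurable_funM; [exact: emeasurable_funM (mP _)|exact: measurable_cst].
- exact: (@measurable_cons_tuple _ _ _ _ (fun t => F t * (\prod_(i < n.+1) G (tnth t i))%:E)).
move=> t _; rewrite big_ord_recl (_ : tnth _ ord0 = a)// -muleA -EFinM.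
by under [in leRHS]eq_bigr do rewrite tnthS; rewrite mulrC.
Qed.

End tuple_comparison.

(** * The fundamental theorem of calculus and a sup bound on the circle *)

Section circle_integrals.
Context {R : realType}.
Local Notation mu := (@lebesgue_measure R).
Local Open Scope ereal_scope.

Lemma circle_measureT : @circle_measure R setT = (2 * pi)%:E.
Proof.
rewrite /circle_measure /mrestr setTI lebesgue_measure_itv/= lte_fin.
by rewrite mulr_gt0 ?pi_gt0// oppr0 adde0.
Qed.

Lemma segment_FTC (G g : R -> R) (a b : R) : (a < b)%R ->
  (forall s : R, is_derive s 1%R G (g s)) -> continuous g ->
  \int[mu]_(s in `[a, b]) (g s)%:E = (G b - G a)%:E.
Proof.
move=> ab dG cg.
have cG : continuous G.
  by move=> s; apply/differentiable_continuous/derivable1_diffP; case: (dG s).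
rewrite (continuous_FTC2 ab (F := G)) ?EFinB//.
- exact: continuous_subspaceT.
- split; first by move=> s _; case: (dG s).
  + exact/cvg_at_right_filter/cG.
  + exact/cvg_at_left_filter/cG.
- by move=> s _; rewrite derive1E; have := dG s => dGs; rewrite derive_val.
Qed.

Lemma integral_circle_real (w : R -> \bar R) : measurable_fun setT w ->
  \int[@circle_measure R]_t w t = \int[mu]_(t in `[0%R, (2 * pi)%R]) w t.
Proof.
move=> mw; rewrite -integral_itv_bndo_bndc; last exact: measurable_funTS.
rewrite [LHS]integralE [RHS]integralE !integral_circle//;
  [exact: measurable_funeneg|exact: measurable_funepos].
Qed.

Lemma circle_FTC (G g : R -> R) :
  (forall s : R, is_derive s 1%R G (g s)) -> continuous g ->
  \int[@circle_measure R]_s (g s)%:E = (G (2 * pi) - G 0%R)%:E.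
Proof.
move=> dG cg; rewrite integral_circle_real.
  by apply: segment_FTC => //; rewrite mulr_gt0// pi_gt0.
by apply/measurable_EFinP; exact: continuous_measurable_fun.
Qed.

(* |G 0%R| <= |G s| + int |g| for every s, then average over s. *)
Lemma circle_sup_bound (G g : R -> R) :
  (forall s : R, is_derive s 1%R G (g s)) -> continuous g ->
  `|G 0%R|%:E <= \int[@circle_measure R]_s (`|G s|%:E + `|g s|%:E).
Proof.
move=> dG cg.
have cG : continuous G.
  by move=> s; apply/differentiable_continuous/derivable1_diffP; case: (dG s).
have mG : measurable_fun setT (fun s => `|G s|%:E).
  apply/measurable_EFinP; apply: measurableT_comp => //.
  exact: continuous_measurable_fun.
have mg : measurable_fun setT (fun s => `|g s|%:E).
  apply/measurable_EFinP; apply: measurableT_comp => //.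
  exact: continuous_measurable_fun.
rewrite ge0_integralD//; try by move=> s _; rewrite lee_fin.
set I := (X in _ <= _ + X).
have I0 : 0 <= I by apply: integral_ge0 => s _; rewrite lee_fin.
have p1 : (1 <= 2 * pi :> R)%R.
  by rewrite (le_trans _ (ler_wpM2l _ (pi_ge2 R)))// -natrM ler1n.
have H s : s \in `[0%R, (2 * pi)%R[ -> `|G 0%R|%:E <= `|G s|%:E + I.
  rewrite in_itv/= le_eqVlt => /andP[/predU1P[<- _|s0 sp]]; first by rewrite leeDl.
  have E := segment_FTC s0 dG cg.
  have -> : G 0%R = (G s - (G s - G 0%R))%R by rewrite opprB addrC subrK.
  apply: (@le_trans _ _ (`|G s|%:E + `|G s - G 0%R|%:E)).
    by rewrite -EFinD lee_fin ler_normB.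
  rewrite leeD2l// -abse_EFin -E /I integral_circle//.
  apply: (@le_trans _ _ (\int[mu]_(s in `[0%R, s]) `|g s|%:E)).
    apply: le_abse_integral => //; apply/measurable_EFinP.
    by apply: measurable_funTS; exact: continuous_measurable_fun.
  apply: ge0_subset_integral => //.
    by apply: measurable_funTS.
  by move=> t /=; rewrite !in_itv/= => /andP[-> ts]; exact: le_lt_trans ts sp.
clearbody I; have [->|Ifin] := eqVneq I +oo.
  have J0 : 0 <= \int[@circle_measure R]_s `|G s|%:E.
    by apply: integral_ge0 => s _; rewrite lee_fin.
  by rewrite addey ?leey//; apply: contraTneq J0 => ->.
have p0 : (0 < 2 * pi :> R)%R by rewrite mulr_gt0// pi_gt0.
have : \int[@circle_measure R]_s `|G 0%R|%:E <= \int[@circle_measure R]_s (`|G s|%:E + I).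
  rewrite [leLHS]integral_circle// [leRHS]integral_circle//; first last.
  - by move=> s; rewrite adde_ge0// lee_fin.
  - exact: emeasurable_funD.
  apply: ge0_le_integral => //.
  by apply: measurable_funTS; exact: emeasurable_funD.
rewrite ge0_integralD// integral_cst//= integral_cst//= circle_measureT.
rewrite -EFinM => HI.
have fI : I \is a fin_num by rewrite ge0_fin_numE// lt_neqAle Ifin leey.
rewrite -(fineK fI) in HI I0 *.
have : (`|G 0%R|)%:E * (2 * pi)%:E <= (\int[@circle_measure R]_s `|G s|%:E) * (2 * pi)%:E
   + (fine I)%:E * (2 * pi)%:E.
  rewrite -EFinM (le_trans HI)// leeD2r// -[leLHS]mule1 lee_wpmul2l//.
  by apply: integral_ge0 => s _; rewrite lee_fin.
rewrite -ge0_muleDl//; last by apply: integral_ge0 => s _; rewrite lee_fin.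
by rewrite lee_pmul2r// lte_fin.
Qed.

End circle_integrals.

Section row_measurability.
Context {R : realType}.

Lemma measurable_row_comp d (T : measurableType d) n (phi : T -> 'rV[R]_n)
    (F : 'rV[R]_n -> R) :
  (forall i, measurable_fun setT (fun t => phi t 0 i)) -> continuous F ->
  measurable_fun setT (fun t => F (phi t)).
Proof.
move=> mphi cF; pose tau t : n.-tuple R := [tuple phi t 0 i | i < n].
rewrite (_ : (fun t => F (phi t)) = (fun t => F (row_of_tuple t)) \o tau).
  apply: measurableT_comp; first exact: measurable_row.
  apply/measurable_fun_tnthP => i.
  by rewrite (_ : _ \o _ = fun t => phi t 0 i)//; apply/funext => t /=; rewrite tnth_mktuple.
apply/funext => t /=; congr F; apply/rowP => i.
by rewrite mxE tnth_mktuple.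
Qed.

Lemma continuous_normr (T : topologicalType) (F : T -> R) :
  continuous F -> continuous (fun x => `|F x|).
Proof. by move=> cF x; apply: cvg_norm; exact: cF. Qed.

Lemma Cinfty_shift n (u : 'rV[R]_n -> R) y : Cinfty u -> Cinfty (fun x => u (x + y)).
Proof.
by move=> Cu; apply: (@Cinfty_affine _ _ _ idfun) => // z; exact: cvg_id.
Qed.

Lemma partial_shift n (u : 'rV[R]_n -> R) y i x : Cinfty u ->
  partial i (fun x => u (x + y)) x = partial i u (x + y).
Proof.
move=> Cu; have cid : continuous (@idfun 'rV[R]_n) by move=> z; exact: cvg_id.
have lid : linear (@idfun 'rV[R]_n) by [].
by have [_ E] := differentiable_affine lid cid (Cinfty_diff Cu (idfun x + y)); exact: E.
Qed.

Lemma Dw_shift n (u : 'rV[R]_n -> R) y a : Cinfty u ->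
  Dw a (fun x => u (x + y)) = fun x => Dw a u (x + y).
Proof.
move=> Cu; elim: a => // i a IH; apply/funext => x.
by rewrite Dw_cons IH partial_shift//; exact: Cinfty_Dw.
Qed.

Lemma continuous_shift_row n (u : 'rV[R]_n -> R) (y : 'rV[R]_n) :
  continuous u -> continuous (fun x : 'rV[R]_n => u (x + y)).
Proof.
move=> cu; apply: (@Ck_affine R _ _ (@idfun 'rV[R]_n) y u 0) => // z; exact: cvg_id.
Qed.

Lemma is_derive_basis n (u : 'rV[R]_n -> R) i x (s : R) : Cinfty u ->
  is_derive s (1 : R) (fun s : R => u (x + s *: Defs.basis i))
    (partial i u (x + s *: Defs.basis i)).
Proof. by move=> Cu; apply: is_derive_line; exact: Cinfty_diff. Qed.

Lemma continuous_line n (u : 'rV[R]_n -> R) x y : continuous u ->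
  continuous (fun s : R => u (x + s *: y)).
Proof.
move=> cu s; apply: (@continuous_comp _ _ _ (fun s : R => x + s *: y) u); last exact: cu.
by apply: cvgD; [exact: cvg_cst|exact: scalel_continuous].
Qed.

End row_measurability.

(** * Integrals of partial derivatives vanish *)

Section translation_invariant.
Context {R : realType} (mu : {sigma_finite_measure set (measurableTypeR R) -> \bar R}) (p : R).
Hypothesis mu_translation : forall (w : R -> \bar R) (s : R),
  measurable_fun setT w -> (forall t, (0 <= w t)%E) -> (forall t, w (t + p)%R = w t) ->
  (\int[mu]_t w (t + s)%R = \int[mu]_t w t)%E.
Variable n : nat.
Local Notation V := 'rV[R]_n.
Local Notation nu := (tuple_power mu n).

(** For [p = 2 * pi] this follows from periodicity; for [p = 0] it holds for every function. The
    circle and the line are thus treated together. *)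
Definition step_invariant (U : Type) (F : V -> U) := forall (q : nat -> R) x,
  (forall i, q i = 0 \/ q i = p) -> F (x + \row_(i < n) q i) = F x.

Lemma row_of_nat (y : V) : exists s : nat -> R, \row_(i < n) s i = y.
Proof.
exists (fun k => if insub k is Some i then y 0 i else 0).
by apply/rowP => i; rewrite mxE valK.
Qed.

Lemma ge0_integral_row_translation (F : V -> R) (y : V) : continuous F ->
  (forall x, 0 <= F x) -> step_invariant F ->
  (\int[nu]_t (F (row_of_tuple t + y))%:E = \int[nu]_t (F (row_of_tuple t))%:E)%E.
Proof.
move=> cF F0 Fp; have [s <-] := row_of_nat y.
rewrite -(@ge0_integral_shift_tuple R mu p mu_translation n
  (fun t => (F (row_of_tuple t))%:E) s).
- by apply: eq_integral => t _; rewrite row_shift_tuple.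
- by apply/measurable_EFinP; exact: measurable_row.
- by move=> t; rewrite lee_fin.
- by move=> q t qp; rewrite row_shift_tuple Fp.
Qed.

Lemma integral_row_translation (F : V -> R) (y : V) : continuous F ->
  step_invariant F ->
  (\int[nu]_t (F (row_of_tuple t + y))%:E = \int[nu]_t (F (row_of_tuple t))%:E)%E.
Proof.
move=> cF Fp; have [s <-] := row_of_nat y.
pose g t := (F (row_of_tuple t))%:E.
have mg : measurable_fun setT g by apply/measurable_EFinP; exact: measurable_row.
have gq (q : nat -> R) : (forall i, q i = 0 \/ q i = p) -> g \o shift_tuple q = g.
  by move=> qp; apply/funext => t; rewrite /g/= row_shift_tuple Fp.
rewrite (_ : (fun t => _) = g \o shift_tuple s); last first.
  by apply/funext => t; rewrite /g/= row_shift_tuple.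
rewrite [LHS]integralE [RHS]integralE funepos_comp funeneg_comp; congr (_ - _)%E.
- apply: (ge0_integral_shift_tuple mu_translation) => //.
    exact: measurable_funepos.
  by move=> q t qp; rewrite -[LHS]/((g^\+ \o shift_tuple q)%E t) -funepos_comp gq.
- apply: (ge0_integral_shift_tuple mu_translation) => //.
    exact: measurable_funeneg.
  by move=> q t qp; rewrite -[LHS]/((g^\- \o shift_tuple q)%E t) -funeneg_comp gq.
Qed.

(* Averaging the translates of the derivative over [0, 2 pi) turns its integral
   into a difference of two translates of [F]. *)
Lemma integral_partial0 (F : V -> R) (i : 'I_n) : Cinfty F -> step_invariant F ->
  nu.-integrable setT (EFin \o (fun t => F (row_of_tuple t))) ->
  nu.-integrable setT (EFin \o (fun t => partial i F (row_of_tuple t))) ->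
  \int[nu]_t partial i F (row_of_tuple t) = 0.
Proof.
move=> CF Fp iF iG; set G := partial i F in iG *.
have CG : Cinfty G by exact: Cinfty_derive.
have Gp : step_invariant G.
  move=> q x qp; rewrite /G -partial_shift//; congr (partial i _ x).
  by apply/funext => z; exact: Fp.
pose h (z : R * n.-tuple R) := (G (row_of_tuple z.2 + z.1 *: Defs.basis i))%:E.
have mh : measurable_fun setT h.
  apply/measurable_EFinP; apply: measurable_row_comp; last exact: Cinfty_continuous.
  move=> j; under eq_fun do rewrite !mxE.
  apply: measurable_funD.
    by apply: (measurableT_comp (measurable_tnth j)).
  by apply: measurable_funM => //; exact: measurable_cst.
have nG : step_invariant (fun x => `|G x|) by move=> q z qp; rewrite Gp.
have cnG : continuous (fun x => `|G x|).
  by apply: continuous_normr; exact: Cinfty_continuous.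
have ih : (@circle_measure R \x nu)%E.-integrable setT h.
  apply/integrable12ltyP => //.
  have E s : (\int[nu]_t `|h (s, t)| = \int[nu]_t `|G (row_of_tuple t)|%:E)%E.
    have := ge0_integral_row_translation (s *: Defs.basis i) cnG (fun x => normr_ge0 (G x)) nG.
    by move=> <-; apply: eq_integral => t _.
  under eq_integral do rewrite E.
  move/integrableP : iG => [_] /= iG.
  rewrite integral_cst//= circle_measureT.
  by rewrite lte_mul_pinfty ?ltry// ?ge0_fin_numE//; apply: integral_ge0 => t _; rewrite lee_fin.
have := Fubini ih; rewrite /h/=.
under eq_integral do rewrite (integral_row_translation _ (Cinfty_continuous CG) Gp).
rewrite integral_cst//= circle_measureT.
have Ft (t : n.-tuple R) : (\int[@circle_measure R]_s (G (row_of_tuple t + s *: Defs.basis i))%:E =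
    (F (row_of_tuple t + (2 * pi) *: Defs.basis i))%:E - (F (row_of_tuple t))%:E)%E.
  have := circle_FTC (fun s => is_derive_basis i (row_of_tuple t) s CF)
    (@continuous_line _ _ G (row_of_tuple t) (Defs.basis i) (Cinfty_continuous CG)).
  by rewrite scale0r addr0 -EFinB.
under [RHS]eq_integral do rewrite Ft.
have iF' : nu.-integrable setT (EFin \o (fun t => F (row_of_tuple t + (2 * pi) *: Defs.basis i))).
  apply/integrableP; split.
    apply/measurable_EFinP; apply: (measurable_row (F := fun x => F (x + _))).
    apply: Cinfty_continuous; exact: Cinfty_shift.
  move/integrableP : iF => [_]; congr (_ < _)%E.
  have cnF := continuous_normr (Cinfty_continuous CF).
  have nF : step_invariant (fun x => `|F x|) by move=> q z qp; rewrite Fp.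
  have := ge0_integral_row_translation ((2 * pi) *: Defs.basis i) cnF
    (fun x => normr_ge0 (F x)) nF.
  by move=> <-; apply: eq_integral => t _.
rewrite integralB_EFin// (integral_row_translation _ (Cinfty_continuous CF) Fp).
rewrite subee; last exact: integrable_fin_num.
move=> /eqP; rewrite mule_eq0 => /orP[/eqP /(congr1 fine)//|].
by rewrite eqe gt_eqF// mulr_gt0// pi_gt0.
Qed.

End translation_invariant.

(** * Sobolev's embedding with one derivative per direction *)

Section sobolev.
Context {R : realType} {d : nat}.
Local Notation V := 'rV[R]_d.

(** All ways of keeping or dropping each letter of [l]: iterating a one-dimensional bound over the
    coordinates produces at most one derivative in each direction. The letter [i] is added on the
    right because [Dw (rcons a i) u] is [Dw a (partial i u)], the form in which the induction meets
    it. *)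
Fixpoint sobolev_words (l : seq 'I_d) : seq (seq 'I_d) :=
  if l is i :: l' then
    sobolev_words l' ++ [seq rcons a i | a <- sobolev_words l']
  else [:: [::]].

Definition lin_comb (l : seq 'I_d) (t : seq R) : V :=
  \sum_(q <- zip l t) q.2 *: Defs.basis q.1.

Lemma lin_comb_nil t : lin_comb [::] t = 0.
Proof. by rewrite /lin_comb; case: t => [|? ?]; rewrite big_nil. Qed.

Lemma lin_comb_enum (t : d.-tuple R) : lin_comb (enum 'I_d) t = row_of_tuple t.
Proof.
have {1}-> : t = [seq tnth t i | i <- enum 'I_d] :> seq R.
  by rewrite -[LHS](map_tnth_enum t).
rewrite /lin_comb -[X in zip X _]map_id zip_map big_map big_enum /=.
rewrite [RHS]row_basis; apply: eq_bigr => i _; by rewrite mxE.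
Qed.

Lemma measurable_lin_comb n (l : seq 'I_d) (i : 'I_d) :
  measurable_fun setT (fun t : n.-tuple R => lin_comb l t 0 i).
Proof.
elim: n l => [|n IH] l.
  rewrite (_ : (fun t => _) = cst (lin_comb l [::] 0 i)); first exact: measurable_cst.
  by apply/funext => t; rewrite [t]tuple0.
case: l => [|j l].
  rewrite (_ : (fun t => _) = cst 0); first exact: measurable_cst.
  by apply/funext => t; rewrite lin_comb_nil mxE.
rewrite (_ : (fun t => _) = fun t : n.+1.-tuple R =>
    thead t * Defs.basis j 0 i + lin_comb l [tuple of behead t] 0 i).
  apply: measurable_funD.
    by apply: measurable_funM; [exact: measurable_tnth|exact: measurable_cst].
  exact: (measurableT_comp (IH l) (@measurable_behead _ _ n)).
apply/funext => t; case/tupleP: t => a t.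
by rewrite /lin_comb big_cons !mxE theadE.
Qed.

(** Along the first direction [circle_sup_bound] replaces [u x] by the values of [u] and
    [partial i u] at shifted points; the induction hypothesis applies to both functions there. *)
Lemma sobolev_tuple n (l : seq 'I_d) (u : V -> R) x : size l = n -> Cinfty u ->
  (`|u x|%:E <= \int[tuple_power (@circle_measure R) n]_t
    \sum_(a <- sobolev_words l) `|Dw a u (x + lin_comb l t)|%:E)%E.
Proof.
move=> ln Cu.
have mS m (l' : seq 'I_d) (u' : V -> R) y W : Cinfty u' ->
    measurable_fun setT (fun t : m.-tuple R =>
    (\sum_(a <- W) `|Dw a u' (y + lin_comb l' t)|%:E)%E).
  move=> Cu'; apply: emeasurable_sum => a; apply/measurable_EFinP.
  apply: measurableT_comp => //.
  apply: (measurable_row_comp (phi := fun t : m.-tuple R => y + lin_comb l' t)).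
    move=> i; under eq_fun do rewrite mxE.
    by apply: measurable_funD; [exact: measurable_cst|exact: measurable_lin_comb].
  by apply: Cinfty_continuous; exact: Cinfty_Dw.
have S0 (u' : V -> R) y W : (0 <= \sum_(a <- W) `|Dw a u' y|%:E)%E.
  by apply: sume_ge0 => a _; rewrite lee_fin.
elim: n l ln u Cu x => [|n IH] [|i l]//= ln u Cu x.
  rewrite (integral_tuple0 (@circle_measure R)); first by rewrite big_seq1 lin_comb_nil addr0.
  - by move=> t; exact: S0.
  - exact: mS.
rewrite (tonelli_tuple (@circle_measure R) (mS n.+1 (i :: l) u x _ Cu)); last by move=> t; exact: S0.
have := @circle_sup_bound R (fun s => u (x + s *: Defs.basis i))
  (fun s => partial i u (x + s *: Defs.basis i)).
rewrite /= scale0r addr0 => H; apply: (le_trans (H _ _)).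
- by move=> s; exact: is_derive_basis.
- by apply: continuous_line; apply: Cinfty_continuous; exact: Cinfty_derive.
have Cpu : Cinfty (partial i u) by exact: Cinfty_derive.
have ml (v : V -> R) : Cinfty v ->
    measurable_fun setT (fun s : R => `|v (x + s *: Defs.basis i)|%:E).
  move=> Cv; apply/measurable_EFinP; apply: measurableT_comp => //.
  apply: continuous_measurable_fun; apply: continuous_line.
  exact: Cinfty_continuous.
apply: ge0_le_integral => //.
- by move=> s _; rewrite adde_ge0// lee_fin.
- by apply: emeasurable_funD; exact: ml.
- apply: (measurable_tonelli_tuple (@circle_measure R) (mS n.+1 (i :: l) u x _ Cu)).
  by move=> t; exact: S0.
move=> s _.
have E (t : n.-tuple R) : x + lin_comb (i :: l) ((s : R) :: t) =
    (x + (s : R) *: Defs.basis i) + lin_comb l t.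
  by rewrite /lin_comb big_cons addrA.
rewrite [leRHS](_ : _ = \int[tuple_power (@circle_measure R) n]_t
    (\sum_(a <- sobolev_words l) `|Dw a u (x + (s : R) *: Defs.basis i + lin_comb l t)|%:E +
     \sum_(a <- sobolev_words l)
       `|Dw a (partial i u) (x + (s : R) *: Defs.basis i + lin_comb l t)|%:E))%E; last first.
  apply: eq_integral => t _; rewrite /= big_cat big_map/=.
  congr (_ + _)%E; apply: eq_bigr => a _; first by rewrite E.
  by rewrite E -cats1 Dw_cat.
have m1 := mS n l u (x + (s : R) *: Defs.basis i) (sobolev_words l) Cu.
have m2 := mS n l (partial i u) (x + (s : R) *: Defs.basis i) (sobolev_words l) Cpu.
have ln' : size l = n by case: ln.
rewrite ge0_integralD//; first exact: leeD (IH l ln' u Cu _) (IH l ln' _ Cpu _).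
Qed.

End sobolev.

(** * Functions on the torus *)

Section torus.
Context {R : realType} {d : nat}.
Local Notation V := 'rV[R]_d.
Implicit Types (u w : V -> R) (x y : V).

Lemma periodic_sum u x (k : 'I_d -> int) (r : seq 'I_d) : Defs.periodic u ->
  u (x + \sum_(i <- r) (2 * pi *~ k i) *: Defs.basis i) = u x.
Proof.
move=> pu; elim: r x => [|i r IH] x; first by rewrite big_nil addr0.
rewrite big_cons addrA IH.
have := @periodic_intmul R _ (fun s => u (x + s *: Defs.basis i)) (2 * pi) (k i) 0.
rewrite add0r scale0r addr0 => -> // t.
by rewrite scalerDl addrA pu.
Qed.

Lemma periodic_step_invariant u : Defs.periodic u -> step_invariant (2 * pi) u.
Proof.
move=> pu q x q0p; pose k (i : 'I_d) : int := if q i == 0 then 0 else 1.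
rewrite -[RHS](periodic_sum x k (index_enum _) pu); congr (u (_ + _)).
rewrite [LHS]row_basis; apply: eq_bigr => i _; rewrite mxE; congr (_ *: _).
rewrite /k; case: eqP => [->|]; first by rewrite mulr0z.
by case: (q0p i) => // -> _; rewrite mulr1z.
Qed.

(** A floor in each coordinate gives one representative that serves all periodic functions at
    once. *)
Lemma torus_cell x : exists2 y : V, forall i, 0 <= y 0 i < 2 * pi &
  forall u, Defs.periodic u -> u x = u y.
Proof.
have p0 : 0 < 2 * pi :> R by rewrite mulr_gt0// pi_gt0.
pose k i := - Num.floor (x 0 i / (2 * pi)).
exists (x + \sum_(i <- index_enum _) (2 * pi *~ k i) *: Defs.basis i); last first.
  by move=> u pu; rewrite periodic_sum.
move=> i; rewrite !mxE summxE (bigD1 i)//= big1 ?addr0.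
  rewrite !mxE !eqxx mulr1 /k mulrNz -[X in _ - X]mulrzr subr_ge0 ltrBlDr.
  rewrite mulrC -ler_pdivlMr// ge_floor/= -[X in X + _]mul1r -mulrDl.
  by rewrite -ltr_pdivrMr// addrC (lt_le_trans (floorD1_gt _))// intrD lexx.
by move=> j ji; rewrite !mxE eqxx/= eq_sym (negbTE ji) mulr0.
Qed.

Lemma compact_cube (lo hi : V) :
  compact [set x : V | forall i, lo 0 i <= x 0 i <= hi 0 i].
Proof.
have -> : [set x : V | forall i, lo 0 i <= x 0 i <= hi 0 i] =
    [set x : V | forall i, x ord0 i \in `[lo 0 i, hi 0 i]].
  by apply/seteqP; split=> x /= xI i; have := xI i; rewrite in_itv.
by apply: (@rV_compact _ _ (fun i => `[lo 0 i, hi 0 i]%classic)) => i;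
  exact: segment_compact.
Qed.

Lemma periodic_bounded u : Defs.periodic u -> continuous u ->
  exists2 M, 0 <= M & forall x, `|u x| <= M.
Proof.
move=> pu cu; have cK := @compact_cube 0 (const_mx (2 * pi)).
have /compact_bounded[M [Mr HM]] := continuous_compact (continuous_subspaceT cu) cK.
exists (`|M| + 1); first by rewrite addr_ge0.
move=> x; have [y yI ->//] := torus_cell x.
apply: HM; first by rewrite ltr_pwDr// ler_norm.
by exists y => // i; rewrite !mxE; have /andP[-> /ltW] := yI i.
Qed.

Lemma torus_measureT : @torus_measure R d setT = ((2 * pi) ^+ d)%:E.
Proof.
have := @tuple_power_box R _ _ (@circle_measure R) d (fun=> setT) (fun=> measurableT).
rewrite (_ : [set _ | _] = setT); last by apply/seteqP; split.
move=> ->; elim: d => [|n IH]; first by rewrite big_ord0 expr0.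
by rewrite big_ord_recl IH exprS EFinM -circle_measureT.
Qed.

Lemma torus_measure_fin : (@torus_measure R d setT < +oo)%E.
Proof. by rewrite torus_measureT ltry. Qed.

Local Notation torus_integrable u :=
  ((@torus_measure R d).-integrable setT (EFin \o (fun t => u (row_of_tuple t)))).

Lemma integrable_torus u : Defs.periodic u -> continuous u -> torus_integrable u.
Proof.
move=> pu cu; have [M M0 uM] := periodic_bounded pu cu.
apply: measurable_bounded_integrable => //.
- exact: torus_measure_fin.
- exact: measurable_row.
- exists M; split; first exact: num_real.
  by move=> m Mm t _ /=; rewrite (le_trans (uM _))// ltW.
Qed.

Lemma int_torusD u w : Defs.periodic u -> continuous u -> Defs.periodic w -> continuous w ->
  int_torus (fun x => u x + w x) = int_torus u + int_torus w.
Proof. by move=> pu cu pw cw; rewrite /int_torus RintegralD//; exact: integrable_torus. Qed.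

Lemma int_torusB u w : Defs.periodic u -> continuous u -> Defs.periodic w -> continuous w ->
  int_torus (fun x => u x - w x) = int_torus u - int_torus w.
Proof. by move=> pu cu pw cw; rewrite /int_torus RintegralB//; exact: integrable_torus. Qed.

Lemma int_torusZ c u : Defs.periodic u -> continuous u ->
  int_torus (fun x => c * u x) = c * int_torus u.
Proof. by move=> pu cu; rewrite /int_torus RintegralZl//; exact: integrable_torus. Qed.

Lemma int_torus_sum (I : Type) (r : seq I) (u : I -> V -> R) :
  (forall i, Defs.periodic (u i)) -> (forall i, continuous (u i)) ->
  int_torus (fun x => \sum_(i <- r) u i x) = \sum_(i <- r) int_torus (u i).
Proof.
move=> pu cu.
have := @Rintegral_sum R _ _ (@torus_measure R d) I r (fun i t => u i (row_of_tuple t)).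
apply => i; exact: integrable_torus.
Qed.

Lemma int_torus_cst c : int_torus (fun _ : V => c) = c * (2 * pi) ^+ d.
Proof.
by rewrite /int_torus Rintegral_cst//; congr (_ * _); exact: (congr1 fine torus_measureT).
Qed.

Lemma int_torus_bound u M : Defs.periodic u -> continuous u ->
  (forall x, `|u x| <= M) -> `|int_torus u| <= M * (2 * pi) ^+ d.
Proof.
move=> pu cu uM; have iu := integrable_torus pu cu.
rewrite (le_trans (le_normr_Rintegral _ iu))//.
rewrite -int_torus_cst; apply: le_Rintegral => //.
- exact: (integrable_norm iu).
- have pM : Defs.periodic (fun _ : V => M) by [].
  exact: (integrable_torus pM (@cst_continuous _ _ M)).
Qed.

Lemma int_torus_translation u y : Defs.periodic u -> continuous u ->
  int_torus (fun x => u (x + y)) = int_torus u.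
Proof.
move=> pu cu; have := @integral_row_translation R (@circle_measure R) (2 * pi)
  (@integral_circle_translation R) d u y cu (periodic_step_invariant pu).
by move=> E; congr fine; exact: E.
Qed.

Lemma periodic_partial u i : Defs.periodic u -> Cinfty u -> Defs.periodic (partial i u).
Proof.
move=> pu Cu j x; rewrite -partial_shift//; congr (partial i _ x).
by apply/funext => z; exact: pu.
Qed.

Definition perC u := Defs.periodic u /\ Cinfty u.

Lemma perC_continuous u : perC u -> continuous u.
Proof. by case=> _; exact: Cinfty_continuous. Qed.

Lemma perC_partial u i : perC u -> perC (partial i u).
Proof. by case=> pu Cu; split; [exact: periodic_partial|exact: Cinfty_derive]. Qed.

Lemma perC_Dw u a : perC u -> perC (Dw a u).
Proof. by move=> Cu; elim: a => // i a IH; exact: perC_partial. Qed.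

Lemma perC_cst c : perC (fun=> c).
Proof. by split; [move=> ?|exact: Cinfty_cst]. Qed.

Lemma perCD u w : perC u -> perC w -> perC (fun x => u x + w x).
Proof. by move=> [pu Cu] [pw Cw]; split; [move=> i x; rewrite pu pw|exact: CinftyD]. Qed.

Lemma perCM u w : perC u -> perC w -> perC (fun x => u x * w x).
Proof. by move=> [pu Cu] [pw Cw]; split; [move=> i x; rewrite pu pw|exact: CinftyM]. Qed.

Lemma perCN u : perC u -> perC (fun x => - u x).
Proof. by move=> [pu Cu]; split; [move=> i x; rewrite pu|exact: CinftyN]. Qed.

Lemma perCB u w : perC u -> perC w -> perC (fun x => u x - w x).
Proof. by move=> Cu Cw; apply: perCD => //; exact: perCN. Qed.

Lemma perCZ c u : perC u -> perC (fun x => c * u x).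
Proof. by move=> Cu; apply: perCM => //; exact: perC_cst. Qed.

Lemma perC_sum (I : Type) (r : seq I) (u : I -> V -> R) :
  (forall i, perC (u i)) -> perC (fun x => \sum_(i <- r) u i x).
Proof.
move=> Cu; split; last by apply: Cinfty_sum => i; case: (Cu i).
by move=> j x; apply: eq_bigr => i _; case: (Cu i) => ->.
Qed.

Lemma perCX u k : perC u -> perC (fun x => u x ^+ k).
Proof. by move=> [pu Cu]; split; [move=> i x; rewrite pu|exact: CinftyX]. Qed.

Lemma perC_laplacian u : perC u -> perC (laplacian u).
Proof. by move=> Cu; apply: perC_sum => i; do 2!apply: perC_partial. Qed.

Lemma perC_bounded u : perC u -> exists2 M, 0 <= M & forall x, `|u x| <= M.
Proof. by move=> [pu Cu]; apply: periodic_bounded => //; exact: Cinfty_continuous. Qed.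

Lemma perC_integrable u : perC u -> torus_integrable u.
Proof. by move=> [pu Cu]; apply: integrable_torus => //; exact: Cinfty_continuous. Qed.

Lemma int_torus_partial u i : perC u -> int_torus (partial i u) = 0.
Proof.
move=> Cu; apply: (@integral_partial0 R (@circle_measure R) (2 * pi)
  (@integral_circle_translation R) d u i Cu.2 (periodic_step_invariant Cu.1)).
- exact: perC_integrable.
- by apply: perC_integrable; exact: perC_partial.
Qed.

Lemma partialM u w i x : Cinfty u -> Cinfty w ->
  partial i (fun x => u x * w x) x = u x * partial i w x + w x * partial i u x.
Proof. by move=> Cu Cw; apply: deriveM; apply: diff_derivable; exact: Cinfty_diff. Qed.

Lemma partialD u w i x : Cinfty u -> Cinfty w ->
  partial i (fun x => u x + w x) x = partial i u x + partial i w x.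
Proof. by move=> Cu Cw; apply: deriveD; apply: diff_derivable; exact: Cinfty_diff. Qed.

Lemma partialZ u c i x : Cinfty u ->
  partial i (fun x => c * u x) x = c * partial i u x.
Proof. by move=> Cu; apply: deriveZ; apply: diff_derivable; exact: Cinfty_diff. Qed.

Lemma partialN u i x : Cinfty u -> partial i (fun x => - u x) x = - partial i u x.
Proof. by move=> Cu; apply: deriveN; apply: diff_derivable; exact: Cinfty_diff. Qed.

Lemma partialB u w i x : Cinfty u -> Cinfty w ->
  partial i (fun x => u x - w x) x = partial i u x - partial i w x.
Proof. by move=> Cu Cw; rewrite partialD ?partialN//; exact: CinftyN. Qed.

Lemma partial_sum (I : Type) (r : seq I) (u : I -> V -> R) i x :
  (forall j, Cinfty (u j)) ->
  partial i (fun x => \sum_(j <- r) u j x) x = \sum_(j <- r) partial i (u j) x.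
Proof.
by move=> Cu; have := @iter_derive_sum _ _ [:: Defs.basis i] _ r u Cu => /(congr1 (@^~ x)).
Qed.

Lemma partialC u i j x : Cinfty u ->
  partial i (partial j u) x = partial j (partial i u) x.
Proof. by move=> Cu; exact: derive_commute. Qed.

Lemma int_torus_IBP u w i : perC u -> perC w ->
  int_torus (fun x => u x * partial i w x) = - int_torus (fun x => partial i u x * w x).
Proof.
move=> Cu Cw; apply/eqP; rewrite -subr_eq0 opprK; apply/eqP.
have pu := perC_partial i Cu; have pw := perC_partial i Cw.
rewrite -int_torusD;
  [|by case: (perCM Cu pw)|by apply: perC_continuous; exact: perCM
   |by case: (perCM pu Cw)|by apply: perC_continuous; exact: perCM].
rewrite -[RHS](int_torus_partial i (perCM Cu Cw)); congr int_torus.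
apply/funext => x; rewrite partialM; [|by case: Cu|by case: Cw].
by congr (_ + _); exact: mulrC.
Qed.

(** Translation invariance removes the base point [x] from the integrals of [sobolev_tuple]. *)
Lemma sobolev_torus u x : perC u ->
  `|u x| <= \sum_(a <- sobolev_words (enum 'I_d)) int_torus (fun x => `|Dw a u x|).
Proof.
move=> Cu; have Cn a : Defs.periodic (fun x => `|Dw a u x|) /\ continuous (fun x => `|Dw a u x|).
  have Ca := perC_Dw a Cu; split; first by move=> i z; case: Ca => ->.
  by apply: continuous_normr; exact: perC_continuous.
have := @sobolev_tuple R d d (enum 'I_d) u x (size_enum_ord d) Cu.2.
under eq_integral do under eq_bigr do rewrite lin_comb_enum.
have -> : (\int[tuple_power (@circle_measure R) d]_t
   \sum_(a <- sobolev_words (enum 'I_d)) `|Dw a u (x + row_of_tuple t)|%:E =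
   (\sum_(a <- sobolev_words (enum 'I_d)) int_torus (fun x => `|Dw a u x|))%:E)%E.
  rewrite ge0_integral_sum//; last first.
    move=> a; apply/measurable_EFinP; under eq_fun do rewrite addrC.
    apply: (measurable_row (F := fun y => `|Dw a u (y + x)|)).
    by apply: (continuous_shift_row (u := fun y => `|Dw a u y|)); case: (Cn a).
  rewrite -sumEFin; apply: eq_bigr => a _; rewrite -(int_torus_translation x); [|by case: (Cn a)..].
  rewrite /int_torus /Rintegral fineK; first by apply: eq_integral => t _; rewrite addrC.
  apply: integrable_fin_num => //; apply: (integrable_torus (u := fun y => `|Dw a u (y + x)|)).
    by move=> i z; rewrite addrAC; case: (Cn a) => ->.
  by apply: (continuous_shift_row (u := fun y => `|Dw a u y|)); case: (Cn a).
by rewrite lee_fin.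
Qed.

End torus.

(** * Gaussian averages in velocity *)

Section velocity.
Context {R : realType}.
Local Notation mu := (@lebesgue_measure R).

Lemma integrable_oneDsqrV : mu.-integrable setT (EFin \o (fun s : R => (1 + s ^+ 2)^-1)).
Proof.
have mf : measurable_fun setT (EFin \o (fun s : R => (1 + s ^+ 2)^-1)).
  by apply/measurable_EFinP; apply: continuous_measurable_fun; exact: continuous_oneDsqrV.
have f0 (s : R) : 0 <= (1 + s ^+ 2)^-1 by rewrite invr_ge0 addr_ge0// sqr_ge0.
apply/integrableP; split=> //=.
under eq_integral do rewrite ger0_norm//.
rewrite ge0_symfun_integralT//=.
- rewrite (_ : [set x | _] = `[0, +oo[%classic); last first.
    by apply/seteqP; split => x/=; rewrite in_itv/= andbT.
  by rewrite (integral0y_oneDsqr R) -EFinM ltry.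
- exact: continuous_oneDsqrV.
- by move=> x /=; rewrite sqrrN.
Qed.

(** After squaring [1 + s^2/4 <= exp (s^2/4)], it remains to compare the cubic [(1 + a) (1 + a^2)]
    with the quartic [32 (1 + a^2/4)^2], where [a = |s|]; the constant is far from sharp. The factor
    [1 + |s|] leaves room for the coordinate of [v] that a derivative of the heat flow brings
    down. *)
Lemma gauss_oneDsqr (s : R) :
  (1 + `|s|) * expR (- (s ^+ 2 / 2)) <= 32 * (1 + s ^+ 2)^-1.
Proof.
have E : expR (s ^+ 2 / 2) = expR (s ^+ 2 / 4) ^+ 2.
  by rewrite -expRM_natl; congr expR; field.
have s0 : 0 <= s ^+ 2 by exact: sqr_ge0.
have H : (1 + `|s|) * (1 + s ^+ 2) <= 32 * expR (s ^+ 2 / 2).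
  have H1 : 1 + s ^+ 2 / 4 <= expR (s ^+ 2 / 4) by exact: expR_ge1Dx.
  have H2 : (1 + s ^+ 2 / 4) ^+ 2 <= expR (s ^+ 2 / 4) ^+ 2.
    by rewrite ler_sqr// nnegrE ?expR_ge0// addr_ge0// divr_ge0.
  rewrite E; apply: le_trans (ler_wpM2l (ltW _) H2); last by [].
  have : `|s| ^+ 2 = s ^+ 2 by rewrite real_normK// num_real.
  have := normr_ge0 s; move: `|s| => a a0 <-; nra.
rewrite expRN ler_pdivrMr ?expR_gt0// mulrAC ler_pdivlMr// ltr_pwDl//.
Qed.

Context {n : nat}.
Local Notation V := 'rV[R]_n.
Local Notation vel_integrable F :=
  ((@velocity_measure R n).-integrable setT (EFin \o (fun t => F (row_of_tuple t)))).

(** A polynomial with integrable inverse. The inverse dominates the Gaussian, while the weight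
    itself can be absorbed by the polynomial moments that smoothness controls. *)
Definition weight (v : V) : R := \prod_(i < n) (1 + v 0 i ^+ 2).

Lemma weight_gt0 v : 0 < weight v.
Proof. by apply: prodr_gt0 => i _; rewrite ltr_wpDr// sqr_ge0. Qed.

Lemma Cinfty_weight : Cinfty weight.
Proof.
apply: Cinfty_prod => i; apply: CinftyD; first exact: Cinfty_cst.
by apply: CinftyX; exact: Cinfty_coord.
Qed.

Lemma continuous_weightV : continuous (fun v => (weight v)^-1).
Proof.
move=> v; have cw : {for v, continuous weight} by exact: (Cinfty_continuous Cinfty_weight).
exact: (cvgV (lt0r_neq0 (weight_gt0 v)) cw).
Qed.

Lemma integrable_weightV : vel_integrable (fun v => (weight v)^-1).
Proof.
apply/integrableP; split.
  apply/measurable_EFinP; apply: (measurable_row (F := fun v => (weight v)^-1)).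
  exact: continuous_weightV.
have E (t : n.-tuple R) : `|(weight (row_of_tuple t))^-1| =
    \prod_(i < n) (fun (_ : nat) (s : R) => (1 + s ^+ 2)^-1) i (tnth t i).
  rewrite ger0_norm ?invr_ge0 ?ltW ?weight_gt0// -prodfV.
  by apply: eq_bigr => i _; rewrite mxE.
under eq_integral => t _ do rewrite /= E.
rewrite (@integral_tuple_prod _ _ _ (@lebesgue_measure R) n (fun _ s => (1 + s ^+ 2)^-1)).
- move/integrableP : integrable_oneDsqrV => [_ /=].
  under eq_integral do rewrite ger0_norm ?invr_ge0 ?addr_ge0 ?sqr_ge0//.
  set I := (\int[_]_x _)%E => Ioo.
  have I0 : (0 <= I)%E.
    by apply: integral_ge0 => s _; rewrite lee_fin invr_ge0 addr_ge0// sqr_ge0.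
  elim: n => [|k IH]; first by rewrite big_ord0 ltry.
  rewrite big_ord_recl; apply: lte_mul_pinfty => //.
  by rewrite ge0_fin_numE.
- by move=> _; apply: continuous_measurable_fun; exact: continuous_oneDsqrV.
- by move=> _ s; rewrite invr_ge0 addr_ge0// sqr_ge0.
Qed.

Definition gauss (v : V) : R := expR (- \sum_(i < n) v 0 i ^+ 2 / 2).

Lemma gaussE v : gauss v = \prod_(i < n) expR (- (v 0 i ^+ 2 / 2)).
Proof. by rewrite /gauss -sumrN expR_sum. Qed.

Lemma Cinfty_gauss_exponent : Cinfty (fun v : V => - \sum_(i < n) v 0 i ^+ 2 / 2).
Proof.
apply: CinftyN; apply: Cinfty_sum => i.
by apply: CinftyM; [apply: CinftyX; exact: Cinfty_coord|exact: Cinfty_cst].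
Qed.

Lemma Cinfty_gauss : Cinfty gauss.
Proof.
exact: (@Cinfty_comp1 R V (fun _ => expR) _ 0 (fun _ t => is_derive_expR t)
  Cinfty_gauss_exponent).
Qed.

Lemma partial_coord (i j : 'I_n) (v : V) : partial i (fun v : V => v 0 j) v = (j == i)%:R.
Proof.
have lj : linear (fun v : V => v 0 j) by move=> c u w; rewrite !mxE.
pose LM := GRing.isLinear.Build _ _ _ _ _ lj.
pose LL : {linear V -> R} := HB.pack (fun v : V => v 0 j) LM.
have cL : continuous LL by exact: coord_continuous.
rewrite /partial deriveE; last exact: differentiable_coord.
have := @diff_lin _ _ _ LL v cL => ->; rewrite /= mxE eqxx/=.
by rewrite eq_sym.
Qed.

Lemma partial_gauss i v : partial i gauss v = - v 0 i * gauss v.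
Proof.
have Cs := Cinfty_gauss_exponent.
have [_ E] := @differentiable_comp1 R V expR (gauss v) _ v (is_derive_expR _) (Cinfty_diff Cs v).
rewrite {1}/partial [LHS]E mulrC; congr (_ * _); rewrite -[LHS]/(partial i _ v).
have Cj j : Cinfty (fun v : V => v 0 j ^+ 2 / 2).
  by apply: CinftyM; [apply: CinftyX; exact: Cinfty_coord|exact: Cinfty_cst].
rewrite partialN; last exact: Cinfty_sum.
rewrite partial_sum// (bigD1 i)//= big1 ?addr0.
  rewrite (_ : (fun x : V => _) = fun x : V => 2^-1 * (x 0 i * x 0 i)); last first.
    by apply/funext => x; rewrite mulrC expr2.
  have Ci := @Cinfty_coord R n i.
  rewrite partialZ; last exact: CinftyM.
  rewrite partialM// partial_coord eqxx /= mulr1; congr (- _).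
  by lra.
move=> j ji.
rewrite (_ : (fun x : V => _) = fun x : V => 2^-1 * (x 0 j * x 0 j)); last first.
  by apply/funext => x; rewrite mulrC expr2.
have Ci := @Cinfty_coord R n j.
rewrite partialZ; last exact: CinftyM.
by rewrite partialM// partial_coord (negbTE ji) !mulr0 addr0 mulr0.
Qed.

Lemma gauss_weight (v : V) i : (1 + `|v 0 i|) * gauss v <= 32 ^+ n * (weight v)^-1.
Proof.
rewrite gaussE (bigD1 i)//= mulrA /weight -prodfV.
have -> : 32 ^+ n = \prod_(i < n) (32 : R) by rewrite prodr_const card_ord.
rewrite -big_split/= [leRHS](bigD1 i)//=.
apply: ler_pM; [by rewrite mulr_ge0 ?addr_ge0// expR_ge0
  |by apply: prodr_ge0 => j _; exact: expR_ge0|exact: gauss_oneDsqr|].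
apply: ler_prod => j _; rewrite expR_ge0/=.
apply: le_trans (gauss_oneDsqr _); rewrite ler_peMl ?expR_ge0// lerDl//.
Qed.

Lemma gauss_weight0 (v : V) : gauss v <= 32 ^+ n * (weight v)^-1.
Proof.
rewrite gaussE /weight -prodfV.
have -> : 32 ^+ n = \prod_(i < n) (32 : R) by rewrite prodr_const card_ord.
rewrite -big_split/=; apply: ler_prod => j _; rewrite expR_ge0/=.
apply: le_trans (gauss_oneDsqr _); rewrite ler_peMl ?expR_ge0// lerDl//.
Qed.

Lemma le_vel_integrable (F : V -> R) C : continuous F ->
  (forall v, `|F v| <= C * (weight v)^-1) -> vel_integrable F.
Proof.
move=> cF FC.
apply: (@le_EFin_integrable R _ _ (@velocity_measure R n)
  (fun t => F (row_of_tuple t)) (fun t => C * (weight (row_of_tuple t))^-1)).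
- exact: measurable_row.
- by move=> t; exact: FC.
- exact: integrable_EFinZ integrable_weightV.
Qed.

(** This is the translation argument with period 0, for which every function is step invariant. *)
Lemma int_velocity_partial (F : V -> R) i : Cinfty F ->
  vel_integrable F -> vel_integrable (partial i F) -> int_velocity (partial i F) = 0.
Proof.
move=> CF iF iG.
apply: (@integral_partial0 R (@lebesgue_measure R) 0 _ n F i CF _ iF iG).
- by move=> w s mw w0 _; exact: ge0_integral_translation.
- move=> q x q0; rewrite (_ : \row_(i < n) q i = 0) ?addr0//.
  by apply/rowP => j; rewrite !mxE; case: (q0 j).
Qed.

(** On the period cell each Gaussian factor is at least [expR (- (2 * pi) ^+ 2 / 2)], and the rest
    of the space only adds to the right-hand side since [u] is nonnegative. *)
Lemma torus_le_gauss (u : V -> R) : continuous u -> (forall v, 0 <= u v) ->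
  ((expR (- (2 * pi) ^+ 2 / 2) ^+ n)%:E *
    \int[@torus_measure R n]_t (u (row_of_tuple t))%:E <=
   \int[@velocity_measure R n]_t (u (row_of_tuple t) * gauss (row_of_tuple t))%:E)%E.
Proof.
move=> cu u0.
have mG : measurable_fun setT (fun s : R => expR (- (s ^+ 2 / 2))).
  apply: measurableT_comp => //; apply: measurableT_comp => //.
  by apply: measurable_funM => //; exact: measurable_funX.
have mI : measurable (`[0, 2 * pi[ : set R) by exact: measurable_itv.
have muG (w : R -> \bar R) : measurable_fun setT w -> (forall t, 0 <= w t)%E ->
    ((expR (- (2 * pi) ^+ 2 / 2))%:E * \int[@circle_measure R]_t w t <=
     \int[mu]_t (w t * (expR (- (t ^+ 2 / 2)))%:E))%E.
  move=> mw w0; rewrite integral_circle//.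
  rewrite -ge0_integralZl//; last exact: measurable_funTS.
  have mwG : measurable_fun setT (fun t : R => (w t * (expR (- (t ^+ 2 / 2)))%:E)%E).
    by apply: emeasurable_funM => //; exact/measurable_EFinP.
  have wG0 (t : R) : (0 <= w t * (expR (- (t ^+ 2 / 2)))%:E)%E.
    by rewrite mule_ge0// lee_fin expR_ge0.
  apply: (@le_trans _ _ (\int[mu]_(t in `[0%R, (2 * pi)%R[) (w t * (expR (- (t ^+ 2 / 2)))%:E))%E).
    apply: ge0_le_integral => //.
    - by move=> t _; rewrite mule_ge0// lee_fin expR_ge0.
    - by apply: measurable_funTS; exact: measurable_funeM.
    - exact: measurable_funTS.
    move=> t /=; rewrite in_itv/= => /andP[t0 tp].
    rewrite muleC lee_wpmul2l// lee_fin ler_expR mulNr lerN2 ler_pM2r//.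
    by rewrite ler_sqr ?nnegrE// ?ltW// (le_lt_trans t0).
  by apply: ge0_subset_integral => //; exact: measurable_funTS.
have := @le_integral_tuple R (@circle_measure R) mu
  (fun s => expR (- (s ^+ 2 / 2))) _ (expR_ge0 _)
  (fun t => expR_ge0 _) mG muG n (fun t => (u (row_of_tuple t))%:E).
move=> H; apply: le_trans (H _ _) _.
- by apply/measurable_EFinP; exact: measurable_row.
- by move=> t; rewrite lee_fin.
under eq_integral => t _.
  rewrite (_ : \prod_(i < n) _ = gauss (row_of_tuple t)); last first.
    by rewrite gaussE; apply: eq_bigr => i _; rewrite mxE.
  rewrite -EFinM; over.
by [].
Qed.

End velocity.

(** * The heat flow on periodic functions *)

Section heat.
Context {R : realType} {n : nat}.
Local Notation V := 'rV[R]_n.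
Implicit Types (h u : V -> R) (x : V).
Local Notation vel := (@velocity_measure R n).
Local Notation vel_integrable F :=
  (vel.-integrable setT (EFin \o (fun t => F (row_of_tuple t)))).

Lemma gauss_ge0 (v : V) : 0 <= gauss v. Proof. exact: expR_ge0. Qed.

Lemma integrable_gauss : vel_integrable (@gauss R n).
Proof.
apply: (@le_vel_integrable R n _ (32 ^+ n)).
  exact: Cinfty_continuous Cinfty_gauss.
by move=> v; rewrite (ger0_norm (gauss_ge0 v)); exact: gauss_weight0.
Qed.

Definition gauss_mass : R := int_velocity (@gauss R n).

(* The mass of the torus under the lower bound of the Gaussian on one period cell. *)
Definition cell_mass : R := (2 * pi) ^+ n * expR (- (2 * pi) ^+ 2 / 2) ^+ n.

Lemma cell_mass_gt0 : 0 < cell_mass.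
Proof. by rewrite mulr_gt0// exprn_gt0// ?mulr_gt0 ?pi_gt0// expR_gt0. Qed.

Lemma cell_mass_le : cell_mass <= gauss_mass.
Proof.
have c1 : continuous (fun _ : V => 1 : R) by move=> v; exact: cst_continuous.
have := @torus_le_gauss R n (fun=> 1) c1 (fun=> ler01).
rewrite integral_cst//= mul1e.
rewrite [X in (_ * X <= _)%E](_ : _ = ((2 * pi) ^+ n)%:E); last exact: torus_measureT.
under eq_integral do rewrite mul1r.
rewrite -EFinM -[leRHS]fineK; last exact: integrable_fin_num integrable_gauss.
by rewrite lee_fin mulrC.
Qed.

Lemma gauss_mass_gt0 : 0 < gauss_mass.
Proof. exact: lt_le_trans cell_mass_gt0 cell_mass_le. Qed.

Lemma gauss_massV_ge0 : 0 <= gauss_mass^-1.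
Proof. by rewrite invr_ge0 ltW// gauss_mass_gt0. Qed.

Lemma integrable_gaussM (F : V -> R) M : continuous F -> (forall v, `|F v| <= M) ->
  vel_integrable (fun v => F v * gauss v).
Proof.
move=> cF FM; apply: (@le_vel_integrable R n _ (M * 32 ^+ n)).
  exact: (@CkM R V 0 F _ cF (Cinfty_continuous Cinfty_gauss)).
move=> v; rewrite normrM (ger0_norm (gauss_ge0 v)) -mulrA.
by apply: ler_pM => //; [exact: gauss_ge0|exact: gauss_weight0].
Qed.

Lemma integrable_gauss_coordM (F : V -> R) M i : continuous F -> (forall v, `|F v| <= M) ->
  vel_integrable (fun v : V => v 0 i * F v * gauss v).
Proof.
move=> cF FM; apply: (@le_vel_integrable R n _ (M * 32 ^+ n)).
  exact: (@CkM R V 0 _ _ (@CkM R V 0 _ F (Cinfty_continuous (@Cinfty_coord R n i)) cF)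
    (Cinfty_continuous Cinfty_gauss)).
move=> v; rewrite !normrM (ger0_norm (gauss_ge0 v)) [X in X * _]mulrC -!mulrA.
apply: ler_pM => //; first by rewrite mulr_ge0// gauss_ge0.
apply: le_trans (@gauss_weight R n v i); rewrite ler_wpM2r ?gauss_ge0// ler_wpDl//.
Qed.

(** The Gaussian average of standard deviation [s / (2 * pi)], that is, the heat flow at time
    [(s / (2 * pi)) ^+ 2 / 2]. With this parameter the flow starts at 0, reaches the unscaled
    average at [2 * pi], and can be integrated in [s] against [circle_measure]. *)
Definition heat (s : R) h x : R :=
  gauss_mass^-1 * int_velocity (fun v => h (x + (s / (2 * pi)) *: v) * gauss v).

Lemma continuous_affine_row h (c : R) x : continuous h -> continuous (fun v : V => h (x + c *: v)).
Proof.
move=> ch; under eq_fun do rewrite addrC.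
apply: (@Ck_affine R V V (fun v => c *: v) x h 0) => //.
  by move=> a u w; rewrite scalerDr !scalerA mulrC.
exact: scaler_continuous.
Qed.

Lemma integrable_heat s h x : perC h ->
  vel_integrable (fun v => h (x + (s / (2 * pi)) *: v) * gauss v).
Proof.
move=> Ch; have [M M0 hM] := perC_bounded Ch.
exact: (integrable_gaussM (@continuous_affine_row h (s / (2 * pi)) x (perC_continuous Ch))
  (fun v => hM (x + (s / (2 * pi)) *: v))).
Qed.

Lemma heat_bound s h M x : perC h -> (forall x, `|h x| <= M) -> `|heat s h x| <= M.
Proof.
move=> Ch hM; rewrite /heat normrM (ger0_norm gauss_massV_ge0).
rewrite mulrC ler_pdivrMr ?gauss_mass_gt0//.
rewrite (le_trans (le_normr_Rintegral _ (integrable_heat _ _ Ch)))//.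
rewrite /gauss_mass /int_velocity -RintegralZl//; last exact: integrable_gauss.
apply: le_Rintegral => //.
- exact: (integrable_norm (integrable_heat _ _ Ch)).
- exact: (integrable_EFinZ M integrable_gauss).
move=> t _; rewrite normrM (ger0_norm (gauss_ge0 _)).
by rewrite ler_wpM2r// gauss_ge0.
Qed.

(** Averaging translates commutes with derivatives and with period shifts; the Gaussian times the
    sup of [Dw a h] is the majorant that justifies it. *)
Lemma heat_perC s h : perC h -> perC (heat s h) /\
  forall a, Dw a (heat s h) = heat s (Dw a h).
Proof.
move=> Ch; have Ch2 := Ch.2.
pose k (t : n.-tuple R) x :=
  gauss_mass^-1 * (gauss (row_of_tuple t) * h (x + (s / (2 * pi)) *: row_of_tuple t)).
have Csh (t : n.-tuple R) : Cinfty (fun x => h (x + (s / (2 * pi)) *: row_of_tuple t)).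
  exact: Cinfty_shift.
have kE a t : Dw a (k t) = fun x => gauss_mass^-1 * (gauss (row_of_tuple t) *
    Dw a h (x + (s / (2 * pi)) *: row_of_tuple t)).
  rewrite /Dw /k iter_deriveZ; last exact: CinftyZ.
  by rewrite iter_deriveZ// -/(Dw a _) Dw_shift.
have /choice[M HM] : forall a, exists M, forall x, `|Dw a h x| <= M.
  by move=> a; have [M _ HM] := perC_bounded (perC_Dw a Ch); exists M.
have cDw a x : continuous (fun v : V => Dw a h (x + (s / (2 * pi)) *: v)).
  exact: (@continuous_affine_row (Dw a h) _ _ (Cinfty_continuous (Cinfty_Dw a Ch2))).
have IE a x : \int[vel]_t Dw a (k t) x = heat s (Dw a h) x.
  rewrite /heat /int_velocity -RintegralZl//; last exact: integrable_heat (perC_Dw a Ch).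
  by apply: eq_Rintegral => t _; rewrite kE; congr (_ * _); rewrite mulrC.
have [] := @Cinfty_integral R n _ _ vel k
  (fun a t => gauss_mass^-1 * (M a * gauss (row_of_tuple t))).
- by move=> t; apply: CinftyZ; exact: CinftyZ.
- move=> a x; under eq_fun do rewrite kE.
  apply: measurable_funM; first exact: measurable_cst.
  apply: measurable_funM; last exact: measurable_row (cDw a x).
  exact: measurable_row (Cinfty_continuous Cinfty_gauss).
- by move=> a; do 2!apply: integrable_EFinZ; exact: integrable_gauss.
- move=> a t x; rewrite kE normrM (ger0_norm gauss_massV_ge0).
  rewrite (ler_wpM2l gauss_massV_ge0)// mulrC normrM.
  by rewrite (ger0_norm (gauss_ge0 _)) ler_wpM2r// gauss_ge0.
move=> CU DU.
have U0 : (fun x => \int[vel]_t Dw [::] (k t) x) = heat s h.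
  by apply/funext => x; rewrite IE.
rewrite U0 in CU DU; split; last first.
  by move=> a; rewrite DU; apply/funext => x; exact: IE.
split=> // i x; rewrite /heat; congr (_ * _); congr (int_velocity _).
by apply/funext => v; rewrite addrAC Ch.1.
Qed.

Lemma heat0 h : heat 0 h = h.
Proof.
apply/funext => x; rewrite /heat mul0r.
under [X in int_velocity X]eq_fun do rewrite scale0r addr0.
rewrite /int_velocity RintegralZl//; last exact: integrable_gauss.
by rewrite mulrCA mulVf ?mulr1// gt_eqF// gauss_mass_gt0.
Qed.

Lemma heatD s u h x : perC u -> perC h ->
  heat s (fun x => u x + h x) x = heat s u x + heat s h x.
Proof.
move=> Cu Ch; rewrite /heat -mulrDr; congr (_ * _).
rewrite /int_velocity -RintegralD//; try exact: integrable_heat.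
by apply: eq_Rintegral => t _; rewrite mulrDl.
Qed.

Lemma heat_sum s (I : Type) (r : seq I) (h : I -> V -> R) x : (forall i, perC (h i)) ->
  heat s (fun x => \sum_(i <- r) h i x) x = \sum_(i <- r) heat s (h i) x.
Proof.
move=> Ch; elim: r => [|i r IH].
  rewrite big_nil /heat; under [X in int_velocity X]eq_fun do rewrite big_nil mul0r.
  by rewrite /int_velocity Rintegral_cst// mul0r mulr0.
under [X in heat s X]eq_fun do rewrite big_cons.
by rewrite heatD// ?IH ?big_cons//; exact: perC_sum.
Qed.

(* Gaussian integration by parts. *)
Lemma heat_coord s h x i : perC h ->
  gauss_mass^-1 * int_velocity (fun v : V => v 0 i * partial i h (x + (s / (2 * pi)) *: v) * gauss v)
  = s / (2 * pi) * heat s (partial i (partial i h)) x.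
Proof.
move=> Ch; pose c := s / (2 * pi).
have Ci := perC_partial i Ch; have Cii := perC_partial i Ci.
have [M M0 hM] := perC_bounded Ci.
pose F v := partial i h (x + c *: v) * gauss v.
have lc : linear (fun v : V => c *: v) by move=> a u w; rewrite scalerDr !scalerA mulrC.
have cc : continuous (fun v : V => c *: v) by exact: scaler_continuous.
have shiftE (u : V -> R) : (fun v => u (x + c *: v)) = (fun v => u (c *: v + x)).
  by apply/funext => v; rewrite addrC.
have Cs : Cinfty (fun v => partial i h (x + c *: v)).
  by rewrite shiftE; exact: Cinfty_affine Ci.2.
have CF : Cinfty F by apply: CinftyM => //; exact: Cinfty_gauss.
have DF v : partial i F v =
    c * (partial i (partial i h) (x + c *: v) * gauss v) -
    v 0 i * partial i h (x + c *: v) * gauss v.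
  rewrite partialM//; last exact: Cinfty_gauss.
  rewrite partial_gauss shiftE.
  have [_ E] := differentiable_affine lc cc (Cinfty_diff Ci.2 (c *: v + x)).
  rewrite {2}/partial E deriveZdir; last exact: Cinfty_diff Ci.2 _.
  by rewrite (addrC (c *: v)) -/(partial i (partial i h) _); ring.
have i1 := integrable_heat s x Cii.
have i2 : vel_integrable (fun v : V => v 0 i * partial i h (x + c *: v) * gauss v).
  exact: (integrable_gauss_coordM i (Cinfty_continuous Cs) (fun v => hM (x + c *: v))).
have iF : vel_integrable F by exact: integrable_heat.
have iDF : vel_integrable (partial i F).
  under eq_fun do rewrite DF.
  by apply: integrable_EFinB => //; exact: integrable_EFinZ.
have := int_velocity_partial CF iF iDF.
rewrite /int_velocity; under eq_Rintegral do rewrite DF.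
rewrite RintegralB//; last exact: integrable_EFinZ.
rewrite RintegralZl// => /eqP; rewrite subr_eq0 => /eqP <-.
by rewrite /heat /int_velocity mulrCA.
Qed.

(** The heat equation in the parameter [s]. Differentiation under the integral produces
    [v . grad h], which [heat_coord] turns into the Laplacian. One factor [1 / (2 pi)] comes from
    the derivative of [s / (2 * pi)], the other from the Gaussian integration by parts. *)
Lemma heat_derive s h x : perC h ->
  is_derive s (1 : R) (fun s => heat s h x)
    (s / (2 * pi) ^+ 2 * heat s (laplacian h) x).
Proof.
move=> Ch; pose r : R := (2 * pi)^-1.
have r0 : 0 <= r by rewrite invr_ge0 mulr_ge0// pi_ge0.
pose f (s : R) (t : n.-tuple R) := h (x + (s / (2 * pi)) *: row_of_tuple t) * gauss (row_of_tuple t).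
have Cp i := perC_partial i Ch.
have /choice[M HM] : forall i, exists M, forall y, `|partial i h y| <= M.
  by move=> i; have [M _ HM] := perC_bounded (Cp i); exists M.
pose df (s : R) (t : n.-tuple R) := \sum_(i < n) r * (row_of_tuple t 0 i *
  partial i h (x + (s / (2 * pi)) *: row_of_tuple t) * gauss (row_of_tuple t)).
have dfE s' t : is_derive s' (1 : R) (f ^~ t) (df s' t).
  have sE (c : R) : x + (c / (2 * pi)) *: row_of_tuple t = x + c *: (r *: row_of_tuple t).
    by rewrite scalerA.
  have dl := is_derive_line (x := x) (h := r *: row_of_tuple t) (t := s')
    (Cinfty_diff Ch.2 (x + s' *: (r *: row_of_tuple t))).
  have -> : f ^~ t = (fun c => h (x + c *: (r *: row_of_tuple t))) * cst (gauss (row_of_tuple t)).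
    by apply/funext => c; rewrite /f sE.
  apply: is_derive_eq; rewrite scaler0 add0r derive_row; last exact: Cinfty_diff Ch.2 _.
  rewrite [LHS]mulr_sumr /df; apply: eq_bigr => i _.
  by rewrite sE !mxE /=; ring.
have i1 s' : vel.-integrable setT (EFin \o f s') by exact: integrable_heat.
pose G (t : n.-tuple R) := \sum_(i < n) r * (M i * (32 ^+ n * (weight (row_of_tuple t))^-1)).
have M0 i : 0 <= M i by exact: le_trans (HM i x).
have wV0 (v : V) : 0 <= (weight v)^-1 by rewrite invr_ge0 ltW// weight_gt0.
have iG : vel.-integrable setT (EFin \o G).
  apply: integrable_EFin_sum => i; do 3!apply: integrable_EFinZ.
  exact: integrable_weightV.
have G0 t : 0 <= G t.
  by apply: sumr_ge0 => i _; rewrite !mulr_ge0// exprn_ge0.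
have dfG s' t : `|df s' t| <= G t.
  rewrite (le_trans (ler_norm_sum _ _ _))//; apply: ler_sum => i _.
  rewrite normrM (ger0_norm r0) ler_wpM2l// 2!normrM [X in X * _ <= _]mulrC -mulrA.
  rewrite ler_pM// ?mulr_ge0// (ger0_norm (gauss_ge0 _)).
  apply: le_trans (@gauss_weight R n _ i); rewrite ler_wpM2r ?gauss_ge0// ler_wpDl//.
have d1E s' t : partial1of2 f s' t = df s' t.
  by rewrite partial1of2E; have := dfE s' t => dd; rewrite derive_val.
have I s' : s' \in `]s' - 1, s' + 1[ by rewrite in_itv/= ltrBlDr ltrDl ltr01.
have der s' t : derivable (f ^~ t) s' 1 by case: (dfE s' t).
have dF : is_derive s (1 : R) (fun s => \int[vel]_t f s t) (\int[vel]_t df s t).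
  apply: DeriveDef.
    apply: (@derivable_under_integral R _ _ vel f setT measurableT s (s - 1) (s + 1) _ _ _ G) => //.
    - exact: I.
    - by move=> s' t _ _; rewrite d1E.
  rewrite -derive1E (@differentiation_under_integral R _ _ vel f setT measurableT s (s - 1) (s + 1) _ _ _ G) => //.
  - by apply: eq_Rintegral => t _; rewrite d1E.
  - exact: I.
  - by move=> s' t _ _; rewrite d1E.
have -> : (fun s => heat s h x) = cst gauss_mass^-1 * (fun s => \int[vel]_t f s t).
  by apply/funext.
apply: is_derive_eq; rewrite scaler0 addr0.
have iD i : vel_integrable (fun v : V => v 0 i * partial i h (x + (s / (2 * pi)) *: v) * gauss v).
  exact: (integrable_gauss_coordM i
    (@continuous_affine_row (partial i h) _ _ (perC_continuous (Cp i)))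
    (fun v => HM i (x + (s / (2 * pi)) *: v))).
rewrite /df (@Rintegral_sum R _ _ vel _ _ (fun i t => r * (row_of_tuple t 0 i *
  partial i h (x + (s / (2 * pi)) *: row_of_tuple t) * gauss (row_of_tuple t)))); last first.
  by move=> i; apply: integrable_EFinZ; exact: iD.
rewrite heat_sum; last by move=> i; exact: perC_partial.
rewrite [LHS]mulr_sumr mulr_sumr; apply: eq_bigr => i _.
rewrite (RintegralZl _ measurableT (iD i)).
have := heat_coord s x i Ch; rewrite /int_velocity => E.
rewrite [LHS]mulrCA E mulrA; congr (_ * _).
by rewrite mulrCA -invfM -expr2.
Qed.

End heat.

(** * The Poisson equation on the torus *)

Section counting_series.
Context {R : realType}.

Lemma integral_telescope (a : nat -> R) : a x @[x --> \oo] --> 0 ->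
  (@counting nat R).-integrable setT (EFin \o (fun k => a k.+1 - a k)) ->
  \int[@counting nat R]_k (a k.+1 - a k) = - a 0.
Proof.
move=> a0 ia; have sa : summable setT (EFin \o (fun k => a k.+1 - a k)).
  move/integrableP : ia => [_].
  rewrite ge0_integral_count; last by move=> k; exact: abse_ge0.
  by rewrite nneseries_esumT//; move=> k _; exact: abse_ge0.
rewrite /Rintegral integral_count//.
apply: (congr1 fine (_ : _ = (- a 0)%:E)).
apply/cvg_lim => //.
rewrite (_ : (fun N => _) = EFin \o (fun N => a N - a 0)).
  apply: cvg_EFin; first exact: nearW.
  by rewrite -[X in _ --> X]add0r; apply: cvgB => //; exact: cvg_cst.
apply/funext => N /=; rewrite sumEFin; congr EFin.
by rewrite -telescope_sumr.
Qed.

Lemma integrable_geometric (q c : R) : 0 <= q -> q < 1 -> 0 <= c ->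
  (@counting nat R).-integrable setT (EFin \o (fun k => q ^+ k * c)).
Proof.
move=> q0 q1 c0; apply/integrableP; split; first by move=> _ Y _.
rewrite ge0_integral_count; last by move=> k; exact: abse_ge0.
apply: (@le_lt_trans _ _ (c * (1 - q)^-1)%:E); last exact: ltry.
apply: lime_le; first by apply: is_cvg_nneseries => k _ _; exact: abse_ge0.
apply: nearW => N /=.
rewrite sumEFin lee_fin.
rewrite (eq_bigr (fun k => geometric c q k)); last first.
  by move=> k _; rewrite ger0_norm ?mulr_ge0 ?exprn_ge0// mulrC.
rewrite -[leLHS]/(series (geometric c q) N) geometric_seriesE ?lt_eqF//=.
by rewrite ler_wpM2r ?invr_ge0 ?subr_ge0 ?(ltW q1)// ler_piMr// gerBl exprn_ge0.
Qed.

End counting_series.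

Section poisson.
Context {R : realType} {n : nat}.
Local Notation V := 'rV[R]_n.
Implicit Types (h u : V -> R) (x : V).
Local Notation circ := (@circle_measure R).

Lemma integrable_circle_continuous (g : R -> R) : continuous g ->
  circ.-integrable setT (EFin \o g).
Proof.
move=> cg; have mg : measurable_fun setT (EFin \o g).
  by apply/measurable_EFinP; exact: continuous_measurable_fun.
apply/integrableP; split => //.
rewrite integral_circle_real; last exact: measurableT_comp.
have /integrableP[] // := @continuous_compact_integrable R g _
  (@segment_compact R 0 (2 * pi)) (continuous_subspaceT cg).
Qed.

Lemma heat_continuous h x : perC h -> continuous (fun s : R => heat s h x).
Proof.
move=> Ch s; apply/differentiable_continuous/derivable1_diffP.
by case: (heat_derive s x Ch).
Qed.

Lemma heat_rate_continuous h x : perC h ->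
  continuous (fun s : R => s / (2 * pi) ^+ 2 * heat s h x).
Proof.
move=> Ch s; apply: cvgM; last exact: heat_continuous.
by apply: cvgM; [exact: cvg_id|exact: cvg_cst].
Qed.

(** In the time variable [t = (s / (2 * pi)) ^+ 2 / 2] this is the integral of the heat flow up to
    time 1/2, the factor [s / (2 * pi) ^+ 2] being [dt / ds]. *)
Definition heat_potential h x : R :=
  \int[circ]_s (s / (2 * pi) ^+ 2 * heat s h x).

Definition heat_potential_norm : R := \int[circ]_s `|s / (2 * pi) ^+ 2|.

Lemma integrable_heat_potential_norm :
  circ.-integrable setT (EFin \o (fun s : R => `|s / (2 * pi) ^+ 2|)).
Proof.
apply: integrable_circle_continuous; apply: continuous_normr => s.
by apply: cvgM; [exact: cvg_id|exact: cvg_cst].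
Qed.

Lemma heat_potential_norm_ge0 : 0 <= heat_potential_norm.
Proof. by apply: Rintegral_ge0. Qed.

Lemma heat_potential_bound h x M : perC h -> (forall x, `|h x| <= M) ->
  `|heat_potential h x| <= heat_potential_norm * M.
Proof.
move=> Ch hM; have ih := integrable_circle_continuous (@heat_rate_continuous _ x Ch).
rewrite (le_trans (le_normr_Rintegral _ ih))//.
rewrite [leRHS]mulrC /heat_potential_norm -RintegralZl//; last exact: integrable_heat_potential_norm.
apply: le_Rintegral => //.
- exact: (integrable_norm ih).
- exact: (integrable_EFinZ M integrable_heat_potential_norm).
by move=> s _; rewrite normrM mulrC ler_wpM2r//; exact: heat_bound.
Qed.

Lemma heat_potential_perC h : perC h -> perC (heat_potential h) /\
  forall a, Dw a (heat_potential h) = heat_potential (Dw a h).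
Proof.
move=> Ch; pose k (s : R) x := s / (2 * pi) ^+ 2 * heat s h x.
have kE a s : Dw a (k s) = fun x => s / (2 * pi) ^+ 2 * heat s (Dw a h) x.
  have [[_ Cs] Ds] := heat_perC s Ch.
  by rewrite /Dw /k iter_deriveZ// -/(Dw a _) Ds.
have /choice[M HM] : forall a, exists M, forall x, `|Dw a h x| <= M.
  by move=> a; have [M _ HM] := perC_bounded (perC_Dw a Ch); exists M.
have [] := @Cinfty_integral R n _ _ circ k
  (fun a s => M a * `|s / (2 * pi) ^+ 2|).
- by move=> s; apply: CinftyZ; case: (heat_perC s Ch) => -[].
- move=> a x; rewrite (_ : (fun s => _) = fun s => s / (2 * pi) ^+ 2 * heat s (Dw a h) x).
    exact: (continuous_measurable_fun (@heat_rate_continuous _ x (perC_Dw a Ch))).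
  by apply/funext => s; rewrite kE.
- by move=> a; exact: (integrable_EFinZ (M a) integrable_heat_potential_norm).
- move=> a s x; rewrite kE normrM mulrC ler_wpM2r//.
  by apply: heat_bound; [exact: perC_Dw|exact: HM].
move=> CU DU; have U0 : (fun x => \int[circ]_s Dw [::] (k s) x) = heat_potential h.
  by [].
rewrite U0 in CU DU; split; last first.
  move=> a; rewrite DU; apply/funext => x.
  by apply: eq_Rintegral => s _; rewrite kE.
split; last exact: CU.
move=> i x; apply: eq_Rintegral => s _.
by case: (heat_perC s Ch) => -[-> _].
Qed.

(** The Laplacian of the integrand is the derivative of [heat s h x] in [s], so the fundamental
    theorem leaves the two endpoint values, and [heat 0] is the identity. *)
Lemma laplacian_heat_potential h x : perC h ->
  laplacian (heat_potential h) x = heat (2 * pi) h x - h x.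
Proof.
move=> Ch; have [_ DW] := heat_potential_perC Ch.
have Cii i : perC (partial i (partial i h)) by do 2!apply: perC_partial.
have -> : laplacian (heat_potential h) x = heat_potential (laplacian h) x.
  rewrite /laplacian.
  have E i : partial i (partial i (heat_potential h)) x =
      heat_potential (partial i (partial i h)) x := congr1 (fun g => g x) (DW [:: i; i]).
  rewrite (eq_bigr _ (fun i _ => E i)).
  rewrite /heat_potential -Rintegral_sum.
    by apply: eq_Rintegral => s _; rewrite heat_sum// mulr_sumr.
  by move=> i; apply: integrable_circle_continuous; exact: heat_rate_continuous (Cii i).
rewrite /heat_potential /Rintegral.
rewrite (circle_FTC (fun s => heat_derive s x Ch) (@heat_rate_continuous _ x (perC_laplacian Ch))).
by rewrite /= heat0.
Qed.

Lemma int_torus_laplacian u : perC u -> int_torus (laplacian u) = 0.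
Proof.
move=> Cu; rewrite /laplacian int_torus_sum.
- by rewrite big1// => i _; apply: int_torus_partial; exact: perC_partial.
- by move=> i; case: (perC_partial i (perC_partial i Cu)).
- by move=> i; apply: perC_continuous; do 2!apply: perC_partial.
Qed.

(** The difference [heat (2 * pi) h - h] is the Laplacian of a periodic function, whose integral
    vanishes. *)
Lemma int_torus_heat h : perC h -> int_torus (heat (2 * pi) h) = int_torus h.
Proof.
move=> Ch; have [CW _] := heat_potential_perC Ch.
have CP := (heat_perC (2 * pi) Ch).1.
have := int_torus_laplacian CW.
rewrite (_ : laplacian _ = fun x => heat (2 * pi) h x - h x); last first.
  by apply/funext => x; exact: laplacian_heat_potential.
rewrite int_torusB; [|exact: CP.1|exact: perC_continuous|exact: Ch.1|exact: perC_continuous].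
by move=> /eqP; rewrite subr_eq0 => /eqP.
Qed.

(** The fraction of the Gaussian mass left after removing its uniform part on the period cell. *)
Definition contraction : R := 1 - @cell_mass R n / @gauss_mass R n.

Lemma contraction_ge0 : 0 <= contraction.
Proof. by rewrite subr_ge0 ler_pdivrMr ?gauss_mass_gt0// mul1r cell_mass_le. Qed.

Lemma contraction_lt1 : contraction < 1.
Proof. by rewrite ltrBlDr ltrDl divr_gt0 ?gauss_mass_gt0// cell_mass_gt0. Qed.

(* Doeblin's argument: the Gaussian dominates a multiple of the uniform law on
   one period cell, and the latter does not see functions of zero mean. *)
Lemma heat_contraction h M x : perC h -> int_torus h = 0 ->
  (forall x, `|h x| <= M) -> `|heat (2 * pi) h x| <= contraction * M.
Proof.
move=> Ch h0 hM.
(* A one-sided bound suffices, applied to [h] and to [- h]. Since [M - w] is nonnegative, its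
   Gaussian average is at least its share on the period cell, and there [w] drops out because its
   mean is zero. *)
have key (w : V -> R) : perC w -> int_torus w = 0 -> (forall x, w x <= M) ->
    heat (2 * pi) w x <= contraction * M.
  move=> Cw w0 wM.
  have p1 : 2 * pi / (2 * pi) = 1 :> R by rewrite divff// gt_eqF// mulr_gt0// pi_gt0.
  have cwx : continuous (fun v : V => w (v + x)).
    by apply: continuous_shift_row; exact: perC_continuous.
  have pwx : Defs.periodic (fun v : V => w (v + x)).
    by move=> i v; rewrite addrAC Cw.1.
  have cu : continuous (fun v : V => M - w (v + x)).
    exact: Cinfty_continuous (CinftyB (@Cinfty_cst R V M) (Cinfty_shift x Cw.2)).
  have H := torus_le_gauss cu (fun v : V => ltac:(by rewrite subr_ge0)).
  have iT : (@torus_measure R n).-integrable setT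
      (EFin \o (fun t => M - w (row_of_tuple t + x))).
    by apply: (integrable_torus (u := fun v => M - w (v + x))) => // i v; rewrite pwx.
  have iV : (@velocity_measure R n).-integrable setT
      (EFin \o (fun t => (M - w (row_of_tuple t + x)) * gauss (row_of_tuple t))).
    have [B B0 HB] := perC_bounded (perCB (perC_cst M) Cw).
    exact: (integrable_gaussM cu (fun v : V => HB (v + x))).
  rewrite -(fineK (integrable_fin_num measurableT iT))
    -(fineK (integrable_fin_num measurableT iV)) -EFinM lee_fin in H.
  have ET : int_torus (fun v : V => M - w (v + x)) = M * (2 * pi) ^+ n.
    rewrite (int_torusB (u := fun=> M)) ?int_torus_cst//; last first.
      by move=> v; exact: cst_continuous.
    by rewrite int_torus_translation ?w0 ?subr0//; [exact: Cw.1|exact: perC_continuous].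
  have EV : int_velocity (fun v : V => (M - w (v + x)) * gauss v) =
      M * @gauss_mass R n - @gauss_mass R n * heat (2 * pi) w x.
    rewrite /heat mulrA divff ?mul1r ?gt_eqF ?gauss_mass_gt0//.
    rewrite /gauss_mass /int_velocity -RintegralZl//; last exact: integrable_gauss.
    have ih := integrable_heat (2 * pi) x Cw.
    rewrite -RintegralB//; last exact: (integrable_EFinZ M (@integrable_gauss R n)).
    by apply: eq_Rintegral => t _; rewrite p1 scale1r mulrBl (addrC x).
  have {}H : expR (- (2 * pi) ^+ 2 / 2) ^+ n * int_torus (fun v : V => M - w (v + x)) <=
    int_velocity (fun v : V => (M - w (v + x)) * gauss v) := H.
  rewrite ET EV in H.
  rewrite /contraction mulrBl mul1r lerBrDr -lerBrDl.
  have -> : @cell_mass R n / @gauss_mass R n * M = (expR (- (2 * pi) ^+ 2 / 2) ^+ n * (M * (2 * pi) ^+ n)) / @gauss_mass R n.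
    by rewrite /cell_mass; ring.
  rewrite ler_pdivrMr ?gauss_mass_gt0// (le_trans H)//.
  by rewrite mulrBl lerB// mulrC.
have H1 := key _ Ch h0 (fun x => le_trans (ler_norm _) (hM x)).
have H2 : heat (2 * pi) (fun x => - h x) x <= contraction * M.
  apply: key; first exact: perCN.
    under [X in int_torus X]eq_fun do rewrite -mulN1r.
    by rewrite int_torusZ ?h0 ?mulr0//; [exact: Ch.1|exact: perC_continuous].
  by move=> y; rewrite (le_trans _ (hM y))// -normrN ler_norm.
rewrite ler_norml H1 andbT lerNl.
move: H2; rewrite /heat.
under [X in int_velocity X]eq_fun do rewrite mulNr -mulN1r.
by rewrite /int_velocity RintegralZl ?mulN1r ?mulrN//; exact: integrable_heat.
Qed.

End poisson.

(** * Sup bound, existence and uniqueness for the Poisson equation *)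

Section poisson_equation.
Context {R : realType} {n : nat}.
Local Notation V := 'rV[R]_n.
Implicit Types (h u : V -> R) (x : V).
Local Notation q := (@contraction R n).
Local Notation P := (@heat R n (2 * pi)).

Lemma heat_potential_laplacian u x : perC u ->
  heat_potential (laplacian u) x = P u x - u x.
Proof.
move=> Cu; rewrite /heat_potential /Rintegral.
rewrite (circle_FTC (fun s => heat_derive s x Cu)
  (@heat_rate_continuous _ _ _ x (perC_laplacian Cu))).
by rewrite /= heat0.
Qed.

Definition poisson_constant : R := @heat_potential_norm R / (1 - q).

Lemma poisson_constant_ge0 : 0 <= poisson_constant.
Proof. by rewrite divr_ge0 ?heat_potential_norm_ge0// subr_ge0 ltW// contraction_lt1. Qed.

(** Writing [u] as [P u] minus the heat potential of [laplacian u] gives [sup |u| <= q * sup |u| +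
    heat_potential_norm * M]; as [q < 1], the first term is absorbed on the left. *)
Lemma poisson_bound u M x : perC u -> int_torus u = 0 ->
  (forall y, `|laplacian u y| <= M) -> `|u x| <= poisson_constant * M.
Proof.
move=> Cu u0 uM; have [B0 B00 HB0] := perC_bounded Cu.
pose S := [set `|u y| | y in [set: V]].
have hS : has_sup S.
  by split; [exists `|u 0|, 0|exists B0 => _ [y _ <-]; exact: HB0].
have uS y : `|u y| <= sup S by apply: ub_le_sup; [exact: hS.2|exists y].
rewrite /poisson_constant mulrAC ler_pdivlMr ?subr_gt0 ?contraction_lt1//.
apply: (@le_trans _ _ (sup S * (1 - q))).
  by rewrite ler_wpM2r ?uS// subr_ge0 ltW// contraction_lt1.
rewrite mulrBr mulr1 lerBlDr [sup S * q]mulrC.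
apply: ge_sup; first exact: hS.1.
move=> _ [y _ <-].
have -> : u y = P u y - heat_potential (laplacian u) y.
  by rewrite heat_potential_laplacian// opprB addrC subrK.
rewrite (le_trans (ler_normB _ _))// addrC lerD//.
  exact: heat_potential_bound (perC_laplacian Cu) uM.
exact: heat_contraction.
Qed.

Lemma int_torus_Dw h a : perC h -> int_torus h = 0 -> int_torus (Dw a h) = 0.
Proof.
move=> Ch h0; case: a => // i a; apply: int_torus_partial; exact: perC_Dw.
Qed.

Lemma iter_heat h k : perC h -> int_torus h = 0 ->
  [/\ perC (iter k P h), int_torus (iter k P h) = 0,
      forall a, Dw a (iter k P h) = iter k P (Dw a h) &
      forall M, (forall x, `|h x| <= M) -> forall x, `|iter k P h x| <= q ^+ k * M].
Proof.
move=> Ch h0; elim: k => [|k [Ck k0 Dk Bk]].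
  by split=> // M hM x; rewrite expr0 mul1r.
have [CP DP] := heat_perC (2 * pi) Ck; split=> //=.
- by rewrite int_torus_heat.
- by move=> a; rewrite DP Dk.
- move=> M hM x; rewrite exprS -mulrA; apply: heat_contraction => // y.
  exact: Bk.
Qed.

(* The Neumann series of [P] summed under the heat potential. *)
Lemma poisson_neumann h : perC h -> int_torus h = 0 ->
  exists2 u, perC u & forall x, laplacian u x = h x.
Proof.
move=> Ch h0.
have hk k := iter_heat k Ch h0.
have Ck k : perC (iter k P h) by case: (hk k).
pose w k := heat_potential (iter k P h).
have /choice[M HM] : forall a, exists M, 0 <= M /\ forall x, `|Dw a h x| <= M.
  by move=> a; have [M M0 HM] := perC_bounded (perC_Dw a Ch); exists M.
have DwE a k : Dw a (w k) = heat_potential (iter k P (Dw a h)).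
  by have [_ ->] := heat_potential_perC (Ck k); have [_ _ -> _] := hk k.
(* [Dw a h] has mean zero too, so the contraction applies to each derivative separately and every
   differentiated series converges geometrically. *)
have wB a k x : `|Dw a (w k) x| <= q ^+ k * (heat_potential_norm * M a).
  have [Ca _ _ Ba] := iter_heat k (perC_Dw a Ch) (int_torus_Dw a Ch h0).
  rewrite DwE mulrCA; apply: heat_potential_bound => // y.
  by apply: Ba => z; case: (HM a).
have ig c : 0 <= c -> (@counting nat R).-integrable setT (EFin \o (fun k => q ^+ k * c)).
  by move=> c0; apply: integrable_geometric => //; [exact: contraction_ge0|exact: contraction_lt1].
have M0 a : 0 <= heat_potential_norm * M a.
  by rewrite mulr_ge0 ?heat_potential_norm_ge0//; case: (HM a).
have iw a x : (@counting nat R).-integrable setT (EFin \o (fun k => Dw a (w k) x)).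
  by apply: (le_EFin_integrable _ (fun k => wB a k x) (ig _ (M0 a))) => _ Y _.
have [] := @Cinfty_integral R n _ _ (@counting nat R) w
  (fun a k => q ^+ k * (heat_potential_norm * M a)).
- by move=> k; have [[]] := heat_potential_perC (Ck k).
- by move=> a x _ Y _.
- by move=> a; exact: ig.
- by move=> a k x; exact: wB.
set u := fun x => \int[@counting nat R]_k Dw [::] (w k) x.
move=> Cu Du.
have pu : Defs.periodic u.
  move=> i x; apply: eq_Rintegral => k _ /=.
  by have [[pk _] _] := heat_potential_perC (Ck k); exact: pk.
have Lu x : laplacian u x = - h x.
  rewrite /laplacian.
  under eq_bigr => i _ do rewrite -[partial i _]/(Dw [:: i; i] u) Du.
  rewrite -Rintegral_sum; last by move=> i; exact: iw.
  have E k : \sum_(i < n) Dw [:: i; i] (w k) x = iter k.+1 P h x - iter k P h x.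
    exact: (laplacian_heat_potential x (Ck k)).
  under eq_Rintegral do rewrite E.
  (* The partial sums are [iter N P h x - h x] and the iterates tend to 0. The sum is therefore
     [- h x], and the solution is [- u]. *)
  apply: (@integral_telescope R (fun k => iter k P h x)).
    have [_ Mx] := HM [::].
    apply: norm_cvg0; apply: (@squeeze_cvgr _ _ _ _ (fun=> 0) (fun k => q ^+ k * M [::])).
    - near=> k; rewrite normr_ge0/=; have [_ _ _ Bk] := hk k.
      by apply: Bk.
    - exact: cvg_cst.
    - rewrite -(mul0r (M [::])); apply: cvgMl.
      by apply: cvg_expr; rewrite ger0_norm ?contraction_ge0// contraction_lt1.
  under eq_fun do rewrite -E.
  by apply: integrable_EFin_sum => i; exact: iw.
exists (fun x => - u x); first exact: perCN.
move=> x; rewrite /laplacian.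
have E2 i : partial i (partial i (fun x => - u x)) x = - partial i (partial i u) x.
  rewrite -[LHS]/(Dw [:: i; i] (fun x => - u x) x) /Dw iter_deriveN//.
by under eq_bigr do rewrite E2; rewrite sumrN -/(laplacian u x) Lu opprK.
Unshelve. all: by end_near.
Qed.

Lemma poisson_solvable h : perC h -> int_torus h = 0 ->
  exists u, [/\ perC u, int_torus u = 0 & forall x, laplacian u x = h x].
Proof.
move=> Ch h0; have [u Cu Lu] := poisson_neumann Ch h0.
have p0 : (2 * pi) ^+ n != 0 :> R by rewrite gt_eqF// exprn_gt0// mulr_gt0// pi_gt0.
exists (fun x => u x - int_torus u / (2 * pi) ^+ n); split.
- by apply: perCB => //; exact: perC_cst.
- rewrite (int_torusB (w := fun=> int_torus u / (2 * pi) ^+ n)).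
  + by rewrite int_torus_cst divfK// subrr.
  + exact: Cu.1.
  + exact: perC_continuous.
  + by move=> i x.
  + by apply: perC_continuous; exact: perC_cst.
- move=> x; rewrite -Lu; apply: eq_bigr => i _.
  congr (partial i _ x); apply/funext => y.
  by rewrite partialB; [rewrite [X in _ - X]derive_cst subr0|exact: Cu.2|exact: Cinfty_cst].
Qed.

(** This is [poisson_bound] with [M = 0], applied to the difference. *)
Lemma poisson_unique u w : perC u -> perC w -> int_torus u = 0 -> int_torus w = 0 ->
  (forall x, laplacian u x = laplacian w x) -> u = w.
Proof.
move=> Cu Cw u0 w0 uw; apply/funext => x; apply/eqP; rewrite -subr_eq0 -normr_le0.
have E y : laplacian (fun x => u x - w x) y = 0.
  rewrite -[RHS](subrr (laplacian w y)) -{1}uw /laplacian -sumrB.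
  apply: eq_bigr => i _; rewrite -partialB;
    [|exact: (perC_partial i Cu).2|exact: (perC_partial i Cw).2].
  congr (partial i _ y); apply/funext => z.
  by rewrite partialB; [|exact: Cu.2|exact: Cw.2].
have := @poisson_bound (fun x => u x - w x) 0 x (perCB Cu Cw).
rewrite mulr0; apply; last by move=> y; rewrite E normr0.
rewrite int_torusB ?u0 ?w0 ?subrr//; [exact: Cu.1|exact: perC_continuous
  |exact: Cw.1|exact: perC_continuous].
Qed.

Lemma inv_laplacianP h : perC h -> int_torus h = 0 ->
  [/\ perC (inv_laplacian h), int_torus (inv_laplacian h) = 0 &
      forall x, laplacian (inv_laplacian h) x = h x].
Proof.
move=> Ch h0; have [u [[pu Cu] u0 Lu]] := poisson_solvable Ch h0.
have [] := @xgetPex _ (fun=> 0) [set u | [/\ Defs.periodic u, Cinfty u, int_torus u = 0 &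
                 forall x, laplacian u x = h x]].
  by exists u.
by move=> ? ? ? ?; split.
Qed.

End poisson_equation.

(** * Smooth functions on phase space and their densities *)

Section phase_words.
Context {R : realType} {d : nat}.
Local Notation V := 'rV[R]_d.
Local Notation phase := (V * V)%type.
Implicit Types (f F : phase -> R) (a c l : seq 'I_d).

Definition ex (i : 'I_d) : phase := (Defs.basis i, 0).
Definition ev (i : 'I_d) : phase := (0, Defs.basis i).
Definition Dx a F : phase -> R := iter_derive [seq ex i | i <- a] F.
Definition Dv c F : phase -> R := iter_derive [seq ev i | i <- c] F.

Lemma perm_count_word a :
  perm_eq (flatten [seq nseq (count_mem i a) i | i <- enum 'I_d]) a.
Proof.
apply/allP => x _ /=; apply/eqP; rewrite count_flatten sumnE -map_comp big_map.
rewrite big_enum (bigD1 x)//= count_nseq /= eqxx mul1n big1 ?addn0//.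
by move=> i ix; rewrite count_nseq /= (negbTE ix).
Qed.

Lemma multi_partial_word (w : 'I_d -> phase) (p : 'I_d -> nat) F :
  multi_partial (fun i g z => 'D_(w i) g z) p F =
  iter_derive [seq w i | i <- flatten [seq nseq (p i) i | i <- enum 'I_d]] F.
Proof.
rewrite /multi_partial; elim: (enum 'I_d) => //= i r ->.
rewrite map_cat iter_derive_cat; elim: (p i) => //= k -> .
by [].
Qed.

(** By symmetry of derivatives a word matters only through the number of occurrences of each letter;
    this links words to the multi-indices in [smooth]. *)
Lemma multi_partial_count (w : 'I_d -> phase) a F : Cinfty F ->
  multi_partial (fun i g z => 'D_(w i) g z) (fun i => count_mem i a) F =
  iter_derive [seq w i | i <- a] F.
Proof.
move=> CF; rewrite multi_partial_word; apply: iter_derive_perm => //.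
exact/perm_map/perm_count_word.
Qed.

Definition monomial l (v : V) : R := \prod_(i <- l) v 0 i.

Lemma monomialE l v : monomial l v = \prod_(i < d) v 0 i ^+ count_mem i l.
Proof.
rewrite /monomial -(perm_big _ (perm_count_word l))/= big_flatten/= big_map.
rewrite big_enum /=; apply: eq_bigr => i _.
by rewrite big_nseq; elim: (count_mem i l) => //= k ->; rewrite exprS.
Qed.

Definition xvword l a c f : phase -> R := fun z => monomial l z.2 * Dx a (Dv c f) z.

Lemma weighted_partialE l a c f : Cinfty f ->
  weighted_partial (fun i => count_mem i l) (fun i => count_mem i a)
    (fun i => count_mem i c) f = xvword l a c f.
Proof.
move=> Cf; apply/funext => z; rewrite /weighted_partial -monomialE; congr (_ * _).
have Ev : multi_partial partialv (fun i => count_mem i c) f = Dv c f.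
  exact: multi_partial_count.
by rewrite Ev (multi_partial_count ex a (Cinfty_iter_derive _ Cf)).
Qed.

Lemma Cinfty_vcoord i : Cinfty (fun z : phase => z.2 0 i).
Proof.
apply: Cinfty_linear; first by move=> c v w; rewrite /= !mxE.
move=> z; apply: (@continuous_comp _ _ _ (fun z : phase => z.2) (fun v : V => v 0 i)).
  exact: cvg_snd.
exact: coord_continuous.
Qed.

Lemma Cinfty_fst (u : V -> R) : Cinfty u -> Cinfty (fun z : phase => u z.1).
Proof.
move=> Cu; rewrite (_ : (fun _ => _) = fun z : phase => u (z.1 + 0)).
  by apply: Cinfty_affine; [move=> c z w|move=> z; exact: cvg_fst|].
by apply/funext => z; rewrite addr0.
Qed.

Lemma Cinfty_snd (u : V -> R) : Cinfty u -> Cinfty (fun z : phase => u z.2).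
Proof.
move=> Cu; rewrite (_ : (fun _ => _) = fun z : phase => u (z.2 + 0)).
  by apply: Cinfty_affine; [move=> c z w|move=> z; exact: cvg_snd|].
by apply/funext => z; rewrite addr0.
Qed.

Lemma Cinfty_monomial l : Cinfty (fun z : phase => monomial l z.2).
Proof. by apply: Cinfty_prod => i; exact: Cinfty_vcoord. Qed.

Lemma Cinfty_Dx a F : Cinfty F -> Cinfty (Dx a F).
Proof. exact: Cinfty_iter_derive. Qed.

Lemma Cinfty_Dv c F : Cinfty F -> Cinfty (Dv c F).
Proof. exact: Cinfty_iter_derive. Qed.

Lemma Cinfty_xvword l a c f : Cinfty f -> Cinfty (xvword l a c f).
Proof.
move=> Cf; apply: CinftyM; first exact: Cinfty_monomial.
exact/Cinfty_Dx/Cinfty_Dv.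
Qed.

Lemma continuous_pairl (v : V) : continuous (fun x : V => (x, v) : phase).
Proof. by move=> x; exact: (@cvg_pair _ _ _ (nbhs x) (nbhs x) (nbhs v) _ _ _ id (cst v) cvg_id (cvg_cst v)). Qed.

Lemma continuous_pairr (x : V) : continuous (fun v : V => (x, v) : phase).
Proof. by move=> v; exact: (@cvg_pair _ _ _ (nbhs v) (nbhs x) (nbhs v) _ _ _ (cst x) id (cvg_cst x) cvg_id). Qed.

Lemma xslice F v : (fun x : V => F (x, v)) = fun x => F ((x, 0) + (0, v)).
Proof. by apply/funext => x; congr F; congr pair; rewrite ?addr0 ?add0r. Qed.

Lemma vslice F x : (fun v : V => F (x, v)) = fun v => F ((0, v) + (x, 0)).
Proof. by apply/funext => v; congr F; congr pair; rewrite ?addr0 ?add0r. Qed.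

Lemma linear_pairl : linear (fun x : V => (x, 0) : phase).
Proof. by move=> c x y; congr pair; rewrite /= scaler0 addr0. Qed.

Lemma linear_pairr : linear (fun v : V => (0, v) : phase).
Proof. by move=> c x y; congr pair; rewrite /= scaler0 addr0. Qed.

Lemma Cinfty_xslice F v : Cinfty F -> Cinfty (fun x : V => F (x, v)).
Proof.
move=> CF; rewrite xslice; apply: Cinfty_affine => //; first exact: linear_pairl.
exact: continuous_pairl.
Qed.

Lemma Cinfty_vslice F x : Cinfty F -> Cinfty (fun v : V => F (x, v)).
Proof.
move=> CF; rewrite vslice; apply: Cinfty_affine => //; first exact: linear_pairr.
exact: continuous_pairr.
Qed.

Lemma Dw_xslice a F v x : Cinfty F -> Dw a (fun x : V => F (x, v)) x = Dx a F (x, v).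
Proof.
move=> CF; rewrite xslice /Dw (iter_derive_affine _ _ linear_pairl)//; last first.
  exact: continuous_pairl.
by rewrite -map_comp /Dx; congr (iter_derive _ F _); congr pair; rewrite ?addr0 ?add0r.
Qed.

Lemma Dw_vslice c F v x : Cinfty F -> Dw c (fun v : V => F (x, v)) v = Dv c F (x, v).
Proof.
move=> CF; rewrite vslice /Dw (iter_derive_affine _ _ linear_pairr)//; last first.
  exact: continuous_pairr.
by rewrite -map_comp /Dv; congr (iter_derive _ F _); congr pair; rewrite ?addr0 ?add0r.
Qed.

Lemma Dx_cat a b F : Dx (a ++ b) F = Dx a (Dx b F).
Proof. by rewrite /Dx map_cat iter_derive_cat. Qed.

Lemma Dx_monomialM a l F : Cinfty F ->
  Dx a (fun z => monomial l z.2 * F z) = fun z => monomial l z.2 * Dx a F z.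
Proof.
move=> CF; apply/funext => -[x v].
rewrite -Dw_xslice; last by apply: CinftyM => //; exact: Cinfty_monomial.
rewrite /= /Dw iter_deriveZ; last exact: Cinfty_xslice.
by congr (_ * _); exact: Dw_xslice.
Qed.

Lemma Dx_xvword a b l c f : Cinfty f -> Dx b (xvword l a c f) = xvword l (b ++ a) c f.
Proof.
move=> Cf; rewrite /xvword Dx_monomialM; first by rewrite Dx_cat.
exact/Cinfty_Dx/Cinfty_Dv.
Qed.

Lemma periodic_iter_derive F s : Cinfty F -> periodic_phase F ->
  periodic_phase (iter_derive s F).
Proof.
move=> CF pF v i x.
have E z : (fun z => F (z + (2 * pi) *: ex i)) z = F z.
  case: z => y w; rewrite -[RHS](pF w i); congr F; congr pair => /=.
  by rewrite scaler0 addr0.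
have := @iter_derive_affine R _ _ (fun z => z) ((2 * pi) *: ex i) F s.
rewrite (funext E) map_id => H; have /(congr1 (fun g => g (x, v))) := H (fun _ _ _ => erefl) (fun _ => cvg_id) CF.
move=> /= ->; congr (iter_derive s F); congr pair => /=.
by rewrite scaler0 addr0.
Qed.

Lemma periodic_phaseM F G : periodic_phase F -> periodic_phase G ->
  periodic_phase (fun z => F z * G z).
Proof. by move=> pF pG v i x; rewrite /= (pF v i) (pG v i). Qed.

Lemma periodic_xvword l a c f : Cinfty f -> periodic_phase f ->
  periodic_phase (xvword l a c f).
Proof.
move=> Cf pf; apply: periodic_phaseM; first by [].
apply: periodic_iter_derive; first exact: Cinfty_Dv.
exact: periodic_iter_derive.
Qed.

End phase_words.

(** * Integrability and the Cauchy-Schwarz inequality on phase space *)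

Section phase_integrals.
Context {R : realType} {d : nat}.
Local Notation V := 'rV[R]_d.
Local Notation phase := (V * V)%type.
Implicit Types (f F : phase -> R) (a c l : seq 'I_d).
Local Notation pmeas := (@phase_measure R d).

Lemma le_integrable_phase F G : continuous F -> (forall z, `|F z| <= G z) ->
  integrable_phase G -> integrable_phase F.
Proof.
move=> cF FG iG; apply: (@le_EFin_integrable _ _ _ pmeas
  (fun p => F (phase_of_tuples p)) (fun p => G (phase_of_tuples p))) => //.
exact: measurable_phase.
Qed.

Lemma integrable_phaseD F G : integrable_phase F -> integrable_phase G ->
  integrable_phase (fun z => F z + G z).
Proof. exact: integrable_EFinD. Qed.

Lemma integrable_phaseZ k F : integrable_phase F -> integrable_phase (fun z => k * F z).
Proof. exact: integrable_EFinZ. Qed.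

Lemma integrable_phase_sum (I : Type) (r : seq I) (F : I -> phase -> R) :
  (forall i, integrable_phase (F i)) -> integrable_phase (fun z => \sum_(i <- r) F i z).
Proof. exact: (@integrable_EFin_sum _ _ _ pmeas I r (fun i p => F i (phase_of_tuples p))). Qed.

Lemma int_phaseD F G : integrable_phase F -> integrable_phase G ->
  int_phase (fun z => F z + G z) = int_phase F + int_phase G.
Proof. move=> iF iG; exact: (@RintegralD _ _ _ pmeas setT
  (F \o @phase_of_tuples R d) (G \o @phase_of_tuples R d) measurableT iF iG). Qed.

Lemma int_phaseZ k F : integrable_phase F ->
  int_phase (fun z => k * F z) = k * int_phase F.
Proof. move=> iF; exact: (@RintegralZl _ _ _ pmeas setT (F \o @phase_of_tuples R d) k measurableT iF). Qed.

Lemma int_phase_sum (I : Type) (r : seq I) (F : I -> phase -> R) :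
  (forall i, integrable_phase (F i)) ->
  int_phase (fun z => \sum_(i <- r) F i z) = \sum_(i <- r) int_phase (F i).
Proof. exact: (@Rintegral_sum _ _ _ pmeas I r (fun i p => F i (phase_of_tuples p))). Qed.

Lemma le_int_phase F G : integrable_phase F -> integrable_phase G ->
  (forall z, F z <= G z) -> int_phase F <= int_phase G.
Proof. by move=> iF iG FG; apply: (@le_Rintegral _ _ _ pmeas setT
  (F \o @phase_of_tuples R d) (G \o @phase_of_tuples R d) measurableT iF iG) => p _; exact: FG. Qed.

Lemma integrable_phase_weightV : integrable_phase (fun z : phase => (weight z.2)^-1).
Proof.
have mw : measurable_fun setT (fun p : d.-tuple R * d.-tuple R =>
    (weight (row_of_tuple p.2))^-1 : R).
  apply: (@measurable_phase _ _ (fun z : phase => (weight z.2)^-1)) => z.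
  apply: (@continuous_comp _ _ _ (fun z : phase => z.2) (fun v : V => (weight v)^-1)).
    exact: cvg_snd.
  exact: continuous_weightV.
apply/(integrable12ltyP (@torus_measure R d) (@velocity_measure R d)).
  exact/measurable_EFinP.
have iw := @integrable_weightV R d.
pose c := (\int[@velocity_measure R d]_t `|((weight (row_of_tuple t))^-1)%:E|)%E.
rewrite [X in (X < _)%E](_ : _ = (\int[@torus_measure R d]_t (cst c) t)%E)//.
rewrite integral_cst// lte_mul_pinfty//.
- exact: integral_ge0.
- by rewrite ge0_fin_numE; [case/integrableP: iw|exact: integral_ge0].
- exact: torus_measure_fin.
Qed.

Lemma Lfun2_sqr d' (T : measurableType d') (mu : {measure set T -> \bar R}) (F : T -> R) :
  measurable_fun setT F -> mu.-integrable setT (EFin \o (fun t => F t ^+ 2)) ->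
  F \in Lfun mu 2%:E.
Proof.
move=> mF /integrableP[_ iF]; rewrite inE; apply/andP; split; first by rewrite inE.
rewrite inE /= /finite_norm unlock poweR_lty//.
rewrite (le_lt_trans _ iF)// le_eqVlt; apply/orP; left; apply/eqP.
by apply: eq_integral => t _ /=; rewrite powR_mulrn ?normrX.
Qed.

(** As [weight] is at least 1, the square of its inverse is bounded by the inverse, which is
    integrable. *)
Lemma le_weightV_Lfun2 F C : continuous F -> (forall z, `|F z| <= C * (weight z.2)^-1) ->
  F \o phase_of_tuples \in Lfun pmeas 2%:E.
Proof.
move=> cF FC; apply: Lfun2_sqr; first exact: measurable_phase.
have cF2 : continuous (fun z => F z ^+ 2).
  by move=> z; apply: (@CkM R _ 0).
apply: (le_integrable_phase cF2 _ (integrable_phaseZ (C ^+ 2) integrable_phase_weightV)).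
move=> z; rewrite normrX.
have w1 : (weight z.2)^-1 <= 1.
  rewrite invf_le1 ?weight_gt0//; rewrite /weight.
  by apply: (@big_ind _ (fun x : R => 1 <= x)) => // [x y x1 y1|i _];
    [rewrite mulr_ege1|rewrite lerDl sqr_ge0].
have w0 : 0 <= (weight z.2)^-1 by rewrite invr_ge0 ltW// weight_gt0.
apply: (@le_trans _ _ ((C * (weight z.2)^-1) ^+ 2)).
  by rewrite ler_pXn2r// ?nnegrE// (le_trans _ (FC z)).
rewrite exprMn ler_wpM2l ?sqr_ge0// expr2 ler_piMl//.
Qed.

Lemma weightV_Lfun2 :
  (fun z : phase => (weight z.2)^-1) \o phase_of_tuples \in Lfun pmeas 2%:E.
Proof.
apply: (@le_weightV_Lfun2 _ 1).
  move=> z; apply: (@continuous_comp _ _ _ (fun z : phase => z.2) (fun v : V => (weight v)^-1)).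
    exact: cvg_snd.
  exact: continuous_weightV.
by move=> z; rewrite mul1r ger0_norm// invr_ge0 ltW// weight_gt0.
Qed.

Definition weight_norm : R := L2norm (fun z : phase => (weight z.2)^-1).

Lemma L2norm_ge0 F : 0 <= L2norm F.
Proof. by rewrite /L2norm fine_ge0// Lnorm_ge0. Qed.

Lemma cauchy_schwarz_phase F G : F \o phase_of_tuples \in Lfun pmeas 2%:E ->
  G \o phase_of_tuples \in Lfun pmeas 2%:E ->
  integrable_phase (fun z => F z * G z) /\
  int_phase (fun z => `|F z * G z|) <= L2norm F * L2norm G.
Proof.
move=> F2 G2; have /Lfun1_integrable iFG := Lfun2_mul_Lfun1 F2 G2; split=> //.
move: F2 G2; rewrite !inE => /andP[/[!inE]/= mF nF] /andP[/[!inE]/= mG nG].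
have H := @hoelder _ _ _ pmeas _ _ 2 2 mF mG.
have {}H : ('N[pmeas]_1[EFin \o ((F \o phase_of_tuples) \* (G \o phase_of_tuples))%R] <=
  'N[pmeas]_2%:E[EFin \o (F \o phase_of_tuples)] * 'N[pmeas]_2%:E[EFin \o (G \o phase_of_tuples)])%E.
  by apply: H => //; rewrite [RHS]splitr !div1r.
rewrite /L2norm /int_phase /Rintegral -fineM ?ge0_fin_numE ?Lnorm_ge0//.
have e : (\int[pmeas]_p (`|F (phase_of_tuples p) * G (phase_of_tuples p)|)%:E =
  'N[pmeas]_1[EFin \o ((F \o phase_of_tuples) \* (G \o phase_of_tuples))%R])%E.
  by rewrite Lnorm1.
rewrite e fine_le// ge0_fin_numE ?Lnorm_ge0//.
- by rewrite (le_lt_trans H)// lte_mul_pinfty// ?ge0_fin_numE ?Lnorm_ge0.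
- by rewrite lte_mul_pinfty// ?ge0_fin_numE ?Lnorm_ge0.
- by rewrite mule_ge0// Lnorm_ge0.
Qed.

End phase_integrals.

(** * L^1 bounds from the norms of smooth functions *)

Section smooth_bounds.
Context {R : realType} {d : nat}.
Local Notation V := 'rV[R]_d.
Local Notation phase := (V * V)%type.
Implicit Types (f F : phase -> R) (a c l : seq 'I_d).
Local Notation pmeas := (@phase_measure R d).

Lemma smooth_norm_ge0 N f : 0 <= smooth_norm N f.
Proof. by do 3! (apply: sumr_ge0 => ? _); exact: L2norm_ge0. Qed.

Lemma ler_sum_term (I : finType) (F : I -> R) i : (forall j, 0 <= F j) ->
  F i <= \sum_j F j.
Proof. by move=> F0; rewrite (bigD1 i)//= lerDl sumr_ge0. Qed.

Lemma L2norm_smooth_norm N (m p q : 'I_d -> nat) f :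
  (forall i, m i <= N)%N -> (forall i, p i <= N)%N -> (forall i, q i <= N)%N ->
  L2norm (weighted_partial m p q f) <= smooth_norm N f.
Proof.
move=> mN pN qN; pose o (r : 'I_d -> nat) : {ffun 'I_d -> 'I_N.+1} := [ffun i => inord (r i)].
have oE r : (forall i, r i <= N)%N -> (fun i => o r i : nat) = r.
  by move=> rN; apply/funext => i; rewrite ffunE inordK// ltnS.
rewrite /smooth_norm.
apply: le_trans (ler_sum_term (o m) _); last first.
  by move=> j; do 2! (apply: sumr_ge0 => ? _); exact: L2norm_ge0.
apply: le_trans (ler_sum_term (o p) _); last first.
  by move=> j; apply: sumr_ge0 => ? _; exact: L2norm_ge0.
apply: le_trans (ler_sum_term (o q) _); last by move=> j; exact: L2norm_ge0.
by rewrite !oE.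
Qed.

(** Each summand on the left is bounded by the whole norm of order [N'], and the factor counts the
    summands; no embedding of one index set into the other is needed. *)
Lemma smooth_norm_le N N' f : (N <= N')%N ->
  smooth_norm N f <= (#|{ffun 'I_d -> 'I_N.+1}| ^ 3)%:R * smooth_norm N' f.
Proof.
move=> NN; rewrite /smooth_norm [X in _ <= _ * X]/= -/(smooth_norm N' f).
have B (r : {ffun 'I_d -> 'I_N.+1}) i : (r i <= N')%N.
  by rewrite (leq_trans _ NN)// -ltnS.
set K := #|_|.
have S (x y : R) (F : {ffun 'I_d -> 'I_N.+1} -> R) : (forall r, F r <= y) ->
    \sum_r F r <= K%:R * y.
  move=> Fy; apply: (@le_trans _ _ (\sum_(r : {ffun 'I_d -> 'I_N.+1}) y)).
    by apply: ler_sum.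
  by rewrite sumr_const mulr_natl.
rewrite expnS expnS expn1 !natrM -!mulrA.
by apply: (S 0) => m; apply: (S 0) => p; apply: (S 0) => q; exact: L2norm_smooth_norm.
Qed.

(** Multiplied out, the weight is a sum of even monomials. Hence [weight] times a weighted
    derivative is a sum of weighted derivatives, which are all in L^2. *)
Lemma weight_expand (v : V) :
  weight v = \sum_(b : {ffun 'I_d -> bool}) \prod_(i < d) v 0 i ^+ (2 * b i).
Proof.
rewrite /weight.
transitivity (\prod_(i < d) \sum_(b : bool) v 0 i ^+ (2 * b)).
  by apply: eq_bigr => i _; rewrite big_bool addrC.
exact: bigA_distr_bigA.
Qed.

Lemma weighted_partial_shift (b : {ffun 'I_d -> bool}) (m p q : 'I_d -> nat) f z :
  weighted_partial (fun i => m i + 2 * b i)%N p q f z =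
  \prod_(i < d) z.2 0 i ^+ (2 * b i) * weighted_partial m p q f z.
Proof.
rewrite /weighted_partial mulrA -big_split/=; congr (_ * _).
by apply: eq_bigr => i _; rewrite exprD mulrC.
Qed.

(* Cauchy-Schwarz against the square integrable [weight^-1] turns the
   weighted L^2 norms into L^1 bounds. *)
Lemma weighted_partial_L1 (m p q : 'I_d -> nat) :
  exists N C, 0 <= C /\ forall f, smooth f ->
    integrable_phase (weighted_partial m p q f) /\
    int_phase (fun z => `|weighted_partial m p q f z|) <= C * smooth_norm N f.
Proof.
(* A crude common bound for the exponents [m i + 2], [p i] and [q i]; the 2 pays for the squares
   contributed by the weight. *)
pose N := (\max_(i < d) (m i + 2 + p i + q i))%N.
have HN i : (m i + 2 + p i + q i <= N)%N by exact: leq_bigmax.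
exists N, (#|{ffun 'I_d -> bool}|%:R * weight_norm (R:=R) (d:=d)); split.
  by rewrite mulr_ge0// L2norm_ge0.
move=> f [pf Cf Lf].
pose G (b : {ffun 'I_d -> bool}) := weighted_partial (fun i => m i + 2 * b i)%N p q f.
have CG b := cauchy_schwarz_phase (Lf _ _ _ : G b \o _ \in _) (@weightV_Lfun2 R d).
have FE z : weighted_partial m p q f z = \sum_b G b z * (weight z.2)^-1.
  rewrite -mulr_suml; under eq_bigr do rewrite /G weighted_partial_shift.
  by rewrite -mulr_suml -weight_expand mulrAC divff ?mul1r// gt_eqF// weight_gt0.
have iF : integrable_phase (weighted_partial m p q f).
  by rewrite (funext FE); apply: integrable_phase_sum => b; exact: (CG b).1.
have iA F : integrable_phase F -> integrable_phase (fun z => `|F z|).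
  by move=> i; exact: (integrable_norm i).
split=> //.
apply: (@le_trans _ _ (int_phase (fun z => \sum_b `|G b z * (weight z.2)^-1|))).
  apply: le_int_phase; first exact: iA.
    by apply: integrable_phase_sum => b; exact/iA/(CG b).1.
  by move=> z; rewrite FE ler_norm_sum.
rewrite int_phase_sum; last by move=> b; exact/iA/(CG b).1.
apply: (@le_trans _ _ (\sum_(b : {ffun 'I_d -> bool}) weight_norm (R:=R) (d:=d) * smooth_norm N f)).
  apply: ler_sum => b _; rewrite (le_trans (CG b).2)// mulrC ler_wpM2l ?L2norm_ge0//.
  apply: L2norm_smooth_norm => i; have := HN i.
  - have : (b i <= 1)%N by case: (b i).
    lia.
  - lia.
  - lia.
by rewrite -mulrA mulr_natl sumr_const.
Qed.

Lemma xvword_L1 l a c : exists N C, 0 <= C /\ forall f, smooth f ->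
  integrable_phase (xvword l a c f) /\
  int_phase (fun z => `|xvword l a c f z|) <= C * smooth_norm N f.
Proof.
have [N [C [C0 H]]] := weighted_partial_L1 (fun i => count_mem i l)
  (fun i => count_mem i a) (fun i => count_mem i c).
by exists N, C; split=> // f sf; have [_ Cf _] := sf; rewrite -weighted_partialE//; exact: H.
Qed.

End smooth_bounds.

(** * Velocity averages of smooth functions *)

Section densities.
Context {R : realType} {d : nat}.
Local Notation V := 'rV[R]_d.
Local Notation phase := (V * V)%type.
Implicit Types (f F : phase -> R) (a c l : seq 'I_d) (u : V -> R).
Local Notation pmeas := (@phase_measure R d).
Local Notation tmeas := (@torus_measure R d).
Local Notation vmeas := (@velocity_measure R d).
Local Notation vel_integrable F :=
  (vmeas.-integrable setT (EFin \o (fun t => F (row_of_tuple t)))).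
Local Notation words := (sobolev_words (enum 'I_d)).

(** What integrating out [v] requires: only derivatives in [x], and only L^1 bounds. The class is
    stable under [Dx] and contains [xvword l a c f] for every smooth [f]. *)
Definition xL1 F := [/\ periodic_phase F, Cinfty F & forall a, integrable_phase (Dx a F)].

Lemma xL1_xvword l a c f : smooth f -> xL1 (xvword l a c f).
Proof.
move=> sf; have [pf Cf _] := sf; split.
- exact: periodic_xvword.
- exact: Cinfty_xvword.
- move=> b; rewrite Dx_xvword//; have [N [C [_ H]]] := xvword_L1 (R := R) l (b ++ a) c.
  by have [] := H _ sf.
Qed.

Lemma perC_xslice F v : periodic_phase F -> Cinfty F -> perC (fun x : V => F (x, v)).
Proof. by move=> pF CF; split; [exact: pF|exact: Cinfty_xslice]. Qed.

Lemma perC_xslice_norm F v : periodic_phase F -> Cinfty F ->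
  Defs.periodic (fun x : V => `|F (x, v)|) /\ continuous (fun x : V => `|F (x, v)|).
Proof.
move=> pF CF; split; first by move=> i x; rewrite (pF v i x).
exact/continuous_normr/Cinfty_continuous/Cinfty_xslice.
Qed.

Lemma integrable_torus_norm F : periodic_phase F -> Cinfty F -> integrable_phase F ->
  vel_integrable (fun v => int_torus (fun x => `|F (x, v)|)) /\
  \int[vmeas]_t int_torus (fun x => `|F (x, row_of_tuple t)|) = int_phase (fun z => `|F z|).
Proof.
move=> pF CF iF; have iN : pmeas.-integrable setT (EFin \o (fun p => `|F (phase_of_tuples p)|)).
  exact: (integrable_norm iF).
have E t : (\int[tmeas]_s (`|F (row_of_tuple s, row_of_tuple t)|)%:E)%E =
    (int_torus (fun x => `|F (x, row_of_tuple t)|))%:E.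
  have [pN cN] := perC_xslice_norm (row_of_tuple t) pF CF.
  rewrite /int_torus /Rintegral fineK//; apply: integrable_fin_num => //.
  exact: (integrable_torus pN cN).
have iG : (\int[vmeas]_t (int_torus (fun x => `|F (x, row_of_tuple t)|))%:E =
    \int[pmeas]_p (`|F (phase_of_tuples p)|)%:E)%E.
  by rewrite -(integral21_prod_meas1 iN); apply: eq_integral => t _; rewrite -E.
have mG : measurable_fun setT (EFin \o (fun t : d.-tuple R =>
    int_torus (fun x => `|F (x, row_of_tuple t)|))).
  move: (measurable_fubini_G iN); congr measurable_fun; apply/funext => t; exact: E.
split; last by rewrite /Rintegral iG.
apply/integrableP; split=> //.
under eq_integral => t _ do rewrite gee0_abs ?lee_fin ?Rintegral_ge0//.
by rewrite iG; have /fin_numPlt/andP[] := integrable_fin_num measurableT iN.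
Qed.

(** At fixed [v], Sobolev's bound on the torus majorises [Dx a F] independently of [x]; by Fubini
    the integral of this majorant over [v] is a sum of L^1 norms on phase space. *)
Lemma density_dominated F : xL1 F -> exists g : seq 'I_d -> d.-tuple R -> R,
  [/\ forall a, vmeas.-integrable setT (EFin \o g a),
      forall a t x, `|Dx a F (x, row_of_tuple t)| <= g a t &
      forall a, \int[vmeas]_t g a t = \sum_(b <- words) int_phase (fun z => `|Dx (b ++ a) F z|)].
Proof.
move=> [pF CF iF].
have pD a : periodic_phase (Dx a F) by exact: periodic_iter_derive.
have CD a : Cinfty (Dx a F) by exact: Cinfty_Dx.
pose g a (t : d.-tuple R) : R :=
  \sum_(b <- words) int_torus (fun x => `|Dx (b ++ a) F (x, row_of_tuple t)|).
have ig b a : vmeas.-integrable setT (EFin \o (fun t : d.-tuple R =>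
    int_torus (fun x => `|Dx (b ++ a) F (x, row_of_tuple t)|))).
  by have [] := integrable_torus_norm (pD (b ++ a)) (CD (b ++ a)) (iF (b ++ a)).
exists g; split.
- by move=> a; apply: integrable_EFin_sum => b; exact: ig.
- move=> a t x.
  have := @sobolev_torus _ _ (fun x => Dx a F (x, row_of_tuple t)) x
    (perC_xslice (row_of_tuple t) (pD a) (CD a)).
  move=> /le_trans; apply; rewrite /g le_eqVlt; apply/orP; left; apply/eqP.
  apply: eq_bigr => b _; congr int_torus; apply/funext => y.
  by rewrite Dw_xslice// Dx_cat.
- move=> a; rewrite /g (Rintegral_sum words (fun b => ig b a)).
  apply: eq_bigr => b _.
  by have [] := integrable_torus_norm (pD (b ++ a)) (CD (b ++ a)) (iF (b ++ a)).
Qed.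

Lemma measurable_vslice F x : Cinfty F ->
  measurable_fun setT (fun t : d.-tuple R => F (x, row_of_tuple t)).
Proof.
move=> CF; apply: (@measurable_row _ _ (fun v => F (x, v))).
exact/Cinfty_continuous/Cinfty_vslice.
Qed.

Lemma integrable_vslice F x : xL1 F -> vel_integrable (fun v => F (x, v)).
Proof.
move=> nF; have [g [ig gF _]] := density_dominated nF; have [_ CF _] := nF.
exact: (@le_EFin_integrable _ _ _ vmeas _ _ (measurable_vslice x CF)
  (fun t => gF [::] t x) (ig [::])).
Qed.

Lemma xL1_Dx a F : xL1 F -> xL1 (Dx a F).
Proof.
move=> [pF CF iF]; split; [exact: periodic_iter_derive|exact: Cinfty_Dx|].
by move=> b; rewrite -Dx_cat.
Qed.

Lemma Dw_density a F : xL1 F -> perC (density F) /\ Dw a (density F) = density (Dx a F).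
Proof.
move=> nF; have [g [ig gF _]] := density_dominated nF; have [pF CF iF] := nF.
have E b x t : Dw b (fun x => F (x, row_of_tuple t)) x = Dx b F (x, row_of_tuple t).
  exact: Dw_xslice.
have [] := @Cinfty_integral R d _ _ vmeas (fun t x => F (x, row_of_tuple t)) g.
- by move=> t; exact: Cinfty_xslice.
- move=> b x; under eq_fun do rewrite E; apply: measurable_vslice; exact: Cinfty_Dx.
- exact: ig.
- by move=> b t x; rewrite E.
move=> C0 D0; split.
  split; last exact: C0.
  by move=> i x; apply: eq_Rintegral => t _; exact: pF.
rewrite [LHS]D0; apply/funext => x; apply: eq_Rintegral => t _; exact: E.
Qed.

Lemma perC_density F : xL1 F -> perC (density F).
Proof. by move=> /(Dw_density [::])[]. Qed.

Lemma density_bound F a x : xL1 F ->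
  `|Dw a (density F) x| <= \sum_(b <- words) int_phase (fun z => `|Dx (b ++ a) F z|).
Proof.
move=> nF; have [g [ig gF gE]] := density_dominated nF; have [_ CF _] := nF.
have [_ ->] := Dw_density a nF; rewrite -gE.
have iS := integrable_vslice x (xL1_Dx a nF).
rewrite (le_trans (le_normr_Rintegral measurableT iS))//.
apply: le_Rintegral => //; exact: (integrable_norm iS).
Qed.

Lemma int_phase_density u F : perC u -> xL1 F ->
  integrable_phase (fun z => u z.1 * F z) /\
  int_phase (fun z => u z.1 * F z) = int_torus (fun x => u x * density F x).
Proof.
move=> Cu nF; have [pF CF iF] := nF; have [M M0 uM] := perC_bounded Cu.
have Cuz := Cinfty_fst Cu.2.
have iuF : integrable_phase (fun z => u z.1 * F z).
  apply: (@le_integrable_phase _ _ _ (fun z => M * `|F z|)).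
  - exact/Cinfty_continuous/CinftyM.
  - by move=> z; rewrite normrM ler_wpM2r.
  - by apply: integrable_phaseZ; exact: (integrable_norm (iF [::])).
split=> //; have := integral12_prod_meas1 iuF.
rewrite /int_phase /int_torus /Rintegral => <-; congr fine.
apply: eq_integral => t _; rewrite /fubini_F /=.
have iS := integrable_vslice (row_of_tuple t) nF.
rewrite /density /int_velocity -RintegralZl// /Rintegral fineK//.
apply: integrable_fin_num => //.
exact: (@integrable_EFinZ _ _ _ vmeas _ _ iS).
Qed.

End densities.

(** * Test functions and uniqueness of the derivative *)

Section bump.
Context {R : realType}.

(** For positive [n], this is the [n]-th power of [s / n <= exp (s / n)]. *)
Lemma exprn_expRN n (s : R) : 0 <= s -> s ^+ n * expR (- s) <= n%:R ^+ n.
Proof.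
move=> s0; case: n => [|n]; first by rewrite !expr0 mul1r expR_le1 oppr_le0.
rewrite expRN -ler_pdivlMr ?invr_gt0 ?expR_gt0// invrK.
have n0 : 0 < n.+1%:R :> R by [].
have -> : expR s = expR (s / n.+1%:R) ^+ n.+1.
  by rewrite -expRM_natl -mulr_natl mulrCA divff ?mulr1// gt_eqF.
rewrite -exprMn; apply: lerXn2r; rewrite ?nnegrE ?mulr_ge0 ?expR_ge0//.
by rewrite -ler_pdivrMl// mulrC (le_trans _ (expR_ge1Dx _))// lerDr.
Qed.

Lemma horner_expRN_bound (P : {poly R}) :
  exists2 C, 0 <= C & forall s, 0 <= s -> `|P.[s] * expR (- s)| <= C.
Proof.
exists (\sum_(i < size P) `|P`_i| * i%:R ^+ i).
  by apply: sumr_ge0 => i _; rewrite mulr_ge0// exprn_ge0.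
move=> s s0; rewrite horner_coef mulr_suml (le_trans (ler_norm_sum _ _ _))//.
apply: ler_sum => i _; rewrite -mulrA normrM ler_wpM2l//.
rewrite ger0_norm; first exact: exprn_expRN.
by rewrite mulr_ge0 ?exprn_ge0// expR_ge0.
Qed.

(** The derivative of [P(1/t) exp(-1/t)] is [t^-2 (P - P')(1/t) exp(-1/t)], whence the recursion. *)
Fixpoint bump_poly k : {poly R} :=
  if k is k'.+1 then 'X^2 * (bump_poly k' - (bump_poly k')^`()) else 1.

(* The derivatives of [t |-> exp (-1 / t)], extended by [0] to [t <= 0]. *)
Definition bump k (t : R) : R :=
  if 0 < t then (bump_poly k).[t^-1] * expR (- t^-1) else 0.

Lemma bump_gt0 t : 0 < t -> 0 < bump 0 t.
Proof. by move=> t0; rewrite /bump t0 /= hornerC mul1r expR_gt0. Qed.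

Lemma bump_ge0 t : 0 <= bump 0 t.
Proof. by have [/bump_gt0/ltW//|t0] := ltP 0 t; rewrite /bump ltNge t0. Qed.

Lemma bump_eq0 k t : t <= 0 -> bump k t = 0.
Proof. by move=> t0; rewrite /bump ltNge t0. Qed.

Lemma is_derive_bump k (t : R) : is_derive t (1 : R) (bump k) (bump k.+1 t).
Proof.
have [t0|t0|->] := ltgtP t 0.
- rewrite bump_eq0 ?ltW//.
  apply: (@near_eq_is_derive _ _ _ (cst 0)).
  near=> s; rewrite bump_eq0//= ltW//; near: s; exact: lt_nbhsl.
- have tn0 : t != 0 by rewrite gt_eqF.
  have dV : is_derive t (1 : R) (fun s : R => s^-1) (- t ^- 2).
    have := @is_deriveV R id t 1 1 tn0 (is_derive_id _ _).
    by rewrite scaler1.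
  have dP : is_derive t (1 : R) (fun s : R => (bump_poly k).[s^-1])
      ((- t ^- 2) * (bump_poly k)^`().[t^-1]).
    have := @is_derive1_comp R (horner (bump_poly k)) (fun s => s^-1) t _ _
      (is_derive_poly _ _) dV.
    by rewrite mulrC.
  have dE : is_derive t (1 : R) (fun s : R => expR (- s^-1)) (t ^- 2 * expR (- t^-1)).
    have dN := @is_deriveN _ _ _ (fun s : R => s^-1) t 1 _ dV.
    have := @is_derive1_comp R expR (fun s => - s^-1) t _ _ (is_derive_expR _) dN.
    by rewrite opprK mulrC.
  apply: (@near_eq_is_derive _ _ _
      (fun s : R => (bump_poly k).[s^-1] * expR (- s^-1))).
    by near=> s; rewrite /bump ifT//; near: s; exact: lt_nbhsr.
  apply: (is_derive_eq (@is_deriveM _ _ _ _ t 1 _ _ dP dE)).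
  rewrite /bump t0 /= hornerM hornerXn hornerD hornerN exprVn.
  by rewrite /GRing.scale /=; ring.
(* At 0, the boundedness of ['X^2 * bump_poly k] against the exponential makes [bump k h] at most
   [C1 * h ^+ 2], so its derivative there exists and is 0. *)
- have [C1 C10 HC1] := horner_expRN_bound ('X^2 * bump_poly k).
  have B h : `|bump k h| <= C1 * `|h| ^+ 2.
    have [h0|h0] := ltP 0 h; last by rewrite bump_eq0// normr0 mulr_ge0.
    have hV : 0 <= h^-1 by rewrite invr_ge0 ltW.
    have := HC1 _ hV; rewrite hornerM hornerXn -mulrA normrM normrX normfV.
    by rewrite exprVn mulrC ler_pdivrMr ?exprn_gt0 ?normr_gt0 ?gt_eqF// /bump h0.
  have [] := @differentiable_quadratic R R (bump k) (\0 : {linear R -> R}) 0 C1.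
  + exact: cst_continuous.
  + by move=> h; rewrite add0r (bump_eq0 k (lexx 0)) !subr0; exact: B.
  + move=> dB Db; have := @derivableP _ _ _ (bump k) 0 1 (diff_derivable dB).
    by rewrite Db bump_eq0.
Unshelve. all: by end_near.
Qed.

End bump.

Section test_functions.
Context {R : realType} {d : nat}.
Local Notation V := 'rV[R]_d.
Local Notation phase := (V * V)%type.
Implicit Types (f F D : phase -> R) (v : V).
Local Notation pmeas := (@phase_measure R d).

Definition cutoff (v0 v : V) : R := \prod_(i < d) bump 0 (1 - (v 0 i - v0 0 i) ^+ 2).

Lemma Cinfty_cutoff v0 : Cinfty (cutoff v0).
Proof.
apply: Cinfty_prod => i; apply: (Cinfty_comp1 (psi := @bump R)); first exact: is_derive_bump.
apply: CinftyB; first exact: Cinfty_cst.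
apply: CinftyX; apply: CinftyB; [exact: Cinfty_coord|exact: Cinfty_cst].
Qed.

Lemma cutoff_ge0 v0 v : 0 <= cutoff v0 v.
Proof. by apply: prodr_ge0 => i _; exact: bump_ge0. Qed.

Lemma cutoff_gt0 v : 0 < cutoff v v.
Proof. by apply: prodr_gt0 => i _; rewrite subrr expr0n subr0 bump_gt0. Qed.

Lemma cutoff_eq0 v0 v i : 1 < `|v 0 i - v0 0 i| -> cutoff v0 v = 0.
Proof.
move=> vi; rewrite /cutoff (bigD1 i)//= bump_eq0 ?mul0r//.
by rewrite subr_le0 -real_normK ?num_real// exprn_ege1// ltW.
Qed.

Lemma weighted_partial_words (m p q : 'I_d -> nat) : exists s : seq phase, forall f z,
  weighted_partial m p q f z = \prod_(i < d) z.2 0 i ^+ m i * iter_derive s f z.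
Proof.
exists ([seq ex i | i <- flatten [seq nseq (p i) i | i <- enum 'I_d]] ++
        [seq ev i | i <- flatten [seq nseq (q i) i | i <- enum 'I_d]]) => f z.
rewrite iter_derive_cat /weighted_partial; congr (_ * _).
have -> := multi_partial_word (@ev R d) q f : multi_partial partialv q f = _.
have Ex F : multi_partial partialx p F =
    iter_derive [seq ex i | i <- flatten [seq nseq (p i) i | i <- enum 'I_d]] F.
  exact: multi_partial_word.
by rewrite Ex.
Qed.

Lemma iter_derive_open0 (W : normedModType R) (F : W -> R) (s : seq W) (O : set W) :
  open O -> (forall z, O z -> F z = 0) -> forall z, O z -> iter_derive s F z = 0.
Proof.
move=> oO F0; elim: s => //= w s IH z Oz.
have : is_derive z w (iter_derive s F) 0.
  apply: (@near_eq_is_derive _ _ _ (cst 0)).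
  by near=> y; rewrite IH//; near: y; exact: open_nbhs_nbhs.
by move=> H; rewrite derive_val.
Unshelve. all: by end_near.
Qed.

Lemma open_off_cutoff (v0 : V) (i : 'I_d) :
  open [set z : phase | 1 < `|z.2 0 i - v0 0 i|].
Proof.
have C : continuous (fun z : phase => `|z.2 0 i - v0 0 i|).
  apply: continuous_normr; apply: Cinfty_continuous.
  by apply: CinftyB; [exact: Cinfty_vcoord|exact: Cinfty_cst].
have := open_comp (fun z _ => C z) (@open_gt R 1).
by [].
Qed.

Lemma bounded_support (v0 : V) F : continuous F -> periodic_phase F ->
  (forall i (z : phase), 1 < `|z.2 0 i - v0 0 i| -> F z = 0) ->
  exists C, forall z, `|F z| <= C.
Proof.
move=> cF pF F0.
have cK := compact_setX (@compact_cube R d 0 (const_mx (2 * pi)))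
  (@compact_cube R d (v0 - const_mx 1) (v0 + const_mx 1)).
have /compact_bounded[M [Mr HM]] := continuous_compact (continuous_subspaceT cF) cK.
exists (`|M| + 1) => -[x v].
have [/existsP[i vi]|] := boolP [exists i : 'I_d, 1 < `|v 0 i - v0 0 i|].
  by rewrite (F0 i)// normr0 addr_ge0.
rewrite negb_exists => /forallP vN; have [y yI /(_ _ (pF v)) ->] := torus_cell x.
apply: HM; first by rewrite ltr_pwDr// ler_norm.
exists (y, v) => //; split=> i /=; rewrite !mxE.
  by have /andP[-> /ltW] := yI i.
by have := vN i; rewrite -leNgt ler_distl.
Qed.

(** Periodicity in [x] and compact support in [v] make every weighted derivative bounded, even after
    multiplication by [weight]; division by the weight then gives L^2. *)
Lemma smooth_cutoffM D v0 : periodic_phase D -> Cinfty D ->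
  smooth (fun z => cutoff v0 z.2 * D z).
Proof.
move=> pD CD; set f := fun z : phase => _.
have Cf : Cinfty f by apply: CinftyM => //; apply: Cinfty_snd; exact: Cinfty_cutoff.
have pf : periodic_phase f by move=> v i x; rewrite /f /= (pD v i).
split=> // m p q.
have [s /(_ f) E] := weighted_partial_words m p q.
have CE : Cinfty (weighted_partial m p q f).
  rewrite (funext E); apply: CinftyM; last exact: Cinfty_iter_derive.
  by apply: Cinfty_prod => i; apply: CinftyX; exact: Cinfty_vcoord.
pose F z := weighted_partial m p q f z * weight z.2.
have [C HC] : exists C, forall z, `|F z| <= C.
  apply: (@bounded_support v0).
  - by apply/Cinfty_continuous/CinftyM => //; apply: Cinfty_snd; exact: Cinfty_weight.
  - move=> v i x; rewrite /F /= !E /=; congr (_ * _ * _).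
    exact: (periodic_iter_derive s Cf pf).
  - move=> i z zi; rewrite /F E (iter_derive_open0 _ (@open_off_cutoff v0 i))// ?mulr0 ?mul0r//.
    by move=> y yi; rewrite /f (cutoff_eq0 yi) mul0r.
apply: (@le_weightV_Lfun2 _ _ _ C); first exact: Cinfty_continuous.
move=> z; rewrite ler_pdivlMr ?weight_gt0//.
by have := HC z; rewrite normrM [X in _ * X]gtr0_norm ?weight_gt0.
Qed.

End test_functions.

(** * Uniqueness of the Frechet derivative *)

Section smooth_space.
Context {R : realType} {d : nat}.
Local Notation V := 'rV[R]_d.
Local Notation phase := (V * V)%type.
Implicit Types (f g F Q : phase -> R) (v : V).
Local Notation pmeas := (@phase_measure R d).

Lemma weighted_partialZ (m p q : 'I_d -> nat) c f : Cinfty f ->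
  weighted_partial m p q (fun z => c * f z) = fun z => c * weighted_partial m p q f z.
Proof.
move=> Cf; have [s E] := weighted_partial_words (R := R) m p q.
by apply/funext => z; rewrite !E iter_deriveZ// mulrCA.
Qed.

Lemma weighted_partialD (m p q : 'I_d -> nat) f g : Cinfty f -> Cinfty g ->
  weighted_partial m p q (fun z => f z + g z) =
  fun z => weighted_partial m p q f z + weighted_partial m p q g z.
Proof.
move=> Cf Cg; have [s E] := weighted_partial_words (R := R) m p q.
by apply/funext => z; rewrite !E iter_deriveD// mulrDr.
Qed.

Let le12 : (1 <= 2%:E :> \bar R)%E.
Proof. by rewrite lee_fin ler1n. Qed.

Lemma smoothD f g : smooth f -> smooth g -> smooth (fun z => f z + g z).
Proof.
move=> [pf Cf Lf] [pg Cg Lg]; split.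
- by move=> v i x; rewrite (pf v i) (pg v i).
- exact: CinftyD.
- move=> m p q; rewrite weighted_partialD//.
  exact: (Lfun_addr_closed pmeas le12).2 (Lf m p q) (Lg m p q).
Qed.

Lemma smoothZ c f : smooth f -> smooth (fun z => c * f z).
Proof.
move=> [pf Cf Lf]; split.
- by move=> v i x; rewrite (pf v i).
- exact: CinftyZ.
- move=> m p q; rewrite weighted_partialZ//.
  rewrite (_ : _ \o _ = c \o* (weighted_partial m p q f \o phase_of_tuples)).
    by apply: Lfun_scale; [rewrite ler1n|exact: Lf].
  by apply/funext => z /=; rewrite mulrC.
Qed.

Lemma L2normZ c F : F \o phase_of_tuples \in Lfun pmeas 2%:E ->
  L2norm (fun z => c * F z) = `|c| * L2norm F.
Proof.
move=> LF; have nF : ('N[pmeas]_2%:E[EFin \o (F \o phase_of_tuples)] \is a fin_num)%E.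
  by move: LF; rewrite inE => /andP[_]; rewrite inE /= ge0_fin_numE// Lnorm_ge0.
have /(congr1 fine) := LnormZ (Lfun_Sub le12 LF) c.
by rewrite fineM.
Qed.

Lemma smooth_normZ N c f : smooth f ->
  smooth_norm N (fun z => c * f z) = `|c| * smooth_norm N f.
Proof.
move=> [_ Cf Lf]; rewrite /smooth_norm mulr_sumr; apply: eq_bigr => m _.
rewrite mulr_sumr; apply: eq_bigr => p _; rewrite mulr_sumr; apply: eq_bigr => q _.
by rewrite weighted_partialZ// L2normZ.
Qed.

Lemma phase_box_gt0 (x v : V) (e : R) : (forall i, 0 <= x 0 i < 2 * pi) -> 0 < e ->
  exists B : set (d.-tuple R * d.-tuple R),
  [/\ measurable B, (0 < pmeas B)%E &
      forall p, B p -> forall i, `|tnth p.1 i - x 0 i| < e /\ `|tnth p.2 i - v 0 i| < e].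
Proof.
move=> xI e0.
have p0 : 0 < 2 * pi :> R by rewrite mulr_gt0// pi_gt0.
(* Coordinates are extended by 0 beyond [d], because [tuple_power_box] takes a family of sets
   indexed by [nat]. *)
pose xs k := oapp (fun i => x 0 i) 0 (insub k : option 'I_d).
pose vs k := oapp (fun i => v 0 i) 0 (insub k : option 'I_d).
have xsE (i : 'I_d) : xs i = x 0 i by rewrite /xs valK.
have vsE (i : 'I_d) : vs i = v 0 i by rewrite /vs valK.
have xsI k : 0 <= xs k < 2 * pi.
  by rewrite /xs; case: insubP => [i _ _|_] /=; [exact: xI|rewrite lexx].
(* The position intervals start at [x] and stop at [2 pi], since [circle_measure] charges only the
   period cell; they are not null because [xs k < 2 * pi]. *)
pose A k := `[xs k, Num.min (xs k + e) (2 * pi)[%classic : set R.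
pose C k := `[vs k, vs k + e[%classic : set R.
pose BA := [set t : d.-tuple R | forall i : 'I_d, A i (tnth t i)].
pose BC := [set t : d.-tuple R | forall i : 'I_d, C i (tnth t i)].
have mbox (S : nat -> set R) : (forall k, measurable (S k)) ->
    measurable [set t : d.-tuple R | forall i : 'I_d, S i (tnth t i)].
  move=> mS; rewrite (_ : [set _ | _] =
      \bigcap_(i in [set: 'I_d]) (fun t : d.-tuple R => tnth t i) @^-1` S i).
    apply: fin_bigcap_measurable => // i _.
    by rewrite -[X in measurable X]setTI; apply: measurable_tnth.
  by apply/seteqP; split=> t /= H i; [move=> _|]; exact: H.
have mBA : measurable BA by apply: mbox => k; exact: measurable_itv.
have mBC : measurable BC by apply: mbox => k; exact: measurable_itv.
exists (BA `*` BC); split; first exact: measurableX.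
- rewrite /phase_measure product_measure1E// mule_gt0//.
    rewrite [X in (0 < X)%E](@tuple_power_box R _ _ (@circle_measure R) d A
      (fun k => measurable_itv _)).
    apply: (@big_ind _ (fun x : \bar R => 0 < x)%E) => [|? ?|i _]; [exact: lte01|exact: mule_gt0|].
    have cA : `[0, 2 * pi[%classic `&` A i = A i.
      apply/seteqP; split=> s; first by case.
      rewrite /A /= !in_itv /= => /andP[s1 s2]; split; last by apply/andP.
      have /andP[x1 _] := xsI i; move: s2; rewrite lt_min => /andP[_ ->].
      by rewrite (le_trans x1).
    suff : (0 < @lebesgue_measure R (A i))%E.
      by rewrite -{1}cA setIC.
    rewrite /A lebesgue_measure_itv /= lte_fin.
    have /andP[_ x2] := xsI i.
    by rewrite lt_min ltrDl e0 x2 lte_fin subr_gt0 lt_min ltrDl e0 x2.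
  rewrite [X in (0 < X)%E](@tuple_power_box R _ _ (@lebesgue_measure R) d C
    (fun k => measurable_itv _)).
  apply: (@big_ind _ (fun x : \bar R => 0 < x)%E) => [|? ?|i _]; [exact: lte01|exact: mule_gt0|].
  suff : (0 < @lebesgue_measure R (C i))%E by [].
  by rewrite /C lebesgue_measure_itv /= lte_fin ltrDl e0 lte_fin addrAC subrr add0r.
- move=> [s t] [/= Hs Ht] i; move: (Hs i) (Ht i).
  rewrite /A /C /= !in_itv /= xsE vsE lt_min => /andP[s1 /andP[s2 _]] /andP[t1 t2].
  by split; rewrite ger0_norm ?subr_ge0// ltrBlDl.
Qed.

(** If [Q] were positive somewhere, periodicity would move the point into the period cell, and
    continuity would bound [Q] below on a box of positive measure. *)
Lemma int_phase_eq0 Q : continuous Q -> periodic_phase Q -> (forall z, 0 <= Q z) ->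
  integrable_phase Q -> int_phase Q = 0 -> forall z, Q z = 0.
Proof.
move=> cQ pQ Q0 iQ IQ [x v]; apply/eqP/negPn/negP => Qxv.
have [y yI /(_ _ (pQ v)) xy] := torus_cell x; rewrite xy in Qxv.
set c := Q (y, v) in Qxv.
have c0 : 0 < c by rewrite lt_neqAle eq_sym Qxv Q0.
have [e e0 eP] : exists2 e, 0 < e & forall z, `|z.1 - y| < e -> `|z.2 - v| < e -> c / 2 <= Q z.
  have /(@cvgrPdist_lt _ _ _) /(_ (c / 2)) := cQ (y, v).
  rewrite divr_gt0// => /(_ isT) /nbhs_ballP[e e0 He]; exists e => // z zy zv.
  have /ltW : `|Q (y, v) - Q z| < c / 2.
    by apply: He; split; rewrite -ball_normE /= distrC.
  by move=> /ler_normlP[_]; rewrite -/c; lra.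
have [B [mB B0 HB]] := phase_box_gt0 v yI e0.
have H : ((c / 2)%:E * pmeas B <= \int[pmeas]_p (Q (phase_of_tuples p))%:E)%E.
  have PQ p : B p -> c / 2 <= Q (phase_of_tuples p).
    move=> /HB Bp; have norm_lt (w : V) : (forall i, `|w 0 i| < e) -> `|w| < e.
      move=> we; rewrite [ltLHS]/Num.norm /= mx_normrE; apply/bigmax_ltP; split=> //= -[i j] _.
      by rewrite ord1.
    by apply: eP; apply: norm_lt => i /=; rewrite !mxE; have [] := Bp i.
  have mQ : measurable_fun setT (fun p => Q (phase_of_tuples p)) by exact: measurable_phase.
  rewrite -integral_cst//; apply: (@le_trans _ _ (\int[pmeas]_(p in B) (Q (phase_of_tuples p))%:E)%E).
    apply: ge0_le_integral => //; first by move=> p _; rewrite lee_fin divr_ge0// ltW.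
    by apply: measurable_funTS; exact/measurable_EFinP.
  apply: ge0_subset_integral => //; first exact/measurable_EFinP.
  by move=> p _; rewrite lee_fin.
move: IQ; rewrite /int_phase /Rintegral => IQ.
have := integrable_fin_num measurableT iQ => /fineK; rewrite [fine _]IQ => e1.
move: H; rewrite -[X in (_ <= X)%E -> _]e1 leNgt => /negP; apply.
by rewrite mule_gt0// lte_fin divr_gt0.
Qed.

(** Comparing the two remainders at [t * h] for small [t] shows that [g1] and [g2] have the same
    integral against every smooth [h]. For [h] the product of a cutoff and [g1 - g2], this says that
    the cutoff times [(g1 - g2) ^+ 2] has integral zero, and the cutoff is positive at its centre,
    which is arbitrary. *)
Lemma frechet_unique G f g1 g2 : is_frechet_derivative G f g1 ->
  is_frechet_derivative G f g2 -> g1 = g2.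
Proof.
move=> [p1 C1 i1 [N1 [K1 H1]]] [p2 C2 i2 [N2 [K2 H2]]].
have int0 h : smooth h -> int_phase (fun z => g1 z * h z) = int_phase (fun z => g2 z * h z).
  move=> sh; apply/eqP; rewrite -subr_eq0 -normr_le0.
  set A := int_phase _; set B := int_phase _.
  pose n1 := smooth_norm N1 h; pose n2 := smooth_norm N2 h.
  have n10 : 0 <= n1 by exact: smooth_norm_ge0.
  have n20 : 0 <= n2 by exact: smooth_norm_ge0.
  have key t : 0 < t -> t * n1 <= 1 -> t * n2 <= 1 ->
      `|A - B| <= (K1 * n1 ^+ 2 + K2 * n2 ^+ 2) * t.
    move=> t0 t1 t2; have st := smoothZ t sh.
    have := H1 _ st; have := H2 _ st; rewrite !smooth_normZ// !(gtr0_norm t0).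
    move=> /(_ t2) + /(_ t1).
    have E g (ig : integrable_phase (fun z => g z * h z)) :
      int_phase (fun z => g z * (t * h z)) = t * int_phase (fun z => g z * h z).
      rewrite -int_phaseZ//; congr int_phase; apply/funext => z; exact: mulrCA.
    rewrite (E _ (i1 _ sh)) (E _ (i2 _ sh)) -/A -/B.
    set X := G _ - G f => b2 b1.
    rewrite -(ler_pM2l t0) -[X in X * `|_|](gtr0_norm t0) -normrM.
    have -> : t * (A - B) = (X - t * B) - (X - t * A) by ring.
    rewrite (le_trans (ler_normB _ _))// (le_trans (lerD b2 b1))//.
    by rewrite le_eqVlt; apply/orP; left; apply/eqP; rewrite /n1 /n2; ring.
  pose K := K1 * n1 ^+ 2 + K2 * n2 ^+ 2; rewrite leNgt; apply/negP => AB.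
  (* The first bound keeps both norms of [t * h] at most 1; the second makes [K * t] at most half of
     [|A - B|], contradicting [key]. *)
  pose t := Num.min ((1 + n1 + n2)^-1) (`|A - B| / (2 * (1 + `|K|))).
  have t0 : 0 < t by rewrite lt_min invr_gt0 ltr_wpDr// ?ltr_wpDr// divr_gt0// mulr_gt0// ltr_wpDr.
  have tn n : 0 <= n -> n <= 1 + n1 + n2 -> t * n <= 1.
    move=> n0 nle; apply: (@le_trans _ _ ((1 + n1 + n2)^-1 * n)).
      by rewrite ler_wpM2r// ge_min lexx.
    by rewrite mulrC ler_pdivrMr ?mul1r// ltr_wpDr// ltr_wpDr.
  have := key t t0; rewrite !tn//; [|lra|lra] => /(_ isT isT).
  have : K * t <= `|A - B| / 2.
    apply: (@le_trans _ _ (`|K| * (`|A - B| / (2 * (1 + `|K|))))).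
      apply: (@le_trans _ _ (`|K| * t)); first by rewrite ler_wpM2r ?ler_norm// ltW.
      by rewrite ler_wpM2l// ge_min lexx orbT.
    rewrite mulrA ler_pdivrMr ?mulr_gt0 ?ltr_wpDr//.
    rewrite [leRHS](_ : _ = `|A - B| * (1 + `|K|)); last by field.
    by rewrite mulrC ler_wpM2l// lerDr.
  rewrite -/K; lra.
pose D z := g1 z - g2 z.
have pD : periodic_phase D by move=> v i x; rewrite /D (p1 v i) (p2 v i).
have CD : Cinfty D by exact: CinftyB.
apply/funext => -[x v]; apply/eqP; rewrite -subr_eq0 -/(D (x, v)).
have sh := smooth_cutoffM v pD CD; set h := (fun z => _ * _) in sh.
pose Q z := D z * h z.
have iQ : integrable_phase Q.
  rewrite (_ : Q = fun z => g1 z * h z + -1 * (g2 z * h z)).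
    by apply: integrable_phaseD; [exact: i1|exact/integrable_phaseZ/i2].
  by apply/funext => z; rewrite /Q /D; ring.
have IQ : int_phase Q = 0.
  rewrite (_ : Q = fun z => g1 z * h z + -1 * (g2 z * h z)).
    rewrite int_phaseD ?int_phaseZ//; [|exact: i2|exact: i1|exact/integrable_phaseZ/i2].
    by rewrite int0// mulN1r subrr.
  by apply/funext => z; rewrite /Q /D; ring.
have QE z : Q z = cutoff v z.2 * D z ^+ 2 by rewrite /Q /h; ring.
have cQ : continuous Q.
  by apply/Cinfty_continuous/CinftyM => //; case: sh.
have QE0 : forall z, Q z = 0.
  apply: int_phase_eq0 => // [w i y|z]; last by rewrite QE mulr_ge0 ?cutoff_ge0// sqr_ge0.
  by rewrite !QE /= (pD w i).
have /eqP := QE0 (x, v); rewrite QE.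
by rewrite mulf_eq0 gt_eqF ?cutoff_gt0//= expf_eq0.
Qed.

Lemma frechet_derivativeE G f g : is_frechet_derivative G f g ->
  frechet_derivative G f = g.
Proof.
move=> Hg; have : [set g | is_frechet_derivative G f g] (frechet_derivative G f).
  by apply: xgetPex; exists g.
by move=> H; exact: frechet_unique H Hg.
Qed.

End smooth_space.

(** * The potential and the iterated brackets *)

Section potential.
Context {R : realType} {d : nat}.
Local Notation V := 'rV[R]_d.
Local Notation phase := (V * V)%type.
Implicit Types (f h F : phase -> R) (x v : V) (u w : V -> R).
Local Notation vmeas := (@velocity_measure R d).

Lemma xvword_nil f : xvword [::] [::] [::] f = f.
Proof. by apply/funext => z; rewrite /xvword /monomial big_nil mul1r. Qed.

Lemma xL1_smooth f : smooth f -> xL1 f.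
Proof. by move=> /(xL1_xvword [::] [::] [::]); rewrite xvword_nil. Qed.

Lemma densityD F G : xL1 F -> xL1 G ->
  density (fun z => F z + G z) = fun x => density F x + density G x.
Proof.
move=> nF nG; apply/funext => x.
exact: (@RintegralD _ _ _ vmeas setT (fun t => F (x, row_of_tuple t))
  (fun t => G (x, row_of_tuple t)) measurableT (integrable_vslice x nF) (integrable_vslice x nG)).
Qed.

Lemma int_phase_smooth f : smooth f -> int_phase f = int_torus (density f).
Proof.
move=> /xL1_smooth nf; have [_] := int_phase_density (perC_cst 1) nf.
rewrite (_ : (fun z : phase => _) = f); last by apply/funext => z; rewrite mul1r.
by move=> ->; congr int_torus; apply/funext => x; rewrite mul1r.
Qed.

Lemma massD f h : smooth f -> smooth h -> mass (fun z => f z + h z) = mass f + mass h.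
Proof.
move=> sf sh; rewrite /mass int_phaseD ?mulrDr//.
- by have [_ _ /(_ [::])] := xL1_smooth sf.
- by have [_ _ /(_ [::])] := xL1_smooth sh.
Qed.

Lemma laplacianD u w x : Cinfty u -> Cinfty w ->
  laplacian (fun x => u x + w x) x = laplacian u x + laplacian w x.
Proof.
move=> Cu Cw; rewrite /laplacian -big_split/=; apply: eq_bigr => i _.
rewrite -partialD; [|exact: Cinfty_derive..].
by congr (partial i _ x); apply/funext => y; rewrite partialD.
Qed.

Lemma laplacianN u x : Cinfty u -> laplacian (fun x => - u x) x = - laplacian u x.
Proof.
move=> Cu; rewrite /laplacian -sumrN; apply: eq_bigr => i _.
rewrite -partialN; last exact: Cinfty_derive.
by congr (partial i _ x); apply/funext => y; rewrite partialN.
Qed.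

Lemma laplacian_partial i u x : Cinfty u ->
  laplacian (partial i u) x = partial i (laplacian u) x.
Proof.
move=> Cu; rewrite /laplacian partial_sum; last first.
  by move=> j; do 2 apply: Cinfty_derive.
apply: eq_bigr => j _; have P : perm_eq [:: j; j; i] [:: i; j; j].
  by rewrite (perm_catC [:: j; j] [:: i]).
exact: (congr1 (fun g => g x) (Dw_perm Cu P)).
Qed.

Lemma int_torusN u : perC u -> int_torus (fun x => - u x) = - int_torus u.
Proof.
move=> Cu; under eq_fun do rewrite -mulN1r.
rewrite (@int_torusZ R d (-1) u) ?mulN1r//; [exact: Cu.1|exact: perC_continuous].
Qed.

Lemma potentialP f : smooth f ->
  [/\ perC (potential f), int_torus (potential f) = 0 &
      forall x, laplacian (potential f) x = mass f - density f x].
Proof.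
move=> sf; have nf := xL1_smooth sf; have Cr := perC_density nf.
have C0 : perC (fun y => density f y - mass f) by exact: (perCB Cr (perC_cst _)).
have [] := inv_laplacianP C0.
  rewrite (@int_torusB R d (density f) (fun=> mass f));
    [|exact: Cr.1|exact: perC_continuous|by move=> ? ?|exact: perC_continuous (perC_cst _)].
  rewrite int_torus_cst /mass int_phase_smooth// mulrAC mulVf ?mul1r ?subrr//.
  by rewrite gt_eqF// exprn_gt0// mulr_gt0// pi_gt0.
move=> Cu u0 Lu; split.
- exact: perCN.
- by rewrite int_torusN// u0 oppr0.
- by move=> x; rewrite laplacianN ?Lu ?opprB//; exact: Cu.2.
Qed.

(** Additivity is not visible on [inv_laplacian], which is a choice; it follows from uniqueness, as
    the sum has mean zero and the right Laplacian. *)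
Lemma potentialD f h : smooth f -> smooth h ->
  potential (fun z => f z + h z) = fun x => potential f x + potential h x.
Proof.
move=> sf sh; have sfh := smoothD sf sh.
have [C1 z1 L1] := potentialP sf; have [C2 z2 L2] := potentialP sh.
have [C3 z3 L3] := potentialP sfh.
apply: poisson_unique; [exact: C3|exact: perCD|exact: z3|..].
- rewrite int_torusD ?z1 ?z2 ?addr0//; [exact: C1.1|exact: perC_continuous
    |exact: C2.1|exact: perC_continuous].
- move=> x; rewrite L3 laplacianD; [|exact: C1.2|exact: C2.2].
  rewrite L1 L2 massD// densityD; [ring|exact: xL1_smooth..].
Qed.

Definition flux (i : 'I_d) f : V -> R := density (fun z => z.2 0 i * f z).

Lemma xvword1 i f : xvword [:: i] [::] [::] f = fun z => z.2 0 i * f z.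
Proof. by apply/funext => z; rewrite /xvword /monomial big_seq1. Qed.

Lemma xL1_coordM i f : smooth f -> xL1 (fun z => z.2 0 i * f z).
Proof. by move=> /(xL1_xvword [:: i] [::] [::]); rewrite xvword1. Qed.

Lemma perC_flux i f : smooth f -> perC (flux i f).
Proof. by move=> sf; exact/perC_density/xL1_coordM. Qed.

Lemma fluxD i f h : smooth f -> smooth h ->
  flux i (fun z => f z + h z) = fun x => flux i f x + flux i h x.
Proof.
move=> sf sh; rewrite /flux -densityD; [|exact: xL1_coordM..].
by congr density; apply/funext => z; rewrite mulrDr.
Qed.

(** The order [N] is left free: it may grow from one operation to the next, just as
    [is_frechet_derivative] allows. *)
Definition norm_bounded (S : (phase -> R) -> V -> R) := exists N C,
  0 <= C /\ forall h x, smooth h -> `|S h x| <= C * smooth_norm N h.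

Lemma norm_bounded_joint (I : finType) (S : I -> (phase -> R) -> V -> R) :
  (forall i, norm_bounded (S i)) -> exists N C, 0 <= C /\
  forall i h x, smooth h -> `|S i h x| <= C * smooth_norm N h.
Proof.
move=> /choice[N] /choice[C HC].
pose M := (\max_i N i)%N.
pose K i := C i * (#|{ffun 'I_d -> 'I_(N i).+1}| ^ 3)%:R.
have K0 i : 0 <= K i by rewrite mulr_ge0//; case: (HC i).
exists M, (\sum_i K i); split; first exact: sumr_ge0.
move=> i h x sh; have [C0 /(_ h x sh) /le_trans] := HC i; apply.
apply: (@le_trans _ _ (K i * smooth_norm M h)).
  by rewrite -mulrA ler_wpM2l// smooth_norm_le// leq_bigmax.
by rewrite ler_wpM2r ?smooth_norm_ge0// (ler_sum_term i).
Qed.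

Lemma norm_bounded_density l c a :
  norm_bounded (fun h => Dw a (density (xvword l [::] c h))).
Proof.
have H (b : seq 'I_d) : norm_bounded (fun h _ => int_phase (fun z => `|xvword l b c h z|)).
  have [N [C [C0 HC]]] := xvword_L1 (R := R) l b c; exists N, C; split=> // h _ sh.
  by rewrite ger0_norm; [have [] := HC h sh|exact: Rintegral_ge0].
pose W := sobolev_words (enum 'I_d).
have [N [C [C0 HC]]] := norm_bounded_joint (fun i : 'I_(size W) => H (nth [::] W i ++ a)).
exists N, ((size W)%:R * C); split; first by rewrite mulr_ge0.
move=> h x sh; have [_ Ch _] := sh.
rewrite (le_trans (density_bound a x (xL1_xvword l [::] c sh)))//.
rewrite (big_nth [::]) big_mkord -mulrA mulr_natl -[X in _ *+ X]card_ord -sumr_const.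
apply: ler_sum => i _; rewrite Dx_xvword// cats0.
by rewrite (le_trans (ler_norm _))// HC.
Qed.

(** [partial i (potential h)] itself solves a Poisson equation, with Laplacian
    [- partial i (density h)], so the sup bound for solutions also controls their gradient at the
    price of one derivative of the density. *)
Lemma norm_bounded_field i : norm_bounded (fun h => partial i (potential h)).
Proof.
have [N [C [C0 HC]]] := norm_bounded_density [::] [::] [:: i].
exists N, (poisson_constant (n := d) * C); split; first by rewrite mulr_ge0// poisson_constant_ge0.
move=> h x sh; have [Cp p0 Lp] := potentialP sh; rewrite -mulrA.
apply: poisson_bound; [exact: perC_partial|exact: int_torus_partial|move=> y].
rewrite laplacian_partial; last exact: Cp.2.
rewrite (funext Lp) partialB; [|exact: Cinfty_cst|exact: (perC_density (xL1_smooth sh)).2].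
rewrite [X in X - _]derive_cst sub0r normrN.
by have := HC h y sh; rewrite xvword_nil.
Qed.

Lemma field_bounds : exists N C, 0 <= C /\ forall h, smooth h ->
  [/\ forall x, `|density h x| <= C * smooth_norm N h,
      forall i x, `|partial i (potential h) x| <= C * smooth_norm N h &
      forall i x, `|flux i h x| <= C * smooth_norm N h].
Proof.
have := @norm_bounded_joint (unit + ('I_d + 'I_d))%type (fun s => match s with
  | inl _ => fun h => density (xvword [::] [::] [::] h)
  | inr (inl i) => fun h => partial i (potential h)
  | inr (inr i) => fun h => density (xvword [:: i] [::] [::] h) end).
move=> [].
  move=> [_|[i|i]]; [exact: (norm_bounded_density _ _ [::])|exact: norm_bounded_field
    |exact: (norm_bounded_density _ _ [::])].
move=> N [C [C0 H]]; exists N, C; split=> // h sh; split=> [x|i x|i x].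
- by have := H (inl tt) h x sh; rewrite xvword_nil.
- exact: (H (inr (inl i)) h x sh).
- by have := H (inr (inr i)) h x sh; rewrite xvword1.
Qed.

End potential.

(** * The kinetic and electric functionals *)

Section functionals.
Context {R : realType} {d : nat}.
Local Notation V := 'rV[R]_d.
Local Notation phase := (V * V)%type.
Implicit Types (f h F : phase -> R) (x v : V) (u w : V -> R).
Local Notation vmeas := (@velocity_measure R d).

Lemma int_torus_perCD u w : perC u -> perC w ->
  int_torus (fun x => u x + w x) = int_torus u + int_torus w.
Proof.
by move=> Cu Cw; apply: int_torusD; [exact: Cu.1|exact: perC_continuous
  |exact: Cw.1|exact: perC_continuous].
Qed.

Lemma int_torus_perCZ c u : perC u -> int_torus (fun x => c * u x) = c * int_torus u.
Proof. by move=> Cu; apply: int_torusZ; [exact: Cu.1|exact: perC_continuous]. Qed.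

Lemma int_torus_perC_sum (I : Type) (r : seq I) (u : I -> V -> R) : (forall i, perC (u i)) ->
  int_torus (fun x => \sum_(i <- r) u i x) = \sum_(i <- r) int_torus (u i).
Proof.
by move=> Cu; apply: int_torus_sum => i; [exact: (Cu i).1|exact: perC_continuous].
Qed.

Lemma green u w : perC u -> perC w ->
  int_torus (fun x => \sum_(i < d) partial i u x * partial i w x) =
  - int_torus (fun x => u x * laplacian w x).
Proof.
move=> Cu Cw; have Cp i : perC (partial i w) by exact: perC_partial.
apply: (etrans (int_torus_perC_sum (index_enum 'I_d)
  (fun i => perCM (perC_partial i Cu) (Cp i)))).
have -> : (fun x => u x * laplacian w x) =
    fun x => \sum_(i < d) u x * partial i (partial i w) x.
  by apply/funext => x; exact: mulr_sumr.
rewrite (int_torus_perC_sum (index_enum 'I_d) (fun i => perCM Cu (perC_partial i (Cp i)))).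
by rewrite -sumrN; apply: eq_bigr => i _; rewrite [in RHS]int_torus_IBP// opprK.
Qed.

Lemma Cinfty_vmonomial l : Cinfty (monomial (R := R) (d := d) l).
Proof. by apply: Cinfty_prod => i; exact: Cinfty_coord. Qed.

(** Integration by parts in [v] at fixed [x] moves the derivative onto the monomial; degrees 0, 1
    and 2 are the ones that the brackets produce. *)
Lemma density_partialv l i f x : smooth f ->
  vmeas.-integrable setT (EFin \o (fun t =>
    partial i (monomial l) (row_of_tuple t) * f (x, row_of_tuple t))) ->
  density (xvword l [::] [:: i] f) x =
  - int_velocity (fun v => partial i (monomial l) v * f (x, v)).
Proof.
move=> sf iM; have [_ Cf _] := sf.
have Cs := Cinfty_vslice x Cf.
pose F v := monomial l v * f (x, v).
have CF : Cinfty F by apply: CinftyM => //; exact: Cinfty_vmonomial.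
have FE : partial i F = fun v => xvword l [::] [:: i] f (x, v) + partial i (monomial l) v * f (x, v).
  apply/funext => v; rewrite partialM//; last exact: Cinfty_vmonomial.
  by rewrite [partial i _ v](@Dw_vslice _ _ [:: i])// [f _ * _]mulrC.
have iX := integrable_vslice x (xL1_xvword l [::] [:: i] sf).
have iF := integrable_vslice x (xL1_xvword l [::] [::] sf).
have := @int_velocity_partial R d F i CF iF.
rewrite FE => /(_ (integrable_EFinD iX iM)) /eqP.
rewrite /int_velocity RintegralD// addr_eq0 => /eqP.
by [].
Qed.

Lemma density_partialv0 i f x : smooth f -> density (xvword [::] [::] [:: i] f) x = 0.
Proof.
move=> sf; have E v : partial i (monomial [::]) v = 0 :> R.
  rewrite (_ : monomial [::] = fun=> 1); first exact: derive_cst.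
  by apply/funext => w; rewrite /monomial big_nil.
rewrite density_partialv//.
  under [X in int_velocity X]eq_fun do rewrite E mul0r.
  by rewrite /int_velocity /Rintegral integral0 oppr0.
by under [X in _ \o X]eq_fun do rewrite E mul0r; exact: integrable0.
Qed.

Lemma density_partialv1 i j f x : smooth f ->
  density (xvword [:: j] [::] [:: i] f) x = - (j == i)%:R * density f x.
Proof.
move=> sf; have E v : partial i (monomial [:: j]) v = (j == i)%:R :> R.
  rewrite (_ : monomial [:: j] = fun v => v 0 j); first exact: partial_coord.
  by apply/funext => w; rewrite /monomial big_seq1.
have iF := integrable_vslice x (xL1_smooth sf).
rewrite density_partialv//.
  under [X in int_velocity X]eq_fun do rewrite E.
  by rewrite mulNr; congr (- _); exact: (RintegralZl _ measurableT iF).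
by under [X in _ \o X]eq_fun do rewrite E; exact: (integrable_EFinZ _ iF).
Qed.

Lemma density_partialv2 i j f x : smooth f ->
  density (xvword [:: j; j] [::] [:: i] f) x = - (2 * (j == i)%:R) * flux j f x.
Proof.
move=> sf; have E v : partial i (monomial [:: j; j]) v * f (x, v) =
    (2 * (j == i)%:R) * (v 0 j * f (x, v)).
  rewrite (_ : monomial [:: j; j] = fun v => v 0 j * v 0 j); last first.
    by apply/funext => w; rewrite /monomial !big_cons big_nil mulr1.
  by rewrite partialM; [rewrite partial_coord; ring|exact: Cinfty_coord..].
have iF := integrable_vslice x (xL1_coordM j sf).
rewrite density_partialv//.
  under [X in int_velocity X]eq_fun do rewrite E.
  by rewrite mulNr; congr (- _); exact: (RintegralZl _ measurableT iF).
by under [X in _ \o X]eq_fun do rewrite E; exact: (integrable_EFinZ _ iF).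
Qed.

Lemma derive_fst u (e z : phase) : Cinfty u ->
  'D_e (fun z : phase => u z.1) z = 'D_(e.1) u z.1.
Proof.
move=> Cu; have du : differentiable u (z.1 + 0) by rewrite addr0; exact: Cinfty_diff.
have [_ H] := @differentiable_affine R _ _ (fun z : phase => z.1) 0 u z
  (fun _ _ _ => erefl) (fun y => cvg_fst) du.
rewrite -[in RHS](addr0 z.1) -H; congr ('D_e _ z).
by apply/funext => y; rewrite addr0.
Qed.

Lemma partialx_fst u i z : Cinfty u -> partialx i (fun z : phase => u z.1) z = partial i u z.1.
Proof. exact: derive_fst. Qed.

Lemma partialv_fst u i z : Cinfty u -> partialv i (fun z : phase => u z.1) z = 0.
Proof.
move=> Cu; rewrite /partialv derive_fst//= deriveE ?linear0//.
exact: Cinfty_diff.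
Qed.

Lemma is_frechet_kinetic f : smooth f ->
  is_frechet_derivative kinetic f (fun z => (\sum_(i < d) z.2 0 i ^+ 2) / 2).
Proof.
move=> sf; have iK h : smooth h ->
    integrable_phase (fun z : phase => (\sum_(i < d) z.2 0 i ^+ 2) / 2 * h z).
  move=> sh; rewrite (_ : (fun _ => _) =
      fun z => 2^-1 * \sum_(i < d) xvword [:: i; i] [::] [::] h z).
    apply/integrable_phaseZ/integrable_phase_sum => i.
    by have [_ _ /(_ [::])] := xL1_xvword [:: i; i] [::] [::] sh.
  apply/funext => z; rewrite -mulrA mulrCA mulr_suml; congr (_ * _).
  by apply: eq_bigr => i _; rewrite /xvword /monomial !big_cons big_nil mulr1 expr2.
split.
- by [].
- apply: CinftyM; last exact: Cinfty_cst.
  by apply: Cinfty_sum => i; apply: CinftyX; exact: Cinfty_vcoord.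
- exact: iK.
- exists 0, 0 => h sh _; rewrite mul0r /kinetic.
  have -> : (fun z : phase => (\sum_(i < d) z.2 0 i ^+ 2) / 2 * (f z + h z)) =
      fun z => (\sum_(i < d) z.2 0 i ^+ 2) / 2 * f z + (\sum_(i < d) z.2 0 i ^+ 2) / 2 * h z.
    by apply/funext => z; rewrite mulrDr.
  rewrite int_phaseD; [|exact: iK..].
  by rewrite [X in X - _]addrAC subrr add0r subrr normr0.
Qed.

Lemma int_phase_fst u f : perC u -> smooth f ->
  integrable_phase (fun z => u z.1 * f z) /\
  int_phase (fun z => u z.1 * f z) = int_torus (fun x => u x * density f x).
Proof. by move=> Cu sf; apply: int_phase_density => //; exact: xL1_smooth. Qed.

Lemma electricE f : electric f =
  int_torus (fun x => 2^-1 * \sum_(i < d) partial i (potential f) x * partial i (potential f) x).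
Proof.
congr int_torus; apply/funext => x; congr (_ * _); apply: eq_bigr => i _.
by rewrite /field sqrrN expr2.
Qed.

(** The mass term in [laplacian (potential h)] is constant, and it disappears because [u] has mean
    zero. *)
Lemma int_potential_laplacian u h : perC u -> int_torus u = 0 -> smooth h ->
  int_torus (fun x => u x * laplacian (potential h) x) = - int_torus (fun x => u x * density h x).
Proof.
move=> Cu u0 sh; have [_ _ Lp] := potentialP sh; have Cr := perC_density (xL1_smooth sh).
have -> : (fun x => u x * laplacian (potential h) x) =
    fun x => mass h * u x + -1 * (u x * density h x).
  by apply/funext => x; rewrite Lp; ring.
rewrite int_torus_perCD ?int_torus_perCZ// ?u0 ?mulr0 ?add0r ?mulN1r//; [exact: perCM|exact: perCZ|].
by apply: perCZ; exact: perCM.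
Qed.

Lemma green_potential u h : perC u -> int_torus u = 0 -> smooth h ->
  int_torus (fun x => \sum_(i < d) partial i u x * partial i (potential h) x) =
  int_torus (fun x => u x * density h x).
Proof.
move=> Cu u0 sh; have [Cp _ _] := potentialP sh.
by rewrite green// int_potential_laplacian// opprK.
Qed.

Lemma ler_norm_sum_const (I : finType) (F : I -> R) M : (forall i, `|F i| <= M) ->
  `|\sum_i F i| <= #|I|%:R * M.
Proof.
move=> FM; rewrite (le_trans (ler_norm_sum _ _ _))// mulr_natl -sumr_const.
exact: ler_sum.
Qed.

Lemma sum_square_half (I : finType) (a b : I -> R) :
  2^-1 * \sum_i (a i + b i) * (a i + b i) =
  2^-1 * \sum_i a i * a i + (\sum_i a i * b i + 2^-1 * \sum_i b i * b i).
Proof.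
rewrite (eq_bigr (fun i => a i * a i + 2 * (a i * b i) + b i * b i)); last by move=> i _; ring.
by rewrite !big_split /= -mulr_sumr; field.
Qed.

(** Since [potential] is linear, the functional is quadratic and its remainder at [h] is
    [electric h]; Green's formula identifies the cross term with the pairing of [potential f] and
    [h]. *)
Lemma is_frechet_electric f : smooth f ->
  is_frechet_derivative electric f (fun z => potential f z.1).
Proof.
move=> sf; have [Cp p0 Lp] := potentialP sf; split.
- by move=> v i x; exact: Cp.1.
- exact/Cinfty_fst/Cp.2.
- by move=> h sh; exact: (int_phase_fst Cp sh).1.
- have [N [C [C0 HC]]] := field_bounds (R := R) (d := d).
  exists N, (2^-1 * (d%:R * C ^+ 2) * (2 * pi) ^+ d) => h sh _.
  have [Ch h0 Lh] := potentialP sh; have [_ Fh _] := HC h sh.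
  have Cpp i (u : V -> R) : perC u -> perC (partial i u) by exact: perC_partial.
  have Cs u w : perC u -> perC w -> perC (fun x => \sum_(i < d) partial i u x * partial i w x).
    by move=> Cu Cw; apply: perC_sum => i; apply: perCM; exact: Cpp.
  have E : electric (fun z => f z + h z) - electric f - int_phase (fun z => potential f z.1 * h z)
      = int_torus (fun x => 2^-1 * \sum_(i < d) partial i (potential h) x * partial i (potential h) x).
    rewrite (int_phase_fst Cp sh).2 -green_potential// !electricE potentialD//.
    have -> : (fun x => 2^-1 * \sum_(i < d) partial i (fun x => potential f x + potential h x) x *
          partial i (fun x => potential f x + potential h x) x) = fun x =>
        2^-1 * \sum_(i < d) partial i (potential f) x * partial i (potential f) x +
        (\sum_(i < d) partial i (potential f) x * partial i (potential h) x +
         2^-1 * \sum_(i < d) partial i (potential h) x * partial i (potential h) x).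
      apply/funext => x; rewrite -sum_square_half; congr (_ * _); apply: eq_bigr => i _.
      by rewrite (@partialD R d (potential f) (potential h) i x Cp.2 Ch.2).
    rewrite int_torus_perCD; [|by apply: perCZ; exact: Cs|by apply: perCD; [|apply: perCZ]; exact: Cs].
    rewrite int_torus_perCD; [|exact: Cs|by apply: perCZ; exact: Cs].
    have L (a b c : R) : a + (b + c) - a - b = c by ring.
    exact: L.
  rewrite E.
  have CE : perC (fun x => 2^-1 * \sum_(i < d) partial i (potential h) x * partial i (potential h) x).
    by apply: perCZ; exact: Cs.
  rewrite (le_trans (int_torus_bound CE.1 (perC_continuous CE)
    (M := 2^-1 * (d%:R * (C * smooth_norm N h) ^+ 2)) _))//.
    move=> x; rewrite normrM ger0_norm ?invr_ge0// ler_wpM2l ?invr_ge0//.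
    rewrite -[X in X%:R * _]card_ord; apply: ler_norm_sum_const => i.
    by rewrite normrM expr2 ler_pM// Fh.
  have L (a b c e : R) : a * (b * (c * e) ^+ 2) = a * (b * c ^+ 2) * e ^+ 2 by ring.
  by rewrite L mulrAC.
Qed.

Lemma micro_bracket_fst u f z : Cinfty u ->
  micro_bracket (fun z => u z.1) f z = \sum_(i < d) partial i u z.1 * partialv i f z.
Proof.
move=> Cu; apply: eq_bigr => i _.
by rewrite partialx_fst// partialv_fst// mul0r subr0.
Qed.

End functionals.

(** * The brackets [T, U] and [[T, U], U] *)

Section brackets.
Context {R : realType} {d : nat}.
Local Notation V := 'rV[R]_d.
Local Notation phase := (V * V)%type.
Implicit Types (f h F : phase -> R) (x v : V) (u w : V -> R) (a b c : 'I_d -> V -> R).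

Definition grad u (i : 'I_d) : V -> R := partial i u.
Definition tdot a b : R := int_torus (fun x => \sum_(i < d) a i x * b i x).
Definition perCv a := forall i, perC (a i).

Lemma perC_tdot a b : perCv a -> perCv b -> perC (fun x => \sum_(i < d) a i x * b i x).
Proof. by move=> Ca Cb; apply: perC_sum => i; exact: perCM. Qed.

Lemma perCv_grad u : perC u -> perCv (grad u).
Proof. by move=> Cu i; exact: perC_partial. Qed.

Lemma tdotC a b : tdot a b = tdot b a.
Proof.
congr int_torus; apply/funext => x; apply: eq_bigr => i _; exact: mulrC.
Qed.

Lemma tdotDl a b c : perCv a -> perCv b -> perCv c ->
  tdot (fun i x => a i x + b i x) c = tdot a c + tdot b c.
Proof.
move=> Ca Cb Cc; rewrite /tdot -int_torus_perCD; [|exact: perC_tdot..].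
congr int_torus; apply/funext => x; rewrite -big_split/=.
by apply: eq_bigr => i _; rewrite mulrDl.
Qed.

Lemma tdotDr a b c : perCv a -> perCv b -> perCv c ->
  tdot c (fun i x => a i x + b i x) = tdot c a + tdot c b.
Proof. by move=> Ca Cb Cc; rewrite tdotC tdotDl// !(tdotC c). Qed.

Lemma tdot_expand a b a' b' : perCv a -> perCv b -> perCv a' -> perCv b' ->
  tdot (fun i x => a i x + b i x) (fun i x => a' i x + b' i x) =
  tdot a a' + tdot a b' + (tdot b a' + tdot b b').
Proof.
move=> Ca Cb Ca' Cb'; rewrite tdotDl//; first by rewrite !tdotDr.
by move=> i; exact: perCD.
Qed.

Lemma tdot_bound a b A B : perCv a -> perCv b -> (forall i x, `|a i x| <= A) ->
  (forall i x, `|b i x| <= B) -> `|tdot a b| <= d%:R * (A * B) * (2 * pi) ^+ d.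
Proof.
move=> Ca Cb aA bB; have Cs := perC_tdot Ca Cb.
apply: int_torus_bound; [exact: Cs.1|exact: perC_continuous|move=> x].
rewrite -[X in X%:R * _]card_ord; apply: ler_norm_sum_const => i.
by rewrite normrM ler_pM.
Qed.

Definition divergence a : V -> R := fun x => \sum_(i < d) partial i (a i) x.

Lemma perC_divergence a : perCv a -> perC (divergence a).
Proof. by move=> Ca; apply: perC_sum => i; exact: perC_partial. Qed.

Lemma int_torus_divergence a : perCv a -> int_torus (divergence a) = 0.
Proof.
move=> Ca; rewrite int_torus_perC_sum; last by move=> i; exact: perC_partial.
by apply: big1 => i _; exact: int_torus_partial.
Qed.

Lemma tdot_grad u a : perC u -> perCv a ->
  tdot (grad u) a = - int_torus (fun x => u x * divergence a x).
Proof.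
move=> Cu Ca; have Cp i := perC_partial i (Ca i).
rewrite /tdot int_torus_perC_sum; last by move=> i; apply: perCM => //; exact: perC_partial.
under [X in - int_torus X]eq_fun do rewrite mulr_sumr.
rewrite int_torus_perC_sum; last by move=> i; exact: perCM.
by rewrite -sumrN; apply: eq_bigr => i _; rewrite [in RHS]int_torus_IBP// opprK.
Qed.

(** The mean-zero [chi] with [- Delta chi = div a], for a smooth periodic field [a]; solvability is
    automatic because a divergence has mean zero. *)
Definition poisson_div a : V -> R := fun x => - inv_laplacian (divergence a) x.

Lemma poisson_divP a : perCv a -> [/\ perC (poisson_div a), int_torus (poisson_div a) = 0 &
  forall x, laplacian (poisson_div a) x = - divergence a x].
Proof.
move=> Ca; have [] := inv_laplacianP (perC_divergence Ca) (int_torus_divergence Ca).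
move=> Cu u0 Lu; split; first exact: perCN.
- by rewrite int_torusN// u0 oppr0.
- by move=> x; rewrite laplacianN ?Lu//; exact: Cu.2.
Qed.

(** Self-adjointness of the inverse Laplacian. The dependence on [h], hidden in its potential, is
    moved to its density, the form from which a Frechet derivative can be read off. *)
Lemma tdot_potential a h : perCv a -> smooth h ->
  tdot (grad (potential h)) a = - int_torus (fun x => poisson_div a x * density h x).
Proof.
move=> Ca sh; have [Cp p0 Lp] := potentialP sh; have [Cu u0 Lu] := poisson_divP Ca.
rewrite tdot_grad//; congr (- _).
rewrite -green_potential//.
transitivity (tdot (grad (potential h)) (grad (poisson_div a))); last exact: tdotC.
rewrite /tdot green// -int_torusN; last by apply: perCM => //; exact: perC_laplacian.
by congr int_torus; apply/funext => x; rewrite Lu mulrN opprK.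
Qed.

Lemma gradD u w : Cinfty u -> Cinfty w ->
  grad (fun x => u x + w x) = fun i x => grad u i x + grad w i x.
Proof. by move=> Cu Cw; apply/funext => i; apply/funext => x; exact: partialD. Qed.

Lemma grad_potentialD f h : smooth f -> smooth h ->
  grad (potential (fun z => f z + h z)) =
  fun i x => grad (potential f) i x + grad (potential h) i x.
Proof.
move=> sf sh; have [Cf _ _] := potentialP sf; have [Ch _ _] := potentialP sh.
by rewrite potentialD// gradD//; [exact: Cf.2|exact: Ch.2].
Qed.

Lemma perCv_flux f : smooth f -> perCv (fun i => flux i f).
Proof. by move=> sf i; exact: perC_flux. Qed.

Lemma perCv_field f : smooth f -> perCv (grad (potential f)).
Proof. by move=> sf; have [Cp _ _] := potentialP sf; exact: perCv_grad. Qed.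

(** In the double sum of terms with [v_j^2] and the [v_i]-derivative of [f], only [i = j] survives
    integration by parts; the 2 from differentiating the square cancels the 1/2 of the kinetic
    energy. *)
Lemma bracket_kinetic_electric f : smooth f ->
  poisson_bracket kinetic electric f = - tdot (grad (potential f)) (fun i => flux i f).
Proof.
move=> sf; have [Cp _ _] := potentialP sf.
rewrite /poisson_bracket (frechet_derivativeE (is_frechet_kinetic sf)).
rewrite (frechet_derivativeE (is_frechet_electric sf)).
pose X j i z := partial i (potential f) z.1 * xvword [:: j; j] [::] [:: i] f z.
have nX j i := xL1_xvword [:: j; j] [::] [:: i] sf.
have iX j i := int_phase_density (perC_partial i Cp) (nX j i).
rewrite (_ : (fun z : phase => _) = fun z => 2^-1 * \sum_(j < d) \sum_(i < d) X j i z); last first.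
  apply/funext => z; rewrite micro_bracket_fst; last exact: Cp.2.
  rewrite mulrAC mulrC mulr_suml; congr (_ * _); apply: eq_bigr => j _.
  rewrite mulr_sumr; apply: eq_bigr => i _.
  by rewrite /X /xvword /monomial !big_cons big_nil mulr1 mulrCA expr2.
rewrite int_phaseZ; last first.
  by apply: integrable_phase_sum => j; apply: integrable_phase_sum => i; exact: (iX j i).1.
rewrite int_phase_sum; last first.
  by move=> j; apply: integrable_phase_sum => i; exact: (iX j i).1.
rewrite /tdot int_torus_perC_sum; last first.
  by move=> i; apply: perCM; [exact: perC_partial|exact: perC_flux].
rewrite mulr_sumr -sumrN; apply: eq_bigr => j _.
rewrite int_phase_sum; last by move=> i; exact: (iX j i).1.
rewrite (bigD1 j)//= big1 ?addr0.
  rewrite (iX j j).2 (_ : (fun x => _) = fun x => - 2 * (grad (potential f) j x * flux j f x)).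
    rewrite int_torus_perCZ; last by apply: perCM; [exact: perC_partial|exact: perC_flux].
    by rewrite mulNr mulrN mulrA mulVf ?mul1r.
  by apply/funext => x; rewrite density_partialv2// eqxx mulr1 mulrCA.
move=> i ij; rewrite (iX j i).2 (_ : (fun x => _) = fun=> 0).
  by rewrite int_torus_cst mul0r.
by apply/funext => x; rewrite density_partialv2// eq_sym (negbTE ij) mulr0 oppr0 mul0r mulr0.
Qed.

Definition d_bracket f : phase -> R := fun z =>
  poisson_div (fun i => flux i f) z.1 - \sum_(i < d) z.2 0 i * partial i (potential f) z.1.

Lemma int_d_bracket f h : smooth f -> smooth h ->
  integrable_phase (fun z => d_bracket f z * h z) /\
  int_phase (fun z => d_bracket f z * h z) =
  int_torus (fun x => poisson_div (fun i => flux i f) x * density h x) -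
  tdot (grad (potential f)) (fun i => flux i h).
Proof.
move=> sf sh; have [Cu _ _] := poisson_divP (perCv_flux sf).
have [i0 e0] := int_phase_fst Cu sh.
have iX i := int_phase_density (perCv_field sf i) (xL1_coordM i sh).
pose X (z : phase) := \sum_(i < d) grad (potential f) i z.1 * (z.2 0 i * h z).
have eX : int_phase X = tdot (grad (potential f)) (fun i => flux i h).
  rewrite int_phase_sum; last by move=> i; exact: (iX i).1.
  rewrite /tdot int_torus_perC_sum; last by move=> i; apply: perCM; [exact: perCv_field|exact: perC_flux].
  by apply: eq_bigr => i _; rewrite (iX i).2.
have jX : integrable_phase X by apply: integrable_phase_sum => i; exact: (iX i).1.
rewrite (_ : (fun z : phase => _) = fun z => poisson_div (fun i => flux i f) z.1 * h z + -1 * X z).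
  split; first by apply: integrable_phaseD => //; exact: integrable_phaseZ.
  by rewrite int_phaseD ?int_phaseZ ?e0 ?eX ?mulN1r//; exact: integrable_phaseZ.
apply/funext => z; rewrite /d_bracket mulrBl mulN1r mulr_suml; congr (_ - _).
by apply: eq_bigr => i _; rewrite mulrAC mulrC.
Qed.

(** The bracket is bilinear in potential and flux, so the remainder is exactly its value at [h]. The
    cross term with the flux of [f] becomes an integral against [h] through [tdot_potential]. *)
Lemma is_frechet_bracket f : smooth f ->
  is_frechet_derivative (poisson_bracket kinetic electric) f (d_bracket f).
Proof.
move=> sf; have [Cu _ _] := poisson_divP (perCv_flux sf); have Cp := perCv_field sf.
split.
- move=> v i x; rewrite /d_bracket /= (Cu.1 i x); congr (_ - _).
  by apply: eq_bigr => j _; congr (_ * _); exact: (Cp j).1.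
- apply: CinftyB; first exact: Cinfty_fst Cu.2.
  apply: Cinfty_sum => i; apply: CinftyM; first exact: Cinfty_vcoord.
  exact: Cinfty_fst (Cp i).2.
- by move=> h sh; exact: (int_d_bracket sf sh).1.
have [N [C [C0 HC]]] := field_bounds (R := R) (d := d).
exists N, (d%:R * C ^+ 2 * (2 * pi) ^+ d) => h sh _.
have [_ Fh Jh] := HC h sh; have Ch := perCv_field sh.
have Jf := perCv_flux sf; have Jh' := perCv_flux sh.
have -> : poisson_bracket kinetic electric (fun z => f z + h z) -
    poisson_bracket kinetic electric f - int_phase (fun z => d_bracket f z * h z) =
    - tdot (grad (potential h)) (fun i => flux i h).
  rewrite (int_d_bracket sf sh).2 (bracket_kinetic_electric (smoothD sf sh)).
  rewrite (bracket_kinetic_electric sf) grad_potentialD//.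
  have -> : (fun i => flux i (fun z => f z + h z)) = fun i x => flux i f x + flux i h x.
    by apply/funext => i; exact: fluxD.
  have L (t a1 a2 a3 a4 e : R) : t = a1 + a2 + (a3 + a4) -> a3 = - e ->
    - t - - a1 - (e - a2) = - a4 by move=> -> ->; ring.
  exact: L (tdot_expand Cp Ch Jf Jh') (tdot_potential Jf sh).
rewrite normrN (le_trans (tdot_bound Ch Jh' Fh Jh))//.
have L (e c n p : R) : e * (c * n * (c * n)) * p = e * c ^+ 2 * p * n ^+ 2 by ring.
by rewrite L.
Qed.

Definition TUU : functional :=
  poisson_bracket (poisson_bracket kinetic electric) (@electric R d).

(** The part of [d_bracket f] depending on [x] alone contributes integrals of [v]-derivatives of
    [f], which vanish. In the part linear in [v] only equal indices survive, and two minus signs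
    cancel. *)
Lemma TUUE f : smooth f ->
  TUU f = int_torus (fun x => (\sum_(i < d) partial i (potential f) x ^+ 2) * density f x).
Proof.
move=> sf; have [Cu _ _] := poisson_divP (perCv_flux sf); have Cp := perCv_field sf.
have Cr := perC_density (xL1_smooth sf).
rewrite /TUU /poisson_bracket -/(poisson_bracket kinetic electric).
rewrite (frechet_derivativeE (is_frechet_bracket sf)).
rewrite (frechet_derivativeE (is_frechet_electric sf)).
pose X j i (z : phase) := grad (potential f) j z.1 * grad (potential f) i z.1 *
  xvword [:: j] [::] [:: i] f z.
pose Y i (z : phase) := poisson_div (fun i => flux i f) z.1 * grad (potential f) i z.1 *
  xvword [::] [::] [:: i] f z.
have iX j i := int_phase_density (perCM (Cp j) (Cp i)) (xL1_xvword [:: j] [::] [:: i] sf).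
have iY i := int_phase_density (perCM Cu (Cp i)) (xL1_xvword [::] [::] [:: i] sf).
have jX : integrable_phase (fun z => \sum_(j < d) \sum_(i < d) X j i z).
  by apply: integrable_phase_sum => j; apply: integrable_phase_sum => i; exact: (iX j i).1.
have jY : integrable_phase (fun z => \sum_(i < d) Y i z).
  by apply: integrable_phase_sum => i; exact: (iY i).1.
rewrite (_ : (fun z : phase => _) = fun z =>
    \sum_(i < d) Y i z + -1 * \sum_(j < d) \sum_(i < d) X j i z); last first.
  apply/funext => z; have [Cpot _ _] := potentialP sf.
  rewrite micro_bracket_fst; last exact: Cpot.2.
  rewrite /d_bracket mulrBl mulN1r mulr_sumr mulr_suml; congr (_ - _); apply: eq_bigr => i _.
    by rewrite /Y /xvword /monomial big_nil mul1r mulrA.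
  rewrite mulr_sumr; apply: eq_bigr => j _.
  have L (p q r s : R) : p * q * (r * s) = q * r * (p * s) by ring.
  by rewrite /X /xvword /monomial big_seq1 L.
rewrite int_phaseD//; last exact: integrable_phaseZ.
rewrite int_phaseZ// !int_phase_sum; last 2 first.
- by move=> j; apply: integrable_phase_sum => i; exact: (iX j i).1.
- by move=> i; exact: (iY i).1.
rewrite big1 ?add0r; last first.
  move=> i _; rewrite (iY i).2 (_ : (fun x => _) = fun=> 0) ?int_torus_cst ?mul0r//.
  by apply/funext => x; rewrite density_partialv0// mulr0.
rewrite (_ : (fun x => _) = fun x => \sum_(i < d) partial i (potential f) x ^+ 2 * density f x);
  last by apply/funext => x; rewrite mulr_suml.
rewrite int_torus_perC_sum; last first.
  by move=> i; apply: perCM => //; apply: perCX; exact: (Cp i).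
rewrite mulN1r -sumrN; apply: eq_bigr => j _.
rewrite int_phase_sum; last by move=> i; exact: (iX j i).1.
rewrite (bigD1 j)//= big1 ?addr0.
  rewrite (iX j j).2 -int_torusN; last first.
    by apply: perCM; [exact: perCM|apply: perC_density; exact: xL1_xvword].
  congr int_torus; apply/funext => x.
  by rewrite density_partialv1// eqxx mulN1r mulrN opprK expr2.
move=> i ij; rewrite (iX j i).2 (_ : (fun x => _) = fun=> 0) ?int_torus_cst ?mul0r//.
by apply/funext => x; rewrite density_partialv1// eq_sym (negbTE ij) oppr0 mul0r mulr0.
Qed.

(** Minus the derivative of [|grad phi|^2 rho] with respect to [grad phi]; the sign matches
    [tdot_potential], so that [poisson_div (current f)] enters the derivative with a plus. *)
Definition current f (i : 'I_d) : V -> R := fun x =>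
  -2 * (density f x * partial i (potential f) x).

Definition TUU_derivative f : V -> R := fun x =>
  \sum_(i < d) partial i (potential f) x ^+ 2 + poisson_div (current f) x.

Lemma perCv_current f : smooth f -> perCv (current f).
Proof.
move=> sf i; apply: perCZ; apply: perCM; last exact: perCv_field.
exact/perC_density/xL1_smooth.
Qed.

Lemma perC_field_square f : smooth f ->
  perC (fun x => \sum_(i < d) partial i (potential f) x ^+ 2).
Proof. by move=> sf; apply: perC_sum => i; apply: perCX; exact: perCv_field sf i. Qed.

Lemma perC_TUU_derivative f : smooth f -> perC (TUU_derivative f).
Proof.
move=> sf; apply: perCD; first exact: perC_field_square.
by have [] := poisson_divP (perCv_current sf).
Qed.

Lemma int_torus_perCB u w : perC u -> perC w ->
  int_torus (fun x => u x - w x) = int_torus u - int_torus w.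
Proof.
by move=> Cu Cw; apply: int_torusB; [exact: Cu.1|exact: perC_continuous
  |exact: Cw.1|exact: perC_continuous].
Qed.

(** With [a], [b] the gradients and [r], [s] the densities of [f] and [h], the terms of
    [|a + b|^2 (r + s)] that are linear in [h] are [|a|^2 s + 2 r a . b]; what remains is at least
    quadratic. *)
Lemma TUU_remainder f h : smooth f -> smooth h ->
  TUU (fun z => f z + h z) - TUU f - int_phase (fun z => TUU_derivative f z.1 * h z) =
  int_torus (fun x => \sum_(i < d)
    (2 * partial i (potential f) x * partial i (potential h) x * density h x +
     partial i (potential h) x ^+ 2 * (density f x + density h x))).
Proof.
move=> sf sh; have Ca := perCv_current sf; have sfh := smoothD sf sh.
have [Cx _ _] := poisson_divP Ca.
have Crf := perC_density (xL1_smooth sf); have Crh := perC_density (xL1_smooth sh).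
have Cqf := perC_field_square sf; have Cqfh := perC_field_square sfh.
have Crfh := perC_density (xL1_smooth sfh); have Ch := perCv_field sh.
rewrite (int_phase_fst (perC_TUU_derivative sf) sh).2 !TUUE//.
have -> : int_torus (fun x => TUU_derivative f x * density h x) =
    int_torus (fun x => (\sum_(i < d) partial i (potential f) x ^+ 2) * density h x -
      \sum_(i < d) grad (potential h) i x * current f i x).
  rewrite int_torus_perCB; [|exact: perCM|exact: perC_tdot].
  rewrite -/(tdot _ _) tdot_potential// opprK -int_torus_perCD; [|exact: perCM..].
  by congr int_torus; apply/funext => x; rewrite /TUU_derivative mulrDl.
rewrite -int_torus_perCB; [|exact: perCM..].
rewrite -int_torus_perCB; [|by apply: perCB; exact: perCM
  |by apply: perCB; [exact: perCM|exact: perC_tdot]].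
congr int_torus; apply/funext => x.
rewrite -/(grad _ _) densityD; [|exact: xL1_smooth..].
have L (a b e : 'I_d -> R) (r s : R) : (forall i, e i = a i + b i) ->
  (\sum_i e i ^+ 2) * (r + s) - (\sum_i a i ^+ 2) * r -
  ((\sum_i a i ^+ 2) * s - \sum_i b i * (- 2 * (r * a i))) =
  \sum_i (2 * a i * b i * s + b i ^+ 2 * (r + s)).
  move=> eE; rewrite !mulr_suml -!sumrB; apply: eq_bigr => i _; rewrite eE; ring.
apply: L => i; have := congr1 (fun g => g i x) (grad_potentialD sf sh).
by [].
Qed.

Lemma is_frechet_TUU f : smooth f ->
  is_frechet_derivative TUU f (fun z => TUU_derivative f z.1).
Proof.
move=> sf; have CK := perC_TUU_derivative sf; split.
- by move=> v i x; exact: CK.1.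
- exact: Cinfty_fst CK.2.
- by move=> h sh; exact: (int_phase_fst CK sh).1.
have [N [C [C0 HC]]] := field_bounds (R := R) (d := d).
have [Nf Hf] : exists B, (forall x, `|density f x| <= B) /\
    forall i x, `|partial i (potential f) x| <= B.
  by exists (C * smooth_norm N f); have [] := HC f sf.
pose B := Nf; have [rB pB] := Hf.
exists N, (d%:R * (2 * B * C ^+ 2 + C ^+ 2 * (B + C)) * (2 * pi) ^+ d) => h sh n1.
have [rh ph _] := HC h sh.
have Crf := perC_density (xL1_smooth sf); have Crh := perC_density (xL1_smooth sh).
have Cf := perCv_field sf; have Ch := perCv_field sh.
rewrite TUU_remainder//; set n := smooth_norm N h in n1 rh ph *.
have n0 : 0 <= n by exact: smooth_norm_ge0.
have B0 : 0 <= B by exact: le_trans (rB 0).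
have CE : perC (fun x => \sum_(i < d)
    (2 * partial i (potential f) x * partial i (potential h) x * density h x +
     partial i (potential h) x ^+ 2 * (density f x + density h x))).
  apply: perC_sum => i; apply: perCD; apply: perCM => //.
  - by apply: perCM; [apply: perCZ; exact: (Cf i)|exact: (Ch i)].
  - by apply: perCX; exact: (Ch i).
  - exact: perCD.
rewrite mulrAC; apply: int_torus_bound; [exact: CE.1|exact: perC_continuous|move=> x].
apply: (@le_trans _ _ (#|'I_d|%:R * ((2 * B * C ^+ 2 + C ^+ 2 * (B + C)) * n ^+ 2))).
  2: by rewrite card_ord mulrA.
apply: ler_norm_sum_const => i.
move: (rB x) (pB i x) (rh x) (ph i x).
move: (density f x) (partial i (potential f) x) (density h x) (partial i (potential h) x).
move=> r a s b rB' aB sB bB.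
(* The remainder has a term cubic in [h]; the hypothesis that the norm is at most 1 reduces it to a
   quadratic one. *)
have sC : `|s| <= C by rewrite (le_trans sB)// ler_piMr.
rewrite (le_trans (ler_normD _ _))// [leRHS]mulrDl lerD//.
  rewrite (_ : 2 * B * C ^+ 2 * n ^+ 2 = 2 * B * (C * n) * (C * n)); last by ring.
  rewrite !normrM (ger0_norm (ler0n R 2)).
  apply: ler_pM; rewrite ?mulr_ge0//.
  by apply: ler_pM; rewrite ?mulr_ge0// ler_wpM2l.
rewrite normrM normrX.
rewrite (_ : C ^+ 2 * (B + C) * n ^+ 2 = (C * n) ^+ 2 * (B + C)); last by ring.
rewrite ler_pM ?exprn_ge0//; first by rewrite ler_pXn2r// ?nnegrE ?mulr_ge0.
by rewrite (le_trans (ler_normD _ _))// lerD.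
Qed.

End brackets.

(** * The equation for K *)

Section bracket_laplacian.
Context {R : realType} {d : nat}.
Local Notation V := 'rV[R]_d.
Local Notation phase := (V * V)%type.
Implicit Types (f : phase -> R) (x : V) (u w : V -> R).

Lemma laplacian_sqr u x : Cinfty u ->
  laplacian (fun x => u x ^+ 2) x =
  2 * (\sum_(i < d) partial i u x ^+ 2) + 2 * (u x * laplacian u x).
Proof.
move=> Cu; rewrite /laplacian !mulr_sumr -big_split/=; apply: eq_bigr => i _.
have -> : partial i (fun x => u x ^+ 2) = fun x => 2 * (u x * partial i u x).
  apply/funext => y; under [X in partial i X]eq_fun do rewrite expr2.
  by rewrite partialM//; ring.
have Cd : Cinfty (partial i u) by exact: Cinfty_derive.
by rewrite partialZ ?partialM//; [ring|exact: CinftyM].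
Qed.

Lemma laplacian_sum (I : Type) (r : seq I) (u : I -> V -> R) x :
  (forall j, Cinfty (u j)) ->
  laplacian (fun x => \sum_(j <- r) u j x) x = \sum_(j <- r) laplacian (u j) x.
Proof.
move=> Cu; rewrite /laplacian exchange_big /=; apply: eq_bigr => i _.
rewrite -partial_sum; last by move=> j; exact: Cinfty_derive.
by congr (partial i _ x); apply/funext => y; rewrite partial_sum.
Qed.

(** The Laplacian of [|grad phi|^2] is twice the squared Hessian plus
    [2 grad phi . grad (Delta phi)]. The last term is cancelled by the divergence of [current f]
    once [rho = m - Delta phi] is inserted, so no third derivative is left. *)
Lemma laplacian_TUU_derivative f x : smooth f ->
  - laplacian (TUU_derivative f) x =
  - 2 * mass f * laplacian (potential f) x
  - 2 * (\sum_(i < d) \sum_(j < d) partial i (partial j (potential f)) x ^+ 2)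
  + 2 * laplacian (potential f) x ^+ 2.
Proof.
move=> sf; have [[_ Cp] _ Lp] := potentialP sf; set phi := potential f in Cp Lp *.
have Cpi i : Cinfty (partial i phi) by exact: Cinfty_derive.
have CL : Cinfty (laplacian phi) by apply: Cinfty_sum => i; do 2 apply: Cinfty_derive.
have [[_ Cx] _ Lx] := poisson_divP (perCv_current sf).
have rE y : density f y = mass f - laplacian phi y by rewrite Lp opprB addrC subrK.
rewrite /TUU_derivative laplacianD//; last by apply: Cinfty_sum => i; exact: CinftyX.
rewrite Lx laplacian_sum; last by move=> j; exact: CinftyX.
have -> : \sum_(j < d) laplacian (fun y => partial j phi y ^+ 2) x =
    2 * (\sum_(i < d) \sum_(j < d) partial i (partial j phi) x ^+ 2) +
    2 * \sum_(j < d) partial j phi x * partial j (laplacian phi) x.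
  rewrite [X in _ = 2 * X + _]exchange_big /= !mulr_sumr -big_split/=.
  apply: eq_bigr => j _.
  by rewrite laplacian_sqr// laplacian_partial.
have -> : divergence (current f) x =
    2 * (\sum_(j < d) partial j phi x * partial j (laplacian phi) x) -
    2 * ((mass f - laplacian phi x) * laplacian phi x).
  rewrite [in X in _ - X]/laplacian mulr_sumr !mulr_sumr -sumrB; apply: eq_bigr => i _.
  have -> : current f i = fun y => -2 * ((mass f - laplacian phi y) * partial i phi y).
    by apply/funext => y; rewrite /current rE.
  have CB : Cinfty (fun y => mass f - laplacian phi y).
    by apply: CinftyB => //; exact: Cinfty_cst.
  rewrite partialZ; last exact: CinftyM.
  rewrite partialM// partialB//; last exact: Cinfty_cst.
  have -> : partial i (fun=> mass f) x = 0 by exact: derive_cst.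
  rewrite -/(laplacian phi x); ring.
move: (laplacian phi x) (mass f) => l m.
set A := \sum_(i < d) _; set B := \sum_(j < d) _; move: A B => A B; ring.
Qed.

End bracket_laplacian.

(** In dimension two the squared Laplacian minus the squared Hessian is twice the Hessian
    determinant, and second derivatives of the potential are first derivatives of the field up to
    sign. *)
Lemma laplacian_TUU_derivative2 {R : realType} (f : 'rV[R]_2 * 'rV[R]_2 -> R)
    (i1 i2 : 'I_2) x : smooth f -> i1 = 0%N :> nat -> i2 = 1%N :> nat ->
  - laplacian (TUU_derivative f) x =
  - 2 * mass f * laplacian (potential f) x
  - 4 * partial i1 (field f i2) x * partial i2 (field f i1) x
  + 4 * partial i1 (field f i1) x * partial i2 (field f i2) x.
Proof.
move=> sf e1 e2; have [[_ Cp] _ _] := potentialP sf.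
have -> : i1 = ord0 by apply: val_inj.
have -> : i2 = lift ord0 ord0 by apply: val_inj.
have sum2 (F : 'I_2 -> R) : \sum_(i < 2) F i = F ord0 + F (lift ord0 ord0).
  by rewrite !big_ord_recl big_ord0 addr0.
rewrite laplacian_TUU_derivative//.
have Cpi i : Cinfty (partial i (potential f)) by exact: Cinfty_derive.
have fE i j : partial i (field f j) x = - partial i (partial j (potential f)) x.
  exact: partialN.
have lE : laplacian (potential f) x =
    partial ord0 (partial ord0 (potential f)) x +
    partial (lift ord0 ord0) (partial (lift ord0 ord0) (potential f)) x := sum2 _.
have dE := etrans (sum2 (fun i => \sum_(j < 2) partial i (partial j (potential f)) x ^+ 2))
  (f_equal2 +%R (sum2 _) (sum2 _)).
rewrite dE lE !fE (@partialC _ _ (potential f) (lift ord0 ord0) ord0)//.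
move: (partial ord0 (partial ord0 (potential f)) x) => p.
move: (partial ord0 (partial (lift ord0 ord0) (potential f)) x) => q.
move: (partial (lift ord0 ord0) (partial (lift ord0 ord0) (potential f)) x) => r.
move: (mass f) => m; ring.
Qed.

Lemma partial_TUU_derivative1 {R : realType} (f : 'rV[R]_1 * 'rV[R]_1 -> R)
    (i : 'I_1) x : smooth f ->
  partial i (TUU_derivative f) x = - 2 * mass f * field f i x.
Proof.
move=> sf; have [Cp _ _] := potentialP sf; have CK := perC_TUU_derivative sf.
pose W y := TUU_derivative f y + (- 2 * mass f) * potential f y.
have CW : perC W by apply: perCD => //; exact: perCZ.
have W0 y : laplacian W y = 0.
  rewrite laplacianD; [|exact: CK.2|exact: CinftyZ Cp.2].
  rewrite -[X in X + _]opprK laplacian_TUU_derivative//.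
  have sum1 (F : 'I_1 -> R) : \sum_(j < 1) F j = F ord0 by rewrite big_ord_recl big_ord0 addr0.
  have lE : laplacian (potential f) y = partial ord0 (partial ord0 (potential f)) y := sum1 _.
  have -> : laplacian (fun y => - 2 * mass f * potential f y) y =
      - 2 * mass f * laplacian (potential f) y.
    rewrite lE -partialZ; last exact: (perC_partial _ Cp).2.
    transitivity (partial ord0 (partial ord0 (fun y => - 2 * mass f * potential f y)) y).
      exact: sum1.
    by congr (partial ord0 _ y); apply/funext => z; rewrite partialZ//; exact: Cp.2.
  rewrite lE !sum1.
  move: (partial ord0 _ y) (mass f) => p m; ring.
(* Uniqueness is applied to [partial i W] rather than to [W]: it is harmonic as well, and as a
   derivative it has mean zero. *)
have : partial i W = fun=> 0.
  apply: poisson_unique; [exact: perC_partial|exact: perC_cst|exact: int_torus_partial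
    |by rewrite int_torus_cst mul0r|move=> y].
  rewrite laplacian_partial; last exact: CW.2.
  rewrite (funext W0) [LHS]derive_cst /laplacian big1// => j _.
  rewrite (_ : partial j (fun=> 0) = fun=> 0); first exact: derive_cst.
  by apply/funext => z; exact: derive_cst.
move=> /(congr1 (fun g => g x)).
rewrite partialD; [|exact: CK.2|exact: CinftyZ Cp.2].
rewrite partialZ; last exact: Cp.2.
by move=> /eqP; rewrite addr_eq0 => /eqP ->; rewrite /field mulrN.
Qed.

Local Close Scope classical_set_scope.

Theorem proposition2p2 (R : realType) (d : nat) (hd : (1 <= d <= 3)%N)
    (f : 'rV[R]_d * 'rV[R]_d -> R) (hf : smooth f) :
  let TUU : functional :=
    poisson_bracket (poisson_bracket kinetic electric) electric in
  let phi := potential f in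
  let m := mass f in
  let E := field f in
  exists K : 'rV[R]_d -> R,
    [/\ is_frechet_derivative TUU f (fun z => K z.1),
        frechet_derivative TUU f = (fun z => K z.1),
        forall x, - laplacian K x =
          - 2 * m * laplacian phi x
          - 2 * (\sum_(i < d) \sum_(j < d) partial i (partial j phi) x ^+ 2)
          + 2 * laplacian phi x ^+ 2,
        d = 2%N -> forall i1 i2 : 'I_d,
          i1 = 0%N :> nat -> i2 = 1%N :> nat ->
          forall x, - laplacian K x =
            - 2 * m * laplacian phi x
            - 4 * partial i1 (E i2) x * partial i2 (E i1) x
            + 4 * partial i1 (E i1) x * partial i2 (E i2) x
      & d = 1%N -> forall (i : 'I_d) x, partial i K x = - 2 * m * E i x].
Proof.
move=> TUU phi m E; have HK := is_frechet_TUU hf.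
exists (TUU_derivative f); split.
- exact: HK.
- exact: frechet_derivativeE HK.
- by move=> x; exact: laplacian_TUU_derivative.
- move=> d2; rewrite {}/TUU {}/phi {}/m {}/E; subst d => i1 i2 e1 e2 x.
  exact: laplacian_TUU_derivative2.
- move=> d1; rewrite {}/TUU {}/phi {}/m {}/E; subst d => i x.
  exact: partial_TUU_derivative1.
Qed.
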